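(* Let $\mathfrak g$ be one of $\mathfrak{so}_{2n+1}$, $\mathfrak{sp}_{2n}$, $\mathfrak{so}_{2n}$, where $n\ge2$ if $\mathfrak g=\mathfrak{sp}_{2n}$ and $n\ge3$ if $\mathfrak g=\mathfrak{so}_{2n}$, and let $V$ be the first fundamental $U_{r,s}(\mathfrak g)$-module described in the context. Then, as $U_{r,s}(\mathfrak g)$-modules, $$V\otimes V\simeq L(2\varepsilon_1)\oplus L(\varepsilon_1+\varepsilon_2)\oplus L(0),$$ where $L(\lambda)$ denotes the irreducible $U_{r,s}(\mathfrak g)$-module of highest weight $\lambda$ (and $\varepsilon_2:=0$ when $\mathfrak g=\mathfrak{so}_3$).
   Context: $\mathbb K$ is an algebraically closed field containing $\mathbb C(r,s)$ with $r,s$ indeterminates. **Root data.** $\varepsilon_1,\dots,\varepsilon_n$ is an orthogonal basis of $\mathbb R^n$ with $(\varepsilon_i,\varepsilon_i)=2$ for $\mathfrak{so}_{2n+1}$ and $(\varepsilon_i,\varepsilon_i)=1$ for $\mathfrak{sp}_{2n},\mathfrak{so}_{2n}$. $\alpha_i=\varepsilon_i-\varepsilon_{i+1}$ for $i<n$, and $\alpha_n=\varepsilon_n$, $2\varepsilon_n$, $\varepsilon_{n-1}+\varepsilon_n$ for $\mathfrak{so}_{2n+1},\mathfrak{sp}_{2n},\mathfrak{so}_{2n}$ respectively. $c_{ij}=2(\alpha_i,\alpha_j)/(\alpha_i,\alpha_i)$, $d_i=(\alpha_i,\alpha_i)/2$, $r_i=r^{d_i}$, $s_i=s^{d_i}$.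 $\langle\cdot,\cdot\rangle$ is the bilinear form on $\bigoplus\mathbb Z\varepsilon_i$ with $\langle\varepsilon_i,\varepsilon_i\rangle=\kappa$, $\langle\varepsilon_i,\varepsilon_j\rangle=-\kappa$ for $i<j$, $=\kappa$ for $i>j$, where $\kappa=1$ for $\mathfrak{so}_{2n+1}$ and $\kappa=\frac12$ for $\mathfrak{sp}_{2n},\mathfrak{so}_{2n}$ (so $\langle\alpha_i,\alpha_j\rangle=d_ic_{ij}$, $d_i$, $0$ for $i<j$, $i=j$, $i>j$, except that $\langle\alpha_{n-1},\alpha_n\rangle=-1=-\langle\alpha_n,\alpha_{n-1}\rangle$ for $\mathfrak{so}_{2n}$). **Algebra.** $[m]_{r,s}=\frac{r^m-s^m}{r-s}$, $[m]_{r,s}!=[m]_{r,s}\cdots[1]_{r,s}$, $\genfrac{[}{]}{0pt}{}{m}{k}_{r,s}=\frac{[m]_{r,s}!}{[m-k]_{r,s}![k]_{r,s}!}$. $U_{r,s}(\mathfrak g)$ is the associative $\mathbb K$-algebra generated by $e_i,f_i,\omega_i^{\pm1},(\omega_i')^{\pm1}$ ($1\le i\le n$) with relations: all $\omega_i^{\pm1},(\omega'_j)^{\pm1}$ commute and $\omega_i\omega_i^{-1}=1=\omega_i'(\omega_i')^{-1}$; $\omega_ie_j=r^{\langle\alpha_j,\alpha_i\rangle}s^{-\langle\alpha_i,\alpha_j\rangle}e_j\omega_i$, $\omega_if_j=r^{-\langle\alpha_j,\alpha_i\rangle}s^{\langle\alpha_i,\alpha_j\rangle}f_j\omega_i$,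 $\omega_i'e_j=r^{-\langle\alpha_i,\alpha_j\rangle}s^{\langle\alpha_j,\alpha_i\rangle}e_j\omega_i'$, $\omega_i'f_j=r^{\langle\alpha_i,\alpha_j\rangle}s^{-\langle\alpha_j,\alpha_i\rangle}f_j\omega_i'$; $e_if_j-f_je_i=\delta_{ij}\frac{\omega_i-\omega_i'}{r_i-s_i}$; and for $i\ne j$, $\sum_{k=0}^{1-c_{ij}}(-1)^k\genfrac{[}{]}{0pt}{}{1-c_{ij}}{k}_{r_i,s_i}(r_is_i)^{k(k-1)/2}(rs)^{k\langle\alpha_j,\alpha_i\rangle}e_i^{1-c_{ij}-k}e_je_i^k=0$ and the same with $e_i^{1-c_{ij}-k}e_je_i^k$ replaced by $f_i^kf_jf_i^{1-c_{ij}-k}$. Tensor products use the coproduct with $\omega_i,\omega_i'$ group-like, $\Delta(e_i)=e_i\otimes1+\omega_i\otimes e_i$, $\Delta(f_i)=1\otimes f_i+f_i\otimes\omega_i'$. **Weights.** A vector $v$ has weight $\lambda\in\bigoplus\mathbb Z\varepsilon_i$ if $\omega_iv=r^{\langle\lambda,\alpha_i\rangle}s^{-\langle\alpha_i,\lambda\rangle}v$ and $\omega_i'v=r^{-\langle\alpha_i,\lambda\rangle}s^{\langle\lambda,\alpha_i\rangle}v$ for all $i$ (all exponents are integers). $L(\lambda)$ is the irreducible module generated by a nonzero weight-$\lambda$ vector killed by all $e_i$. **Module $V$.** $N=2n+1$ for $\mathfrak{so}_{2n+1}$, $N=2n$ otherwise; $i'=N+1-i$; $V=\mathbb K^N$ with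 basis $v_1,\dots,v_N$, $E_{ij}v_k=\delta_{jk}v_i$; $v_k$ has weight $\varepsilon_k$ and $v_{k'}$ weight $-\varepsilon_k$ for $k\le n$, and $v_{n+1}$ has weight $0$ for $\mathfrak{so}_{2n+1}$. For $i<n$: $e_i=E_{i,i+1}-E_{(i+1)',i'}$, $f_i=E_{i+1,i}-(rs)^{-2\kappa}E_{i',(i+1)'}$. For $i=n$: $e_n=E_{n,n+1}-E_{n+1,n'}$, $f_n=(r^{-1}+s^{-1})(E_{n+1,n}-E_{n',n+1})$ for $\mathfrak{so}_{2n+1}$; $e_n=E_{nn'}$, $f_n=(rs)^{-1}E_{n'n}$ for $\mathfrak{sp}_{2n}$; $e_n=(rs)^{-1}E_{n-1,n'}-E_{n,(n-1)'}$, $f_n=E_{n',n-1}-E_{(n-1)',n}$ for $\mathfrak{so}_{2n}$. *)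

(* Defs.v *)
From HB Require Import structures.
From mathcomp Require Import all_boot all_order all_algebra.
From mathcomp.real_closed Require Import complex mxtens.
From mathcomp Require Import reals.

Set Implicit Arguments.
Unset Strict Implicit.
Unset Printing Implicit Defensive.

Import Order.TTheory GRing.Theory Num.Theory.
Local Open Scope ring_scope.

(* so_{2n+1}, sp_{2n}, so_{2n} *)
Inductive classical_type := TypeB | TypeC | TypeD.

(* The nat indices a, b of eps, E, V_weight and prime_idx count from 1; an
   ordinal i (of a simple root, a generator or a basis vector of V) stands for
   the index i.+1. *)

Section RootData.

Variables (g : classical_type) (n : nat).

Definition weight := 'rV[int]_n.

(* eps a = 0 unless 1 <= a <= n; in particular eps 2 = 0 for so_3. *)
Definition eps (a : nat) : weight := \row_(j < n) (j.+1 == a)%:R.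

Definition alpha (i : 'I_n) : weight :=
  let a := i.+1 in
  if (a < n)%N then eps a - eps a.+1 else
  match g with
  | TypeB => eps n
  | TypeC => eps n *+ 2
  | TypeD => eps n.-1 + eps n
  end.

(* the inner product ( , ) *)
Definition inner (la mu : weight) : rat :=
  \sum_(i < n) (if g is TypeB then 2 else 1) * (la 0 i)%:~R * (mu 0 i)%:~R.

Definition cartan (i j : 'I_n) : rat :=
  2 * inner (alpha i) (alpha j) / inner (alpha i) (alpha i).

Definition dsym (i : 'I_n) : rat := inner (alpha i) (alpha i) / 2.

Definition kappa : rat := if g is TypeB then 1 else 1 / 2.

(* the non-symmetric form < , > *)
Definition form (la mu : weight) : rat :=
  \sum_(i < n) \sum_(j < n)
    (la 0 i)%:~R * (mu 0 j)%:~R * (if (i < j)%N then - kappa else kappa).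

(* a' = N + 1 - a *)
Definition dimV : nat := if g is TypeB then n.*2.+1 else n.*2.
Definition prime_idx (a : nat) : nat := (dimV.+1 - a)%N.

End RootData.

Section GeneratorActions.

Variables (K : fieldType) (n : nat).

(* e_i, f_i, omega_i, omega_i^-1, omega'_i, (omega'_i)^-1 *)
Inductive generator :=
  | Ge of 'I_n | Gf of 'I_n
  | Gw of 'I_n | Gwinv of 'I_n | Gw' of 'I_n | Gw'inv of 'I_n.

Definition toral (x : generator) : bool :=
  match x with Ge _ | Gf _ => false | _ => true end.

(* A vector space on which each generator acts; it is a module over the algebra
   presented by a set of relations iff these relations hold between the
   actions (see is_Urs_module). *)
Record gmodule := Gmodule {
  carrier :> lmodType K;
  act : generator -> {linear carrier -> carrier} }.

Definition submodule (M : gmodule) (P : M -> Prop) : Prop :=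
  [/\ P 0,
      forall (c : K) (u v : M), P u -> P v -> P (c *: u + v)
    & forall (x : generator) (u : M), P u -> P (act M x u)].

Definition irreducible (M : gmodule) : Prop :=
  (exists v : M, v <> 0) /\
  forall P : M -> Prop, submodule P ->
    (forall v, P v -> v = 0) \/ (forall v, P v).

Definition generated_by (M : gmodule) (v : M) : Prop :=
  forall P : M -> Prop, submodule P -> P v -> forall u, P u.

Definition isomorphic (M M' : gmodule) : Prop :=
  exists2 phi : {linear M -> M'}, bijective phi
    & forall (x : generator) (u : M), phi (act M x u) = act M' x (phi u).

Section DirectSum.

Variables M M' : gmodule.

Definition dsum_act (x : generator) (u : (M * M')%type) : (M * M')%type :=
  (act M x u.1, act M' x u.2).

Fact dsum_act_is_linear x : linear (dsum_act x).
Proof. by move=> c u v; rewrite /dsum_act /= !linearP. Qed.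

HB.instance Definition _ (x : generator) :=
  GRing.isLinear.Build K (M * M')%type (M * M')%type *:%R (dsum_act x)
    (dsum_act_is_linear x).

Definition dsum : gmodule := Gmodule (fun x => dsum_act x).

End DirectSum.

Definition matrix_gmodule (m : nat) (rho : generator -> 'M[K]_m) : gmodule :=
  @Gmodule 'cV[K]_m (fun x => mulmx (rho x)).

(* The tensor product of two finite-dimensional modules, K^m (x) K^m' being
   identified with K^(m * m') through the Kronecker product. *)
Definition tensor_rep (m m' : nat) (rho : generator -> 'M[K]_m)
    (rho' : generator -> 'M[K]_m') (x : generator) : 'M[K]_(m * m') :=
  match x with
  | Ge i => rho (Ge i) *t 1%:M + rho (Gw i) *t rho' (Ge i)
  | Gf i => 1%:M *t rho' (Gf i) + rho (Gf i) *t rho' (Gw' i)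
  | _ => rho x *t rho' x
  end.

End GeneratorActions.

Section TwoParameter.

Variables (K : fieldType) (r s : K) (g : classical_type) (n : nat).

(* x ^ q for a rational q that is an integer, as all the exponents below are;
   the floor only converts q to type int. *)
Definition qpow (x : K) (q : rat) : K := x ^ Num.floor q.

Definition rs_pow (p q : rat) : K := qpow r p * qpow s q.

Definition qint (x y : K) (m : nat) : K := (x ^+ m - y ^+ m) / (x - y).
Definition qfact (x y : K) (m : nat) : K := \prod_(1 <= k < m.+1) qint x y k.
Definition qbinom (x y : K) (m k : nat) : K :=
  qfact x y m / (qfact x y (m - k) * qfact x y k).

Definition r_ (i : 'I_n) : K := qpow r (dsym g i).
Definition s_ (i : 'I_n) : K := qpow s (dsym g i).

Local Notation al := (alpha g).
Local Notation "<[ x , y ]>" := (form g x y).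

(* 1 - c_ij, a natural number for i != j *)
Definition serre_deg (i j : 'I_n) : nat := Num.truncn (1 - cartan g i j).

Definition serre_coef (i j : 'I_n) (k : nat) : K :=
  (-1) ^+ k * qbinom (r_ i) (s_ i) (serre_deg i j) k
  * (r_ i * s_ i) ^+ (k * k.-1)./2 * qpow (r * s) (k%:R * <[al j, al i]>).

Record is_Urs_module (M : gmodule K n) : Prop := {
  Urs_toral_comm : forall (x y : generator n) (u : M), toral x -> toral y ->
    act M x (act M y u) = act M y (act M x u);
  Urs_wV : forall i (u : M), act M (Gw i) (act M (Gwinv i) u) = u;
  Urs_w'V : forall i (u : M), act M (Gw' i) (act M (Gw'inv i) u) = u;
  Urs_we : forall i j (u : M),
    act M (Gw i) (act M (Ge j) u) =
    rs_pow <[al j, al i]> (- <[al i, al j]>) *: act M (Ge j) (act M (Gw i) u);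
  Urs_wf : forall i j (u : M),
    act M (Gw i) (act M (Gf j) u) =
    rs_pow (- <[al j, al i]>) <[al i, al j]> *: act M (Gf j) (act M (Gw i) u);
  Urs_w'e : forall i j (u : M),
    act M (Gw' i) (act M (Ge j) u) =
    rs_pow (- <[al i, al j]>) <[al j, al i]> *: act M (Ge j) (act M (Gw' i) u);
  Urs_w'f : forall i j (u : M),
    act M (Gw' i) (act M (Gf j) u) =
    rs_pow <[al i, al j]> (- <[al j, al i]>) *: act M (Gf j) (act M (Gw' i) u);
  Urs_ef : forall i j (u : M),
    act M (Ge i) (act M (Gf j) u) - act M (Gf j) (act M (Ge i) u) =
    (if i == j then (r_ i - s_ i)^-1 *: (act M (Gw i) u - act M (Gw' i) u)
     else 0);
  Urs_serre_e : forall i j (u : M), i != j ->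
    \sum_(0 <= k < (serre_deg i j).+1) serre_coef i j k *:
      iter (serre_deg i j - k) (act M (Ge i))
        (act M (Ge j) (iter k (act M (Ge i)) u)) = 0;
  Urs_serre_f : forall i j (u : M), i != j ->
    \sum_(0 <= k < (serre_deg i j).+1) serre_coef i j k *:
      iter k (act M (Gf i))
        (act M (Gf j) (iter (serre_deg i j - k) (act M (Gf i)) u)) = 0
}.

Definition w_eigen (la : weight n) (i : 'I_n) : K :=
  rs_pow <[la, al i]> (- <[al i, la]>).
Definition w'_eigen (la : weight n) (i : 'I_n) : K :=
  rs_pow (- <[al i, la]>) <[la, al i]>.

Definition has_weight (M : gmodule K n) (v : M) (la : weight n) : Prop :=
  forall i, act M (Gw i) v = w_eigen la i *: v /\
            act M (Gw' i) v = w'_eigen la i *: v.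

(* M is (a copy of) L(la) *)
Definition is_L (la : weight n) (M : gmodule K n) : Prop :=
  [/\ is_Urs_module M, irreducible M
    & exists v : M, [/\ v <> 0, has_weight v la,
                        forall i, act M (Ge i) v = 0 & generated_by v]].

Local Notation N := (dimV g n).
Local Notation pr := (prime_idx g n).

Definition E (a b : nat) : 'M[K]_N :=
  \matrix_(i, j) ((i.+1 == a) && (j.+1 == b))%:R.

Definition V_weight (a : nat) : weight n :=
  if (a <= n)%N then eps n a else
  if (pr a <= n)%N then - eps n (pr a) else 0.

Definition V_e (i : 'I_n) : 'M[K]_N :=
  let a := i.+1 in
  if (a < n)%N then E a a.+1 - E (pr a.+1) (pr a) else
  match g with
  | TypeB => E n n.+1 - E n.+1 (pr n)
  | TypeC => E n (pr n)
  | TypeD => (r * s)^-1 *: E n.-1 (pr n) - E n (pr n.-1)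
  end.

Definition V_f (i : 'I_n) : 'M[K]_N :=
  let a := i.+1 in
  if (a < n)%N
  then E a.+1 a - qpow (r * s) (- (2 * kappa g)) *: E (pr a) (pr a.+1) else
  match g with
  | TypeB => (r^-1 + s^-1) *: (E n.+1 n - E (pr n) n.+1)
  | TypeC => (r * s)^-1 *: E (pr n) n
  | TypeD => E (pr n) n.-1 - E (pr n.-1) n
  end.

Definition V_rep (x : generator n) : 'M[K]_N :=
  match x with
  | Ge i => V_e i
  | Gf i => V_f i
  | Gw i => diag_mx (\row_a w_eigen (V_weight a.+1) i)
  | Gwinv i => diag_mx (\row_a (w_eigen (V_weight a.+1) i)^-1)
  | Gw' i => diag_mx (\row_a w'_eigen (V_weight a.+1) i)
  | Gw'inv i => diag_mx (\row_a (w'_eigen (V_weight a.+1) i)^-1)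
  end.

Definition VV : gmodule K n := matrix_gmodule (tensor_rep V_rep V_rep).

End TwoParameter.

(* Main.v *)
(** A vector killed by all e_i is called singular. A direct computation shows that
the singular vectors of V (x) V are spanned by v_1 (x) v_1, by
v_1 (x) v_2 - c v_2 (x) v_1 and by an invariant vector sum_a u_a v_a (x) v_a'.
There is a diagonal bilinear form on V (x) V for which f_i is the adjoint of e_i
and the toral generators are self-adjoint; the three singular vectors are
orthogonal and of nonzero square length, because these square lengths are values
of rational functions in r, s that are positive at r = s = 1.

Let M_j be the span of all f-words applied to the j-th singular vector. It is a
submodule, and the M_j are pairwise orthogonal. Every nonzero submodule contains a
nonzero singular vector since the e_i are jointly nilpotent; hence each M_j is
irreducible, and the orthogonal complement of their sum vanishes.

The Serre element in e_i, e_j commutes with all f_k by the remaining relations and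
kills the singular vectors, so it vanishes on the M_j, that is on V (x) V; by
adjunction so does the one in f_i, f_j. *)

Require Import Defs.
From HB Require Import structures.
From mathcomp Require Import all_boot all_order all_algebra.
From mathcomp.real_closed Require Import complex mxtens.
From mathcomp Require Import reals boolp ring zify.
Import Defs.

Set Implicit Arguments.
Unset Strict Implicit.
Unset Printing Implicit Defensive.

Import Order.TTheory GRing.Theory Num.Theory.
Local Open Scope ring_scope.

(** * The bilinear form and the weights of V *)

(** The role of complete reducibility is played by the form: the submodule generated by a singular
    vector splits off once that vector is not isotropic. The square lengths are sums whose length
    grows with n and whose shape depends on the type. They are never evaluated; it is enough that
    their terms lie in a cone closed under sums, products and inverses. Of the scalars to be
    inverted only r_i - s_i falls outside the cone, and it is a multiple of r - s. The Serre
    relations are the only ones that do not pass easily to a tensor product, so they are checked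
    neither on V nor through the coproduct. The argument by commutation with the f_k needs only two
    identities for quantum binomials of degree at most 3. The three types are treated together: each
    simple root is a difference of weights of two basis vectors v_p, v_q, and e_i = c1 E_{pq} + c2
    E_{q'p'}. The type enters through the choice of p, the four coefficients of e_i and f_i, and
    kappa. *)

Section Form.

Variables (g : classical_type) (n : nat).
Implicit Types (la mu nu : weight n).

Lemma formDl la mu nu : form g (la + mu) nu = form g la nu + form g mu nu.
Proof.
rewrite /form -big_split /=; apply: eq_bigr => i _.
by rewrite -big_split /=; apply: eq_bigr => j _; rewrite mxE rmorphD /= !mulrDl.
Qed.

Lemma formDr la mu nu : form g nu (la + mu) = form g nu la + form g nu mu.
Proof.
rewrite /form -big_split /=; apply: eq_bigr => i _.
rewrite -big_split /=; apply: eq_bigr => j _.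
by rewrite mxE rmorphD /= mulrDr !mulrDl.
Qed.

Lemma formNl la nu : form g (- la) nu = - form g la nu.
Proof.
rewrite /form -sumrN; apply: eq_bigr => i _.
by rewrite -sumrN; apply: eq_bigr => j _; rewrite mxE rmorphN /= !mulNr.
Qed.

Lemma formNr la nu : form g nu (- la) = - form g nu la.
Proof.
rewrite /form -sumrN; apply: eq_bigr => i _.
rewrite -sumrN; apply: eq_bigr => j _.
by rewrite mxE rmorphN /= mulrN !mulNr.
Qed.

Lemma form0l nu : form g 0 nu = 0.
Proof. by rewrite -(subrr nu) formDl formNl subrr. Qed.

Lemma form0r nu : form g nu 0 = 0.
Proof. by rewrite -(subrr nu) formDr formNr subrr. Qed.

Definition formE := (formDl, formDr, formNl, formNr, form0l, form0r).

(** The off-diagonal values -kappa and kappa cancel, and the diagonal contributes 2 kappa. Cartan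
    integers can thus be computed from [form]. *)
Lemma form_sym la mu : form g la mu + form g mu la = inner g la mu.
Proof.
rewrite /form [X in _ + X]exchange_big /= -big_split /= /inner.
apply: eq_bigr => i _; rewrite -big_split /= (bigD1 i) //= big1 ?addr0.
  by rewrite ltnn /kappa; case: g; field.
by move=> j; rewrite neq_ltn => /orP[] h; rewrite h ltnNge ltnW //=; ring.
Qed.

Lemma form_row la mu :
  form g la mu = \sum_k (la 0 k)%:~R * form g (eps n k.+1) mu.
Proof.
apply: eq_bigr => k _.
rewrite /form [X in _ * X](bigD1 k) //= [X in _ * (_ + X)]big1 ?addr0 => [|i
  ik].
  by rewrite mulr_sumr; apply: eq_bigr => j _; rewrite mxE eqxx mul1r !mulrA.
by apply: big1 => j _; rewrite mxE eqSS (inj_eq val_inj) (negPf ik) !mul0r.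
Qed.

Local Notation N := (dimV g n).

Definition wt (a : 'I_N) : weight n := V_weight g n a.+1.

Definition wt_sign (a : 'I_N) : int :=
  if (a < n)%N then 1 else if (N - a <= n)%N then -1 else 0.

(** For the vector of weight 0 of so_{2n+1} this is n, outside the range of coordinates; [wt_sign]
    is 0 there. *)
Definition wt_index (a : 'I_N) : nat := if (a < n)%N then nat_of_ord a else
  (N.-1 - a)%N.

Lemma dimV_bounds : (n.*2 <= N <= n.*2.+1)%N.
Proof. by rewrite /dimV; case: g; rewrite !leqnn ?leqnSn. Qed.

Lemma wtE a j : wt a 0 j = wt_sign a * (nat_of_ord j == wt_index a)%:R.
Proof.
rewrite /wt /V_weight /wt_sign /wt_index /prime_idx.
case: (ltnP a n) => an; first by rewrite mxE eqSS mul1r.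
have -> : (N.+1 - a.+1 = N - a)%N by [].
case: ifP => h; last by rewrite mxE mul0r.
rewrite !mxE mulN1r; congr (- (_)%:R); congr nat_of_bool.
have := ltn_ord a; lia.
Qed.

Definition form_sign (a b : 'I_N) : int :=
  wt_sign a * wt_sign b * (if (wt_index a < wt_index b)%N then -1 else 1).

Lemma wt_index_lt a : wt_sign a != 0 -> (wt_index a < n)%N.
Proof.
rewrite /wt_sign /wt_index; case: ltnP => //; case: ifP => //.
by have := ltn_ord a; lia.
Qed.

Lemma form_wt a b : form g (wt a) (wt b) = kappa g * (form_sign a b)%:~R.
Proof.
rewrite /form_sign; case: (eqVneq (wt_sign a) 0) => [a0|/wt_index_lt ha].
  rewrite a0 !mul0r mulr0 /form big1 // => i _; rewrite big1 // => j _.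
  by rewrite wtE a0 !mul0r.
case: (eqVneq (wt_sign b) 0) => [b0|/wt_index_lt hb].
  rewrite b0 mulr0 mul0r mulr0 /form big1 // => i _; rewrite big1 // => j _.
  by rewrite (wtE b) b0 mul0r mulr0 mul0r.
rewrite /form (bigD1 (Ordinal ha)) //= [X in _ + X]big1 ?addr0; last first.
  by move=> i ni; rewrite big1 // => j _; rewrite wtE -(inj_eq val_inj) /= in
    ni *;
     rewrite (negPf ni) mulr0 !mul0r.
rewrite (bigD1 (Ordinal hb)) //= [X in _ + X]big1 ?addr0; last first.
  by move=> i ni; rewrite (wtE b) -(inj_eq val_inj) /= in ni *;
     rewrite (negPf ni) !mulr0 mul0r.
by rewrite !wtE /= !eqxx !mulr1; case: ifP => _; rewrite ?mulrN1 ?mulr1;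
   rewrite ?rmorphN /= rmorphM /=; ring.
Qed.

Lemma wt_rev a : wt (rev_ord a) = - wt a.
Proof.
apply/rowP => j; rewrite mxE !wtE /wt_sign /wt_index /=.
have := ltn_ord j; have := ltn_ord a; have := dimV_bounds => ? ? ?.
have e1 : (N - (N - a.+1) = a.+1)%N by lia.
have e2 : (N.-1 - (N - a.+1) = a)%N by lia.
rewrite e1 e2; case: (ltnP a n) => an.
  have -> : (N - a.+1 < n)%N = false by lia.
  by rewrite mul1r mulN1r.
have -> : (N - a.+1 < n)%N = (N - a <= n)%N by lia.
case: ifP => h; first by rewrite mul1r mulN1r opprK; congr ((_ == _)%:R); lia.
by rewrite !mul0r oppr0.
Qed.

Hypothesis hn : (match g with TypeB => 1 | TypeC => 2 | TypeD => 3 end <= n)%N.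

(** Simple roots are differences of weights of consecutive basis vectors, except the last root of
    so_{2n}: eps_{n-1} + eps_n is the weight of v_{n-1} minus that of v_{n'}, so it starts one place
    earlier. *)
Definition end1_nat (i : nat) : nat :=
  if g is TypeD then (if i.+1 == n then i.-1 else i) else i.

Fact end1_subproof (i : 'I_n) : (end1_nat i < N)%N.
Proof.
by rewrite /end1_nat; move: hn; rewrite /dimV; case: g; have := ltn_ord i;
  try case: ifP; lia.
Qed.

Fact end2_subproof (i : 'I_n) : (i.+1 < N)%N.
Proof. by move: hn; rewrite /dimV; case: g; have := ltn_ord i; lia. Qed.

(* e_i is supported on the matrix entries (p, q) and (q', p') with p = end1 i
   and q = end2 i. *)
Definition end1 i : 'I_N := Ordinal (end1_subproof i).
Definition end2 i : 'I_N := Ordinal (end2_subproof i).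

Lemma alpha_wt i : alpha g i = wt (end1 i) - wt (end2 i).
Proof.
apply/rowP => j; rewrite !mxE !wtE /wt_sign /wt_index /= /alpha /end1_nat.
have ? := ltn_ord j; have ? := ltn_ord i; move: hn; rewrite /dimV /eps.
case: (ltnP i.+1 n) => hi.
  case: g => _; rewrite !mxE ?mul1r !eqSS.
  - have -> : (i < n)%N by lia. by rewrite mul1r.
  - have -> : (i < n)%N by lia. by rewrite mul1r.
  - have -> : (i.+1 == n) = false by lia.
    have -> : (i < n)%N by lia. by rewrite mul1r.
have ei : i.+1 = n by lia.
rewrite ei eqxx; case: g => h /=.
- have -> : (i < n)%N by lia. have -> : (n.*2.+1 - n <= n)%N = false by lia.
  by rewrite mxE mul1r mul0r subr0; congr (_%:R); lia.
- have -> : (i < n)%N by lia. have -> : (n.*2 - n <= n)%N by lia.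
  rewrite !mxE mul1r mulN1r opprK; congr (_%:R + _%:R); lia.
- have -> : (i.-1 < n)%N by lia. have -> : (n.*2 - n <= n)%N by lia.
  rewrite !mxE mul1r mulN1r opprK; congr (_%:R + _%:R); lia.
Qed.

End Form.

Section Roots.

Variables (g : classical_type) (n : nat).
Hypothesis hn : (match g with TypeB => 1 | TypeC => 2 | TypeD => 3 end <= n)%N.

Local Notation N := (dimV g n).
Local Notation al := (alpha g).
Local Notation p := (end1 hn).
Local Notation q := (end2 hn).
Local Notation wt := (@wt g n).

Lemma wt_sign_CD (a : 'I_N) : g <> TypeB -> wt_sign a = 1 \/ wt_sign a = -1.
Proof.
rewrite /wt_sign => gB; case: ltnP; first by left.
have eN : N = n.*2 by rewrite /dimV; case: g gB.
by case: ifP; [right | lia].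
Qed.

Lemma form_sign_CD (a b : 'I_N) : g <> TypeB ->
  form_sign a b = 1 \/ form_sign a b = -1.
Proof.
move=> gB; rewrite /form_sign.
by case: (wt_sign_CD a gB) => ->; case: (wt_sign_CD b gB) => ->;
  case: ifP => _; [right|left|left|right|left|right|right|left].
Qed.

Lemma kappaP : (g = TypeB /\ kappa g = 1) \/ (g <> TypeB /\ kappa g = 2^-1).
Proof. by rewrite /kappa; case: g; [left|right|right]; split;
  rewrite // mul1r. Qed.

Lemma form_wt_alpha a i : form g (wt a) (al i) =
  kappa g * (form_sign a (p i) - form_sign a (q i))%:~R.
Proof. by rewrite alpha_wt !formE !form_wt intrD rmorphN /= mulrDr mulrN. Qed.

Lemma form_alpha_wt a i : form g (al i) (wt a) =
  kappa g * (form_sign (p i) a - form_sign (q i) a)%:~R.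
Proof. by rewrite alpha_wt !formE !form_wt intrD rmorphN /= mulrDr mulrN. Qed.

(** When kappa is 1/2, no weight of V is 0, so both signs are 1 or -1 and their difference is
    even. *)
Lemma kappa_diff_int (a b c d : 'I_N) :
  kappa g * (form_sign a b - form_sign c d)%:~R \is a Num.int.
Proof.
case: kappaP => [[_ ->]|[gB ->]]; first by rewrite mul1r intr_int.
by case: (form_sign_CD a b gB) => ->; case: (form_sign_CD c d gB) => ->.
Qed.

Lemma kappa_form_int (a b : 'I_N) :
  kappa g - form g (wt a) (wt b) \is a Num.int /\
  kappa g + form g (wt a) (wt b) \is a Num.int.
Proof.
rewrite form_wt; case: kappaP => [[_ ->]|[gB ->]].
  by rewrite mul1r; split; [rewrite rpredB|rewrite rpredD];
    rewrite ?rpred1 ?intr_int.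
by case: (form_sign_CD a b gB) => ->.
Qed.

Lemma eps_wt (k : 'I_n) : exists a : 'I_N, eps n k.+1 = wt a.
Proof.
have h : (k < N)%N by have := dimV_bounds g n; have := ltn_ord k; lia.
by exists (Ordinal h); rewrite /wt /V_weight /= ltn_ord.
Qed.

(** [qpow] takes a floor, so exponents may be added only once they are known to be integers. Each
    eps_k is a weight of V, which reduces the claim to [kappa_diff_int]. *)
Lemma form_alphar_int (la : weight n) i : form g la (al i) \is a Num.int.
Proof.
rewrite form_row rpred_sum // => k _; rewrite rpredM ?intr_int //.
by have [a ->] := eps_wt k; rewrite form_wt_alpha kappa_diff_int.
Qed.

Lemma form_alphal_int (la : weight n) i : form g (al i) la \is a Num.int.
Proof.
have -> : form g (al i) la = inner g la (al i) - form g la (al i).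
  by rewrite -form_sym; ring.
rewrite rpredB ?form_alphar_int // /inner rpred_sum // => k _.
by rewrite !rpredM ?intr_int //; case: g.
Qed.

Lemma end_signs i :
  [/\ wt_sign (p i) = 1, wt_index (p i) = end1_nat g n i,
      wt_sign (q i) = if (i.+1 < n)%N then 1 else if g is TypeB then 0 else -1
    & wt_index (q i) =
        if (i.+1 < n)%N then i.+1 else if g is TypeB then n else n.-1].
Proof.
have ? := ltn_ord i.
have lp : (end1_nat g n i < n)%N.
  by rewrite /end1_nat; case: g; try case: ifP; lia.
rewrite /wt_sign /wt_index /= lp; split=> //.
  case: ltnP => // ni; move: hn; rewrite /dimV.
  by case: g => h; case: ifP => //; lia.
by case: ltnP => // ni; move: hn; rewrite /dimV; case: g => h; lia.
Qed.

Definition form_end i : rat * rat * rat * rat :=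
  if (i.+1 < n)%N then (2 * kappa g, 0, 0, - (2 * kappa g)) else
  match g with
  | TypeB => (1, 1, 0, 0)
  | TypeC => (1, 1, -1, -1)
  | TypeD => (0, 1, -1, 0)
  end.

Lemma form_endE i : (form g (wt (p i)) (al i), form g (al i) (wt (p i)),
  form g (wt (q i)) (al i), form g (al i) (wt (q i))) = form_end i.
Proof.
rewrite !form_wt_alpha !form_alpha_wt /form_sign /form_end.
have [-> -> -> ->] := end_signs i; rewrite /end1_nat !ltnn.
have li := ltn_ord i; case: (ltnP i.+1 n) => ni.
  have -> : (i.+1 == n) = false by lia.
  by case: g; rewrite ?ltnSn ?ltnn; have -> : (i.+1 < i)%N = false by lia.
have ei : i.+1 = n by lia.
rewrite ei eqxx; move: hn; case: g => h.
- by rewrite !mulr0 !mul0r.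
- have -> : (i < n.-1)%N = false by lia.
  have -> : (n.-1 < i)%N = false by lia.
  by [].
- have -> : (i.-1 < n.-1)%N by lia.
  by have -> : (n.-1 < i.-1)%N = false by lia.
Qed.

End Roots.

(** * Exponent laws and eigenvalues of the toral generators *)

Section Eigenvalues.

Variables (K : fieldType) (r s : K) (g : classical_type) (n : nat).
Hypothesis hn : (match g with TypeB => 1 | TypeC => 2 | TypeD => 3 end <= n)%N.
Hypotheses (r0 : r != 0) (s0 : s != 0).

Local Notation N := (dimV g n).

Lemma qpow_int (x : K) (m : int) : qpow x m%:~R = x ^ m.
Proof. by rewrite /qpow intrKfloor. Qed.

Lemma qpowD (x : K) (a b : rat) : x != 0 -> a \is a Num.int ->
  b \is a Num.int -> qpow x (a + b) = qpow x a * qpow x b.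
Proof.
by move=> x0 /intrP[m ->] /intrP[k ->]; rewrite -intrD !qpow_int expfzDr.
Qed.

Lemma rs_pow_int (m k : int) : rs_pow r s m%:~R k%:~R = r ^ m * s ^ k.
Proof. by rewrite /rs_pow !qpow_int. Qed.

Lemma rs_powD (a b c d : rat) : a \is a Num.int -> b \is a Num.int ->
  c \is a Num.int -> d \is a Num.int ->
  rs_pow r s (a + b) (c + d) = rs_pow r s a c * rs_pow r s b d.
Proof. by move=> *; rewrite /rs_pow !qpowD // mulrACA. Qed.

Lemma rs_pow00 : rs_pow r s 0 0 = 1.
Proof. by rewrite -[0]/(0%:~R) rs_pow_int !expr0z mulr1. Qed.

Lemma rs_pow_neq0 a b : rs_pow r s a b != 0.
Proof. by rewrite mulf_neq0 // expfz_neq0. Qed.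

Lemma w_eigenD (la mu : weight n) i :
  w_eigen r s g (la + mu) i = w_eigen r s g la i * w_eigen r s g mu i.
Proof.
by rewrite /w_eigen !formE opprD rs_powD ?rpredN ?form_alphar_int
  ?form_alphal_int.
Qed.

Lemma w'_eigenD (la mu : weight n) i :
  w'_eigen r s g (la + mu) i = w'_eigen r s g la i * w'_eigen r s g mu i.
Proof.
by rewrite /w'_eigen !formE opprD rs_powD ?rpredN ?form_alphar_int
  ?form_alphal_int.
Qed.

Lemma w_eigen0 (i : 'I_n) : w_eigen r s g 0 i = 1.
Proof. by rewrite /w_eigen !formE oppr0 rs_pow00. Qed.

Lemma w'_eigen0 (i : 'I_n) : w'_eigen r s g 0 i = 1.
Proof. by rewrite /w'_eigen !formE oppr0 rs_pow00. Qed.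

Lemma w_eigen_neq0 (la : weight n) i : w_eigen r s g la i != 0.
Proof. exact: rs_pow_neq0. Qed.

Lemma w'_eigen_neq0 (la : weight n) i : w'_eigen r s g la i != 0.
Proof. exact: rs_pow_neq0. Qed.

End Eigenvalues.

(** * Root lengths, Cartan integers and Serre degrees *)

Section RootLengths.

Variables (g : classical_type) (n : nat).
Hypothesis hn : (match g with TypeB => 1 | TypeC => 2 | TypeD => 3 end <= n)%N.

Local Notation N := (dimV g n).
Local Notation al := (alpha g).
Local Notation wt := (@wt g n).

(** This is d_i = (alpha_i, alpha_i) / 2, which is also the value of <alpha_i, alpha_i>. *)
Definition root_length (i : 'I_n) : nat :=
  if (i.+1 < n)%N then (if g is TypeB then 2 else 1)
  else if g is TypeC then 2 else 1.

Lemma form_alpha_alpha (i : 'I_n) : form g (al i) (al i) = (root_length i)%:R.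
Proof.
rewrite {1}(alpha_wt hn) !formE.
have /= -> := congr1 (fun t => t.1.1.1 - t.1.2) (form_endE hn i).
by rewrite /form_end /root_length /kappa; case: ifP; case: g.
Qed.

Lemma inner_alpha_alpha (i : 'I_n) :
  inner g (al i) (al i) = 2 * (root_length i)%:R.
Proof. by rewrite -form_sym form_alpha_alpha mulr_natl mulr2n. Qed.

Lemma dsymE (i : 'I_n) : dsym g i = (root_length i)%:R.
Proof. by rewrite /dsym inner_alpha_alpha mulrAC divff // mul1r. Qed.

Lemma root_length_gt0 (i : 'I_n) : (0 < root_length i)%N.
Proof. by rewrite /root_length; case: ifP; case: g. Qed.

Lemma inner_wt (a b : 'I_N) : inner g (wt a) (wt b) = 2 * kappa g *
  (wt_sign a * wt_sign b * (wt_index a == wt_index b)%:R)%:~R.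
Proof.
rewrite -form_sym !form_wt -mulrDr -intrD /form_sign [2 * _]mulrC -[_ * 2 *
  _]mulrA.
congr (_ * _). rewrite -[2]/(2%:~R) -intrM; congr (_%:~R).
by case: ltngtP => _ /=; ring.
Qed.

Lemma inner_wt0 (a b : 'I_N) : a != b -> a != rev_ord b ->
  wt_sign a * wt_sign b * (wt_index a == wt_index b)%:R = 0.
Proof.
rewrite -!(inj_eq (@ord_inj _)) /= => ab ab'; apply/eqP.
rewrite mulf_eq0 mulf_eq0 -orbA; apply/or3P.
have [|a0] := eqVneq (wt_sign a) 0; first by constructor.
have [|b0] := eqVneq (wt_sign b) 0; first by constructor.
constructor 3; case: eqP => // e; exfalso; move: e ab ab' (wt_index_lt a0)
  (wt_index_lt b0).
rewrite /wt_index; have := ltn_ord a; have := ltn_ord b.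
by case: (ltnP a n) => ?; case: (ltnP b n) => ?; lia.
Qed.

Lemma innerDl (la mu nu : weight n) :
  inner g (la - mu) nu = inner g la nu - inner g mu nu.
Proof. by rewrite -!form_sym !formE; ring. Qed.

Lemma innerDr (la mu nu : weight n) :
  inner g nu (la - mu) = inner g nu la - inner g nu mu.
Proof. by rewrite -!form_sym !formE; ring. Qed.

(** In units of d_i these are the off-diagonal Cartan integers 0, -1, -2. So Serre degrees are at
    most 3, and the identities for quantum binomials can be checked degree by degree. *)
Lemma inner_alpha_cases (i j : 'I_n) : i != j ->
  [\/ inner g (al i) (al j) = 0,
      inner g (al i) (al j) = - (root_length i)%:R
    | inner g (al i) (al j) = - (2 * (root_length i)%:R)].
Proof.
rewrite -(inj_eq val_inj) /= => /eqP nij.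
rewrite !(alpha_wt hn) !innerDl !innerDr !inner_wt /root_length.
have [-> -> -> ->] := end_signs hn i; have [-> -> -> ->] := end_signs hn j.
rewrite /end1_nat; have li := ltn_ord i; have lj := ltn_ord j.
move: hn; case: (ltnP i.+1 n) => hi; case: (ltnP j.+1 n) => hj; last by lia.
- have -> : (i.+1 == n) = false by lia. have -> : (j.+1 == n) = false by lia.
  case: g => h; do 4!(case: eqP => ?); first [exfalso; lia
    | by constructor 1 | by constructor 2 | by constructor 3].
- have -> : (i.+1 == n) = false by lia. have -> : (j.+1 == n) by lia.
  case: g => h; do 4!(case: eqP => ?); first [exfalso; lia
    | by constructor 1 | by constructor 2 | by constructor 3].
- have -> : (j.+1 == n) = false by lia. have -> : (i.+1 == n) by lia.
  case: g => h; do 4!(case: eqP => ?); first [exfalso; lia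
    | by constructor 1 | by constructor 2 | by constructor 3].
Qed.

(** The truncation in [serre_deg] loses nothing, as 1 - c_ij is already a natural number. The second
    part lets [serre_scalars] eliminate <alpha_i, alpha_j> in favour of <alpha_j, alpha_i>. *)
Lemma serre_degE (i j : 'I_n) : i != j ->
  ((0 < serre_deg g i j <= 3)%N) /\ form g (al i) (al j) + form g (al j) (al i)
    =
     - ((root_length i * (serre_deg g i j).-1)%N%:R).
Proof.
move=> nij; have d0 : (root_length i)%:R != 0 :> rat.
  by rewrite pnatr_eq0 -lt0n root_length_gt0.
suff [m [m3 e]] : exists m, (m < 3)%N /\
    inner g (al i) (al j) = - (m%:R * (root_length i)%:R).
  have sm : serre_deg g i j = m.+1.
    rewrite /serre_deg /cartan inner_alpha_alpha e mulrN mulNr opprK.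
    suff -> : 2 * (m%:R * (root_length i)%:R) / (2 * (root_length i)%:R) = m%:R
      :> rat.
      by rewrite addrC natr1 natrK.
    by field; rewrite d0.
  by rewrite form_sym e sm /= -natrM mulnC.
case: (inner_alpha_cases nij) => ->; [exists 0%N|exists 1%N|exists 2%N];
  by rewrite ?mul0r ?oppr0 ?mul1r.
Qed.

End RootLengths.

Section SerreScalars.

Variables (K : fieldType) (r s : K) (g : classical_type) (n : nat).
Hypothesis hn : (match g with TypeB => 1 | TypeC => 2 | TypeD => 3 end <= n)%N.
Hypotheses (r0 : r != 0) (s0 : s != 0).

Local Notation N := (dimV g n).
Local Notation al := (alpha g).

Local Notation x i := (r_ r g i).
Local Notation y i := (s_ s g i).

Lemma r_E (i : 'I_n) : x i = r ^+ root_length g i.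
Proof. by rewrite /r_ dsymE // pmulrn qpow_int. Qed.

Lemma s_E (i : 'I_n) : y i = s ^+ root_length g i.
Proof. by rewrite /s_ dsymE // pmulrn qpow_int. Qed.

(** The scalars picked up between toral generators and the e's are written through z, r_i and s_i
    alone, so that what is needed of the Serre coefficients becomes an identity of rational
    functions in three variables. *)
Lemma serre_scalars (i j : 'I_n) : i != j ->
  let m := serre_deg g i j in let z := qpow (r * s) (form g (al j) (al i)) in
  [/\ z != 0, forall k, qpow (r * s) (k%:R * form g (al j) (al i)) = z ^+ k,
      rs_pow r s (form g (al j) (al i)) (- form g (al i) (al j)) =
        z * y i ^+ m.-1 /\
      rs_pow r s (- form g (al i) (al j)) (form g (al j) (al i)) =
        z * x i ^+ m.-1
    & rs_pow r s (form g (al i) (al j)) (- form g (al j) (al i)) =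
        (z * x i ^+ m.-1)^-1 /\
      rs_pow r s (- form g (al j) (al i)) (form g (al i) (al j)) =
        (z * y i ^+ m.-1)^-1].
Proof.
move=> nij; have [_] := serre_degE hn nij; rewrite /= r_E s_E -!exprM.
have /intrP[A eA] := form_alphar_int hn (al i) j.
have /intrP[B eB] := form_alphar_int hn (al j) i.
rewrite eA eB; set M := (_ * _)%N => e.
have rs0 : r * s != 0 by rewrite mulf_neq0.
have e' : A = - B - Posz M.
  apply: (mulrIz (oner_neq0 rat)); rewrite !intrD !rmorphN /=.
  by move: e => /(canRL (addrK _)) ->; ring.
rewrite /= !qpow_int -!rmorphN /= !rs_pow_int; split.
- by rewrite expfz_neq0.
- by move=> k; rewrite pmulrn -intrM qpow_int (mulrC (Posz k)) -exprz_exp.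
- rewrite expfzMl e' opprD !opprK !expfzDr // -[r ^ M]exprnP -[s ^ M]exprnP.
  have := expfz_neq0 B r0; have := expfz_neq0 B s0.
  have := expf_neq0 M r0; have := expf_neq0 M s0.
  move: (r ^ B) (s ^ B) (r ^+ M) (s ^+ M) => a b c d.
  by move=> *; split; field; rewrite ?mulf_neq0.
- rewrite expfzMl e' !expfzDr // -!invr_expz -[r ^ M]exprnP -[s ^ M]exprnP.
  have := expfz_neq0 B r0; have := expfz_neq0 B s0.
  have := expf_neq0 M r0; have := expf_neq0 M s0.
  move: (r ^ B) (s ^ B) (r ^+ M) (s ^+ M) => a b c d.
  by move=> *; split; field; do ?(apply/andP; split).
Qed.

Lemma rs_pow_alpha (i : 'I_n) :
  rs_pow r s (form g (al i) (al i)) (- form g (al i) (al i)) = x i / y i /\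
  rs_pow r s (- form g (al i) (al i)) (form g (al i) (al i)) = y i / x i.
Proof.
rewrite (form_alpha_alpha hn) r_E s_E pmulrn -rmorphN /=.
by rewrite !rs_pow_int -!invr_expz -!exprnP; split => //; rewrite mulrC.
Qed.

End SerreScalars.

(** * Serre elements *)

Section QuantumBinomials.

Variables (K : fieldType) (x y : K).
Hypotheses (x0 : x != 0) (y0 : y != 0) (xy : x - y != 0).
Hypotheses (q2 : x + y != 0) (q3 : x ^+ 2 + x * y + y ^+ 2 != 0).

Lemma qint1 : qint x y 1 = 1.
Proof. by rewrite /qint !expr1 divff. Qed.

Lemma qint2 : qint x y 2 = x + y.
Proof. by rewrite /qint; field. Qed.

Lemma qint3 : qint x y 3 = x ^+ 2 + x * y + y ^+ 2.
Proof. by rewrite /qint; field. Qed.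

Lemma qfact0 : qfact x y 0 = 1.
Proof. by rewrite /qfact big_nil. Qed.

Lemma qfactS m : qfact x y m.+1 = qfact x y m * qint x y m.+1.
Proof. by rewrite /qfact big_nat_recr. Qed.

Definition qfactE := (qfactS, qfact0, qint1, qint2, qint3, mul1r, subn0).

Variable z : K.
Hypothesis z0 : z != 0.

(* serre_coef with x = r_i, y = s_i and z = (rs)^<alpha_j, alpha_i> *)
Definition qserre m k : K :=
  (-1) ^+ k * qbinom x y m k * (x * y) ^+ (k * k.-1)./2 * z ^+ k.

Definition geom (u : K) a : K := \sum_(t < a) u ^+ t.

Lemma geom0 (u : K) : geom u 0%N = 0.
Proof. exact: big_ord0. Qed.

Lemma geomS (u : K) a : geom u a.+1 = geom u a + u ^+ a.
Proof. exact: big_ord_recr. Qed.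

(** The summands are the two contributions to the monomial e_i^(m-k-1) e_j e_i^k in the commutator
    of the Serre element with f_i: term k+1 loses an e_i to the right of e_j, term k loses one to
    the left. *)
Lemma qserre_geom m k : (k < m <= 3)%N ->
  qserre m k.+1 * geom (x / y) k.+1 +
    qserre m k * geom (x / y) (m - k) * (z * y ^+ m.-1) * (x / y) ^+ k = 0 /\
  qserre m k.+1 * geom (y / x) k.+1 +
    qserre m k * geom (y / x) (m - k) * (z * x ^+ m.-1) * (y / x) ^+ k = 0.
Proof.
rewrite /qserre /qbinom.
move=> /andP[km m3]; move: m3 km.
case: m => [|[|[|[|m]]]] //; case: k => [|[|[|k]]] //= _ _;
  rewrite ?subSS ?subn0 !qfactE !geomS !geom0 /=; split; field;
  do ?(apply/andP; split); rewrite ?oner_eq0 //.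
Qed.

(** By the Gauss binomial formula, the sum of [qserre m k * b ^+ k] is the product over t < m of 1 -
    x^(m-1-t) y^t z b. The two values of b are the zeros of its first and last factors. *)
Lemma qserre_sum m : (0 < m <= 3)%N ->
  \sum_(k < m.+1) qserre m k * (z * x ^+ m.-1)^-1 ^+ k = 0 /\
  \sum_(k < m.+1) qserre m k * (z * y ^+ m.-1)^-1 ^+ k = 0.
Proof.
rewrite /qserre /qbinom.
case: m => [|[|[|[|m]]]] //= _;
  rewrite !big_ord_recr /= !big_ord0 !(subSS, subn0) !qfactE; split; field;
  do ?(apply/andP; split); rewrite ?oner_eq0 //.
Qed.

End QuantumBinomials.

(** * Commutation of Serre elements with the f's *)

Section SerreCommutation.

Variables (K : fieldType) (V : lmodType K).
Implicit Types (f : {linear V -> V}) (u v : V) (c : nat -> K) (m k : nat).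

Lemma iter_linear f a (c : K) u v :
  iter a f (c *: u + v) = c *: iter a f u + iter a f v.
Proof. by elim: a => //= a ->; rewrite linearP. Qed.

Lemma iter_linear0 f a : iter a f 0 = 0.
Proof. by elim: a => //= a ->; rewrite linear0. Qed.

Lemma iterZ f a (c : K) u : iter a f (c *: u) = c *: iter a f u.
Proof. by rewrite -[c *: u]addr0 iter_linear iter_linear0 addr0. Qed.

Lemma iterD f a u v : iter a f (u + v) = iter a f u + iter a f v.
Proof. by rewrite -[u]scale1r iter_linear !scale1r. Qed.

Lemma iterB f a u v : iter a f (u - v) = iter a f u - iter a f v.
Proof. by rewrite addrC -scaleN1r iter_linear scaleN1r addrC. Qed.

Lemma iter_scaled_comm f (h : {linear V -> V}) (c : K) a u :
  (forall v, h (f v) = c *: f (h v)) ->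
  h (iter a f u) = c ^+ a *: iter a f (h u).
Proof.
move=> hf; elim: a => [|a IH] /=; first by rewrite scale1r.
by rewrite hf IH linearZ scalerA exprS.
Qed.

Lemma iter_comm f (h : {linear V -> V}) a u :
  (forall v, h (f v) = f (h v)) -> h (iter a f u) = iter a f (h u).
Proof. by move=> hf; elim: a => //= a IH; rewrite hf IH. Qed.

Definition serre_sum (c : nat -> K) m (e e' : {linear V -> V}) u : V :=
  \sum_(k < m.+1) c k *: iter (m - k) e (e' (iter k e u)).

Lemma serre_sum_linear c m (e e' : {linear V -> V}) b u v :
  serre_sum c m e e' (b *: u + v) =
  b *: serre_sum c m e e' u + serre_sum c m e e' v.
Proof.
rewrite /serre_sum scaler_sumr -big_split /=; apply: eq_bigr => k _.
by rewrite iter_linear linearP iter_linear scalerDr !scalerA mulrC.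
Qed.

Lemma serre_sum0 c m (e e' : {linear V -> V}) : serre_sum c m e e' 0 = 0.
Proof.
rewrite /serre_sum big1 // => k _.
by rewrite iter_linear0 linear0 iter_linear0 scaler0.
Qed.

Lemma serre_sum_comm c m (e e' f : {linear V -> V}) u :
  (forall v, f (e v) = e (f v)) -> (forall v, f (e' v) = e' (f v)) ->
  serre_sum c m e e' (f u) = f (serre_sum c m e e' u).
Proof.
move=> fe fe'; rewrite /serre_sum linear_sum; apply: eq_bigr => k _.
by rewrite linearZ (iter_comm _ _ fe) fe' (iter_comm _ _ fe).
Qed.

(* With f = f_j in the Serre element of (e, e') = (e_i, e_j); serre_sum_comm and
   serre_sum_comm_first treat k <> i, j and k = i. So the Serre element commutes
   with every f_k, without any use of the Serre relations. *)
Lemma serre_sum_comm_second c m (e e' f w w' : {linear V -> V})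
    (gam b b' : K) u :
  (forall v, f (e v) = e (f v)) ->
  (forall v, e' (f v) = f (e' v) + gam *: (w v - w' v)) ->
  (forall v, w (e v) = b *: e (w v)) -> (forall v, w' (e v) = b' *: e (w' v)) ->
  \sum_(k < m.+1) c k * b ^+ k = 0 -> \sum_(k < m.+1) c k * b' ^+ k = 0 ->
  serre_sum c m e e' (f u) = f (serre_sum c m e e' u).
Proof.
move=> fe e'f we w'e sb sb'; rewrite /serre_sum linear_sum.
have -> : \sum_(k < m.+1) c k *: iter (m - k) e (e' (iter k e (f u))) =
    \sum_(k < m.+1) f (c k *: iter (m - k) e (e' (iter k e u))) +
    gam *: ((\sum_(k < m.+1) c k * b ^+ k) *: iter m e (w u) -
            (\sum_(k < m.+1) c k * b' ^+ k) *: iter m e (w' u)).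
  rewrite !scaler_suml -sumrB scaler_sumr -big_split /=; apply: eq_bigr => k _.
  rewrite -(iter_comm _ _ fe) e'f iterD iterZ iterB linearZ (iter_comm _ _ fe)
    scalerDr.
  congr (_ + _).
  rewrite (iter_scaled_comm _ _ we) (iter_scaled_comm _ _ w'e) !iterZ.
  rewrite -!ssrnat.iterD subnK; last by rewrite -ltnS.
  rewrite -[(c k * b ^+ k) *: _]scalerA -[(c k * b' ^+ k) *: _]scalerA.
  by rewrite -[c k *: _ - _]scalerBr scalerA [RHS]scalerA mulrC.
by rewrite sb sb' !scale0r subrr scaler0 addr0.
Qed.

Lemma linear_comb f (c d : K) u v : f (c *: u - d *: v) = c *: f u - d *: f v.
Proof. by rewrite linearB !linearZ. Qed.

(** Each of the a factors e meets f once and leaves w - w' behind. Moving w to the right through the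
    remaining t factors costs b^t, and these costs add up to [geom b a]. *)
Lemma iter_ef (e f w w' : {linear V -> V}) (gam b b' : K) a u :
  (forall v, e (f v) = f (e v) + gam *: (w v - w' v)) ->
  (forall v, w (e v) = b *: e (w v)) -> (forall v, w' (e v) = b' *: e (w' v)) ->
  iter a e (f u) = f (iter a e u) +
    gam *: (geom b a *: iter a.-1 e (w u) - geom b' a *: iter a.-1 e (w' u)).
Proof.
move=> ef we w'e; elim: a => [|a IH].
  by rewrite !geom0 !scale0r subrr scaler0 addr0.
rewrite iterS IH linearD ef linearZ linear_comb -addrA; congr (_ + _).
rewrite -scalerDr; congr (_ *: _).
rewrite (iter_scaled_comm _ _ we) (iter_scaled_comm _ _ w'e) !geomS !scalerDl.
case: a {IH} => [|a] /=; first by rewrite !geom0 !scale0r subrr !add0r addr0.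
by rewrite addrACA -opprD; congr (_ - _); rewrite addrC.
Qed.

Lemma serre_sum_comm_first c m (e e' f w w' : {linear V -> V})
    (gam b b' d d' : K) u :
  (forall v, f (e' v) = e' (f v)) ->
  (forall v, e (f v) = f (e v) + gam *: (w v - w' v)) ->
  (forall v, w (e v) = b *: e (w v)) -> (forall v, w' (e v) = b' *: e (w' v)) ->
  (forall v, w (e' v) = d *: e' (w v)) ->
  (forall v, w' (e' v) = d' *: e' (w' v)) ->
  (forall k, (k < m)%N ->
    c k.+1 * geom b k.+1 + c k * geom b (m - k) * d * b ^+ k = 0 /\
    c k.+1 * geom b' k.+1 + c k * geom b' (m - k) * d' * b' ^+ k = 0) ->
  serre_sum c m e e' (f u) = f (serre_sum c m e e' u).
Proof.
move=> fe' ef we w'e we' w'e' hc; rewrite /serre_sum linear_sum.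
(* [X k] are the monomials of the commutator. In [A] the first summand comes from the e's to the
   right of e', the second from those to the left; a shift of the index pairs them off. The
   predecessor of k = 0 does no harm, since [geom b 0] is 0. *)
pose X k v := iter (m - k.+1) e (e' (iter k e v)).
pose A b d v := \sum_(k < m.+1) ((c k * geom b k) *: X k.-1 v +
  (c k * geom b (m - k) * d * b ^+ k) *: X k v).
have A0 (b1 d1 : K) v : (forall k, (k < m)%N ->
    c k.+1 * geom b1 k.+1 + c k * geom b1 (m - k) * d1 * b1 ^+ k = 0) ->
    A b1 d1 v = 0.
  move=> h; rewrite /A big_split /= big_ord_recl big_ord_recr /= geom0 subnn.
  rewrite geom0 !(mulr0, mul0r) !scale0r add0r addr0 -big_split big1 //= => k _.
  by rewrite -scalerDl h ?scale0r.
have -> : \sum_(k < m.+1) c k *: iter (m - k) e (e' (iter k e (f u))) =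
    \sum_(k < m.+1) f (c k *: iter (m - k) e (e' (iter k e u))) +
    gam *: (A b d (w u) - A b' d' (w' u)).
  rewrite /A -sumrB scaler_sumr -big_split /=; apply: eq_bigr => k _.
  rewrite (iter_ef _ _ ef we w'e) linearD iterD -fe' (iter_ef _ _ ef we w'e).
  rewrite 2![c k *: (_ + _)]scalerDr [f (c k *: _)]linearZ -addrA;
    congr (_ + _).
  rewrite we' w'e' (iter_scaled_comm _ _ we) (iter_scaled_comm _ _ w'e).
  have e'Z (a : K) v : e' (a *: v) = a *: e' v by exact: linearZ.
  rewrite !e'Z (linear_comb e') !(e'Z, iterZ, iterB).
  have XE (b1 : K) v : (c k * geom b1 k) *: X k.-1 v =
      c k *: (geom b1 k *: iter (m - k) e (e' (iter k.-1 e v))).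
    rewrite /X; case: (nat_of_ord k) => [|l]; last by rewrite scalerA.
    by rewrite geom0 mulr0 !scale0r scaler0.
  have XE' v : X k v = iter (m - k).-1 e (e' (iter k e v)) by rewrite /X subnS.
  rewrite !XE !XE'.
  move: (iter _ e _) (iter _ e _) (iter _ e _) (iter _ e _) => P P' R R'.
  rewrite -!scalerDr [LHS]scalerA [c k * gam]mulrC -[LHS]scalerA;
    congr (_ *: _).
  rewrite !scalerDr !scalerN !scalerA opprD.
  by rewrite !mulrA [LHS]addrC addrACA.
by rewrite !A0 ?subrr ?scaler0 ?addr0 // => k /hc[].
Qed.

End SerreCommutation.

(** * Modules generated by singular vectors *)

(* Stands in for the positive elements of an ordering, which K does not have.
   Up to sign, every scalar that must not vanish is positive in this sense or a
   positive multiple of r - s. *)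
Record pos_cone (K : fieldType) (pos : K -> Prop) : Prop := {
  pos_neq0 : forall x, pos x -> x != 0;
  pos1 : pos 1;
  posD : forall x y, pos x -> pos y -> pos (x + y);
  posM : forall x y, pos x -> pos y -> pos (x * y);
  posV : forall x, pos x -> pos x^-1 }.

Section PosCone.

Variables (K : fieldType) (pos : K -> Prop).
Hypothesis hpos : pos_cone pos.

Lemma posX x k : pos x -> pos (x ^+ k).
Proof.
move=> px; elim: k => [|k IH]; first exact: pos1 hpos.
by rewrite exprS; apply: posM hpos _ _ px IH.
Qed.

Lemma posXz x (k : int) : pos x -> pos (x ^ k).
Proof.
move=> px; case: k => k; first exact: posX.
by rewrite NegzE -invr_expz; apply/(posV hpos)/posX.
Qed.

Lemma pos_qpow x q : pos x -> pos (qpow x q).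
Proof. exact: posXz. Qed.

Lemma pos_sum (I : eqType) (l : seq I) (F : I -> K) i0 :
  i0 \in l -> pos (F i0) -> (forall i, i \in l -> F i = 0 \/ pos (F i)) ->
  pos (\sum_(i <- l) F i).
Proof.
have aux (l' : seq I) : (forall i, i \in l' -> F i = 0 \/ pos (F i)) ->
    \sum_(i <- l') F i = 0 \/ pos (\sum_(i <- l') F i).
  elim: l' => [|i l' IH] hl; first by rewrite big_nil; left.
  rewrite big_cons; have [|->|pi] := hl i; first by rewrite mem_head.
    by rewrite add0r; apply: IH => j jl; apply: hl; rewrite inE jl orbT.
  right; case: IH => [j jl|->|pl]; first by apply: hl; rewrite inE jl orbT.
    by rewrite addr0.
  exact: posD.
elim: l => // i l IH; rewrite inE big_cons => il pi0 hl.
have hl' j : j \in l -> F j = 0 \/ pos (F j).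
  by move=> jl; apply: hl; rewrite inE jl orbT.
case: (eqVneq i0 i) il => [<- _|_ /= il].
  by case: (aux l hl') => [->|pl]; [rewrite addr0 | exact: posD].
have pl := IH il pi0 hl'.
by case: (hl i) => [|->|pi]; rewrite ?mem_head ?add0r //; apply: posD.
Qed.

End PosCone.

(* is_Urs_module without the two Serre relations *)
Record is_prelim_module (K : fieldType) (r s : K) (g : classical_type) (n : nat)
    (M : gmodule K n) : Prop := {
  pre_toral_comm : forall (x y : generator n) (u : M), toral x -> toral y ->
    act M x (act M y u) = act M y (act M x u);
  pre_wV : forall i (u : M), act M (Gw i) (act M (Gwinv i) u) = u;
  pre_w'V : forall i (u : M), act M (Gw' i) (act M (Gw'inv i) u) = u;
  pre_we : forall i j (u : M),
    act M (Gw i) (act M (Ge j) u) =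
    rs_pow r s (form g (alpha g j) (alpha g i)) (- form g (alpha g i) (alpha g
      j))
      *: act M (Ge j) (act M (Gw i) u);
  pre_wf : forall i j (u : M),
    act M (Gw i) (act M (Gf j) u) =
    rs_pow r s (- form g (alpha g j) (alpha g i)) (form g (alpha g i) (alpha g
      j))
      *: act M (Gf j) (act M (Gw i) u);
  pre_w'e : forall i j (u : M),
    act M (Gw' i) (act M (Ge j) u) =
    rs_pow r s (- form g (alpha g i) (alpha g j)) (form g (alpha g j) (alpha g
      i))
      *: act M (Ge j) (act M (Gw' i) u);
  pre_w'f : forall i j (u : M),
    act M (Gw' i) (act M (Gf j) u) =
    rs_pow r s (form g (alpha g i) (alpha g j)) (- form g (alpha g j) (alpha g
      i))
      *: act M (Gf j) (act M (Gw' i) u);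
  pre_ef : forall i j (u : M),
    act M (Ge i) (act M (Gf j) u) - act M (Gf j) (act M (Ge i) u) =
    (if i == j then (r_ r g i - s_ s g i)^-1 *: (act M (Gw i) u - act M (Gw' i)
      u)
     else 0)
}.

Inductive f_span (K : fieldType) (n : nat) (M : gmodule K n) (v : M) : M ->
  Prop :=
  | f_span_gen : f_span v v
  | f_span_lin (c : K) (u w : M) :
      f_span v u -> f_span v w -> f_span v (c *: u + w)
  | f_span_f (i : 'I_n) (u : M) : f_span v u -> f_span v (act M (Gf i) u).

Section FSpan.

Variables (K : fieldType) (pos : K -> Prop) (hpos : pos_cone pos).
Variables (r s : K) (pr : pos r) (ps : pos s) (rs : r != s).
Variables (g : classical_type) (n : nat).
Hypothesis hn : (match g with TypeB => 1 | TypeC => 2 | TypeD => 3 end <= n)%N.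
Variables (M : gmodule K n) (hM : is_prelim_module r s g M).

Let r0 : r != 0 := pos_neq0 hpos pr.
Let s0 : s != 0 := pos_neq0 hpos ps.

Lemma prelim_ef i j (u : M) : act M (Ge i) (act M (Gf j) u) =
  act M (Gf j) (act M (Ge i) u) +
  (if i == j then (r_ r g i - s_ s g i)^-1 *: (act M (Gw i) u - act M (Gw' i) u)
   else 0).
Proof. by rewrite -(pre_ef hM) addrC subrK. Qed.

Section Highest.

Variables (v : M) (la : weight n).
Hypotheses (wv : has_weight r s g v la) (ev : forall i, act M (Ge i) v = 0).

Local Notation F := (f_span v).

Lemma f_span0 : F 0.
Proof. by rewrite -[0](addNr v) -scaleN1r; apply: f_span_lin;
  exact: f_span_gen. Qed.

Lemma f_spanZ c u : F u -> F (c *: u).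
Proof. by move=> hu; rewrite -[c *: u]addr0; apply: f_span_lin hu f_span0. Qed.

Lemma f_spanD u w : F u -> F w -> F (u + w).
Proof. by move=> hu hw; rewrite -[u]scale1r; apply: f_span_lin. Qed.

Lemma f_span_act x : F (act M x v) ->
  (forall j u, F u -> F (act M x u) -> F (act M x (act M (Gf j) u))) ->
  forall u, F u -> F (act M x u).
Proof.
move=> xv xf u; elim=> // c u1 u2 _ h1 _ h2.
by rewrite linearP; apply: f_span_lin.
Qed.

(** No defining relation moves an inverse toral generator past f_j; the scalar follows from the one
    for [t], since [t] and [ti] commute. *)
Lemma inverse_f_comm (t ti : generator n) (j : 'I_n) (c : K) :
  toral t -> toral ti -> c != 0 -> (forall u, act M t (act M ti u) = u) ->
  (forall u, act M t (act M (Gf j) u) = c *: act M (Gf j) (act M t u)) ->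
  forall u, act M ti (act M (Gf j) u) = c^-1 *: act M (Gf j) (act M ti u).
Proof.
move=> tt tti c0 tK tf u; apply: (canRL (scalerK c0)).
by rewrite -[RHS]tK (pre_toral_comm hM _ tt tti) tf tK linearZ.
Qed.

Lemma inverse_weight (t ti : generator n) (c : K) :
  toral t -> toral ti -> c != 0 -> (forall u, act M t (act M ti u) = u) ->
  act M t v = c *: v -> act M ti v = c^-1 *: v.
Proof.
move=> tt tti c0 tK tv; apply: (canRL (scalerK c0)).
by rewrite -linearZ -tv -(pre_toral_comm hM _ tt tti).
Qed.

Lemma f_span_w i u : F u -> F (act M (Gw i) u).
Proof.
apply: f_span_act => [|j w hw h]; first by rewrite (wv i).1;
  apply/f_spanZ/f_span_gen.
by rewrite (pre_wf hM); apply/f_spanZ/f_span_f.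
Qed.

Lemma f_span_w' i u : F u -> F (act M (Gw' i) u).
Proof.
apply: f_span_act => [|j w hw h]; first by rewrite (wv i).2;
  apply/f_spanZ/f_span_gen.
by rewrite (pre_w'f hM); apply/f_spanZ/f_span_f.
Qed.

Lemma f_span_e i u : F u -> F (act M (Ge i) u).
Proof.
apply: f_span_act => [|j w hw h]; first by rewrite ev; apply: f_span0.
rewrite prelim_ef; apply: f_spanD; first exact: f_span_f.
case: ifP => _; last exact: f_span0.
by apply: f_spanZ; rewrite addrC -scaleN1r; apply: f_span_lin;
  [apply: f_span_w'|apply: f_span_w].
Qed.

(** The relations move e_i and the toral generators through an f-word down to v, which e_i kills and
    the toral generators scale. *)
Lemma f_span_submodule : submodule (M := M) F.
Proof.
split; [exact: f_span0 | by move=> c u w; apply: f_span_lin | case=> i].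
- exact: f_span_e.
- by move=> u; apply: f_span_f.
- exact: f_span_w.
- apply: f_span_act => [|j w hw h].
    rewrite (inverse_weight (t := Gw i) _ _ (w_eigen_neq0 _ r0 s0 _ _) (pre_wV
      hM i) (wv i).1) //.
    by apply/f_spanZ/f_span_gen.
  rewrite (inverse_f_comm (t := Gw i) _ _ (rs_pow_neq0 r0 s0 _ _) (pre_wV hM i)
    (pre_wf hM i j)) //.
  by apply/f_spanZ/f_span_f.
- exact: f_span_w'.
- apply: f_span_act => [|j w hw h].
    rewrite (inverse_weight (t := Gw' i) _ _ (w'_eigen_neq0 _ r0 s0 _ _)
      (pre_w'V hM i) (wv i).2) //.
    by apply/f_spanZ/f_span_gen.
  rewrite (inverse_f_comm (t := Gw' i) _ _ (rs_pow_neq0 r0 s0 _ _) (pre_w'V hM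
    i) (pre_w'f hM i j)) //.
  by apply/f_spanZ/f_span_f.
Qed.

End Highest.

(** r_i - s_i is r - s or (r - s)(r + s). The last two expressions are the quantum integers 2 and 3,
    the denominators in quantum binomials of degree at most 3. *)
Lemma pos_rs_distinct (i : 'I_n) :
  [/\ r_ r g i != 0, s_ s g i != 0, r_ r g i - s_ s g i != 0,
      r_ r g i + s_ s g i != 0
    & r_ r g i ^+ 2 + r_ r g i * s_ s g i + s_ s g i ^+ 2 != 0].
Proof.
rewrite (r_E r hn) (s_E s hn); set d := root_length g i.
have px : pos (r ^+ d) by apply: posX.
have py : pos (s ^+ d) by apply: posX.
split.
- exact: (pos_neq0 hpos px).
- exact: (pos_neq0 hpos py).
- suff : (d = 1 \/ d = 2)%N.
    case=> ->; first by rewrite !expr1 subr_eq0.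
    by rewrite subr_sqr mulf_neq0 ?subr_eq0 // (pos_neq0 hpos) //; apply: posD.
  by rewrite /d /root_length; case: ifP; case: g; auto.
- by apply: (pos_neq0 hpos); apply: posD.
- by apply: (pos_neq0 hpos); do !apply: (posD hpos); rewrite ?expr2;
    apply: (posM hpos).
Qed.

Definition serre_op (i j : 'I_n) : M -> M :=
  serre_sum (serre_coef r s g i j) (serre_deg g i j) (act M (Ge i)) (act M (Ge
    j)).

Lemma serre_coefE (i j : 'I_n) k : i != j -> serre_coef r s g i j k =
  qserre (r_ r g i) (s_ s g i) (qpow (r * s) (form g (alpha g j) (alpha g i)))
    (serre_deg g i j) k.
Proof.
by move=> ij; have [_ h _ _] := serre_scalars hn r0 s0 ij;
  rewrite /serre_coef h.
Qed.

Lemma serre_op_f i j k (u : M) : i != j ->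
  serre_op i j (act M (Gf k) u) = act M (Gf k) (serre_op i j u).
Proof.
move=> ij; have [z0 _ [we we'] [wj wj']] := serre_scalars hn r0 s0 ij.
have [x0 y0 xy xpy q3] := pos_rs_distinct i.
have [/andP[m0 m3] _] := serre_degE hn ij.
have [xx yy] := rs_pow_alpha r s hn i.
have ef_neq a b (w : M) : a != b ->
    act M (Gf b) (act M (Ge a) w) = act M (Ge a) (act M (Gf b) w).
  by move=> ab; rewrite prelim_ef (negPf ab) addr0.
have ef_eq a (w : M) : act M (Ge a) (act M (Gf a) w) = act M (Gf a) (act M (Ge
  a) w) +
    (r_ r g a - s_ s g a)^-1 *: (act M (Gw a) w - act M (Gw' a) w).
  by rewrite prelim_ef eqxx.
rewrite /serre_op; case: (eqVneq k i) => [->|ki].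
  apply: (serre_sum_comm_first (w := act M (Gw i)) (w' := act M (Gw' i))
    (gam := (r_ r g i - s_ s g i)^-1) (b := r_ r g i / s_ s g i)
    (b' := s_ s g i / r_ r g i)) => [w|w|w|w|w|w|l lm].
  - by apply: ef_neq; rewrite eq_sym.
  - exact: ef_eq.
  - by rewrite (pre_we hM) xx.
  - by rewrite (pre_w'e hM) yy.
  - by rewrite (pre_we hM) we.
  - by rewrite (pre_w'e hM) we'.
  - by rewrite !serre_coefE //; apply: qserre_geom => //; rewrite lm.
case: (eqVneq k j) => [->|kj].
  apply: (serre_sum_comm_second (w := act M (Gw j)) (w' := act M (Gw' j))
    (gam := (r_ r g j - s_ s g j)^-1)
    (b := (qpow (r * s) (form g (alpha g j) (alpha g i)) * r_ r g i ^+
      (serre_deg g i j).-1)^-1)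
    (b' := (qpow (r * s) (form g (alpha g j) (alpha g i)) * s_ s g i ^+
      (serre_deg g i j).-1)^-1)) => [w|w|w|w||].
  - exact: ef_neq.
  - exact: ef_eq.
  - by rewrite (pre_we hM) wj.
  - by rewrite (pre_w'e hM) wj'.
  - under eq_bigr do rewrite serre_coefE //.
    by apply: (qserre_sum x0 y0 xy xpy q3 z0 _).1; rewrite m0.
  - under eq_bigr do rewrite serre_coefE //.
    by apply: (qserre_sum x0 y0 xy xpy q3 z0 _).2; rewrite m0.
by apply: serre_sum_comm => w; apply: ef_neq; rewrite eq_sym.
Qed.

Lemma serre_op_f_span i j (v u : M) : i != j ->
  (forall k, act M (Ge k) v = 0) -> f_span v u -> serre_op i j u = 0.
Proof.
move=> ij ev; elim=> [|c u1 u2 _ h1 _ h2|k u1 _ h1].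
(* The first operator applied to v is e_j in the term k = 0 and e_i in the others. *)
- rewrite /serre_op /serre_sum big1 // => -[[|k] hk] _ /=.
    by rewrite ev iter_linear0 scaler0.
  by rewrite -iterS iterSr ev iter_linear0 linear0 iter_linear0 scaler0.
- by rewrite /serre_op serre_sum_linear -/(serre_op _ _) h1 h2 scaler0 addr0.
- by rewrite serre_op_f // h1 linear0.
Qed.

End FSpan.

(** * Orthogonal decomposition along singular vectors *)

Section Subspace.

Variables (K : fieldType) (m : nat).

(** A subspace of maximal dimension among those contained in P exhausts P, since any further vector
    of P would enlarge it. This turns f-spans into subspaces with a carrier type. *)
Lemma vspace_of_closed (P : 'cV[K]_m -> Prop) :
  P 0 -> (forall c u v, P u -> P v -> P (c *: u + v)) ->
  exists U : {vspace 'cV[K]_m}, forall u, u \in U <-> P u.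
Proof.
move=> P0 Plin; pose Q k := `[< exists2 U : {vspace 'cV[K]_m},
  (forall u, u \in U -> P u) & \dim U = k >].
have exQ : exists k, Q k.
  by exists 0%N; apply/asboolP; exists 0%VS; rewrite ?dimv0 // => u;
    rewrite memv0 => /eqP->.
have ubQ k : Q k -> (k <= \dim {:'cV[K]_m})%N.
  by move=> /asboolP[U _ <-]; rewrite dimvS ?subvf.
case: (ex_maxnP exQ ubQ) => k /asboolP[U UP Uk] kmax; exists U => u.
split=> [|Pu]; first exact: UP.
have WP w : w \in (U + <[u]>)%VS -> P w.
  move=> /memv_addP[a aU [b /vlineP[c ->] ->]].
  by rewrite addrC; apply: Plin => //; apply: UP.
have sUW : (U <= U + <[u]>)%VS := addvSl _ _.
have : U == (U + <[u]>)%VS.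
  rewrite eqEdim sUW Uk; apply: kmax; apply/asboolP.
  by exists (U + <[u]>)%VS.
by move=> /eqP ->; rewrite memvE addvSr.
Qed.

End Subspace.

(** * Restriction of a module to an invariant subspace *)

Section SubGmodule.

Variables (K : fieldType) (r s : K) (g : classical_type) (n m : nat).
Variables (rho : generator n -> 'M[K]_m) (U : {vspace 'cV[K]_m}).

Local Notation M := (matrix_gmodule rho).

(** Composing with the projection onto U gives linear maps for any U; for invariant U they are the
    restrictions. *)
Definition sub_gmodule : gmodule K n := @Gmodule K n (subvs_of U)
  (fun x => vsproj U \o (act M x \o vsval)).

Lemma val_subZ c (u : sub_gmodule) : vsval (c *: u) = c *: vsval u.
Proof. exact: linearZ. Qed.

Hypothesis stU : forall x u, u \in U -> act M x u \in U.

Lemma val_sub_act x (u : sub_gmodule) :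
  vsval (act sub_gmodule x u) = act M x (vsval u).
Proof. by rewrite /= vsprojK // stU // subvsP. Qed.

Lemma val_sub_iter x k (u : sub_gmodule) :
  vsval (iter k (act sub_gmodule x) u) = iter k (act M x) (vsval u).
Proof. by elim: k => // k IH; rewrite !iterS val_sub_act IH. Qed.

Lemma sub_is_Urs_module : is_Urs_module r s g M -> is_Urs_module r s g
  sub_gmodule.
Proof.
move=> hM; have vi := @subvs_inj _ _ U.
have vB (u v : sub_gmodule) : vsval (u - v) = vsval u - vsval v by exact:
  linearB.
have vS k (F : nat -> sub_gmodule) :
    vsval (\sum_(0 <= l < k) F l) = \sum_(0 <= l < k) vsval (F l).
  exact: linear_sum.
split.
- by move=> x y u tx ty; apply: vi; rewrite !val_sub_act (Urs_toral_comm hM).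
- by move=> i u; apply: vi; rewrite !val_sub_act (Urs_wV hM).
- by move=> i u; apply: vi; rewrite !val_sub_act (Urs_w'V hM).
- by move=> i j u; apply: vi; rewrite val_subZ !val_sub_act (Urs_we hM).
- by move=> i j u; apply: vi; rewrite val_subZ !val_sub_act (Urs_wf hM).
- by move=> i j u; apply: vi; rewrite val_subZ !val_sub_act (Urs_w'e hM).
- by move=> i j u; apply: vi; rewrite val_subZ !val_sub_act (Urs_w'f hM).
- move=> i j u; apply: vi; rewrite vB !val_sub_act (Urs_ef hM).
  by case: ifP => _; rewrite ?linear0 // val_subZ vB !val_sub_act.
- move=> i j u ij; apply: vi; rewrite vS linear0.
  rewrite -[RHS](Urs_serre_e hM (vsval u) ij); apply: eq_bigr => k _.
  by rewrite val_subZ val_sub_iter val_sub_act val_sub_iter.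
- move=> i j u ij; apply: vi; rewrite vS linear0.
  rewrite -[RHS](Urs_serre_f hM (vsval u) ij); apply: eq_bigr => k _.
  by rewrite val_subZ val_sub_iter val_sub_act val_sub_iter.
Qed.

(** Through this image, singular vectors of a submodule of the restriction are looked for inside
    M. *)
Lemma sub_submodule (P : sub_gmodule -> Prop) : submodule P ->
  submodule (M := M) (fun u => exists2 w : sub_gmodule, vsval w = u & P w).
Proof.
case=> P0 Pl Pa; split.
- by exists 0; rewrite ?linear0.
- move=> c u v [w <- Pw] [w' <- Pw']; exists (c *: w + w'); last exact: Pl.
  by rewrite linearP.
- by move=> x u [w <- Pw]; exists (act sub_gmodule x w);
  [exact: val_sub_act|exact: Pa].
Qed.

End SubGmodule.

Section Decomposition.

Variables (K : fieldType) (pos : K -> Prop) (hpos : pos_cone pos).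
Variables (r s : K) (pr : pos r) (ps : pos s) (rs : r != s).
Variables (g : classical_type) (n : nat).
Hypothesis hn : (match g with TypeB => 1 | TypeC => 2 | TypeD => 3 end <= n)%N.
Variables (m : nat) (rho : generator n -> 'M[K]_m).

Local Notation M := (matrix_gmodule rho).
Hypothesis hM : is_prelim_module r s g M.

Variable d : 'I_m -> K.
Hypothesis d0 : forall k, d k != 0.

Definition diag_form (u v : 'cV[K]_m) : K := \sum_k d k * u k 0 * v k 0.

Local Notation bil := diag_form.

Lemma diag_formC u v : bil u v = bil v u.
Proof. by apply: eq_bigr => k _; ring. Qed.

Lemma diag_form_linl c u v w : bil (c *: u + v) w = c * bil u w + bil v w.
Proof.
rewrite /bil mulr_sumr -big_split; apply: eq_bigr => k _.
by rewrite !mxE /=; ring.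
Qed.

Lemma diag_form_linr c u v w : bil w (c *: u + v) = c * bil w u + bil w v.
Proof. by rewrite diag_formC diag_form_linl !(diag_formC w). Qed.

Lemma diag_form0l u : bil 0 u = 0.
Proof. by rewrite /bil big1 // => k _; rewrite mxE mulr0 mul0r. Qed.

Lemma diag_form0r u : bil u 0 = 0.
Proof. by rewrite diag_formC diag_form0l. Qed.

Lemma diag_formZr c u v : bil u (c *: v) = c * bil u v.
Proof. by rewrite -[c *: v]addr0 diag_form_linr diag_form0r addr0. Qed.

Lemma diag_formDr u v w : bil u (v + w) = bil u v + bil u w.
Proof. by rewrite -[v]scale1r diag_form_linr mul1r scale1r. Qed.

Lemma diag_form_sumr (I : finType) u (F : I -> 'cV[K]_m) :
  bil u (\sum_j F j) = \sum_j bil u (F j).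
Proof.
by apply: (big_morph (bil u)); [exact: diag_formDr | exact: diag_form0r].
Qed.

Lemma diag_form_nondeg u : (forall v, bil v u = 0) -> u = 0.
Proof.
move=> h; apply/colP => k; rewrite mxE; apply/eqP.
have := h (delta_mx k 0); rewrite /bil (bigD1 k) //= big1 => [|j jk].
  rewrite !mxE !eqxx mulr1 addr0 => /eqP.
  by rewrite mulf_eq0 (negPf (d0 k)).
by rewrite !mxE (negPf jk) mulr0 mul0r.
Qed.

(** Orthogonality to U is a system of [\dim U] < m linear equations, solved by a nonzero column of
    the cokernel of its matrix. *)
Lemma diag_form_perp (U : {vspace 'cV[K]_m}) : U != fullv ->
  exists2 v, v != 0 & forall u, u \in U -> bil u v = 0.
Proof.
move=> Uf; pose B := \matrix_(i < \dim U, k < m) (d k * (vbasis U)`_i k 0).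
have rB : (\rank B < m)%N.
  apply: leq_ltn_trans (rank_leq_row _) _; rewrite ltn_neqAle.
  have := dimvS (subvf U); rewrite dimvf /dim /= muln1 => -> ; rewrite andbT.
  apply: contraNneq Uf => e.
  by rewrite eqEdim subvf dimvf /dim /= muln1 e.
have : cokermx B != 0 by rewrite -mxrank_eq0 mxrank_coker -lt0n subn_gt0.
move=> /matrix0Pn[a [b cab]]; exists (col b (cokermx B)).
  by apply: contraNneq cab => /colP/(_ a); rewrite !mxE => ->.
move=> u uU; rewrite (coord_vbasis uU) diag_formC diag_form_sumr big1 // => i _.
rewrite diag_formZr diag_formC; suff -> : bil (vbasis U)`_i (col b (cokermx B))
  = 0.
  by rewrite mulr0.
have /matrixP/(_ i b) := mulmx_coker B; rewrite !mxE => <-.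
by apply: eq_bigr => k _; rewrite !mxE.
Qed.

Hypothesis ef_adj : forall i u v,
  bil (act M (Ge i) u) v = bil u (act M (Gf i) v).
Hypothesis toral_adj : forall x u v, toral x ->
  bil (act M x u) v = bil u (act M x v).

Variable lev : 'I_m -> nat.
Hypothesis e_lev : forall i a b, rho (Ge i) a b != 0 -> (lev a < lev b)%N.

Variables (I : finType) (sv : I -> 'cV[K]_m) (la : I -> weight n).
Hypothesis sv_weight : forall j, has_weight (M := M) r s g (sv j) (la j).
Hypothesis sv_e : forall j i, act M (Ge i) (sv j) = 0.
Hypothesis sv_orth : forall j k, j != k -> bil (sv j) (sv k) = 0.
Hypothesis sv_norm : forall j, bil (sv j) (sv j) != 0.
Hypothesis sv_span : forall t, (forall i, act M (Ge i) t = 0) ->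
  exists c : I -> K, t = \sum_j c j *: sv j.

Local Notation F j := (f_span (M := M) (sv j)).

(* The e_i strictly lower lev, so repeated application of them to a nonzero
   vector must end in a nonzero vector killed by all of them. *)
Lemma submodule_singular (P : M -> Prop) (u : 'cV[K]_m) : submodule P -> P u ->
  u != 0 -> exists t : 'cV[K]_m, [/\ P t, t != 0 & forall i,
    act M (Ge i) t = 0].
Proof.
case=> _ _ Pa Pu u0.
have [b ub] : exists b, forall k, u k 0 != 0 -> (lev k < b)%N.
  exists (\max_k lev k).+1 => k _; rewrite ltnS; exact: leq_bigmax.
elim: b u Pu u0 ub => [|b IH] u Pu u0 ub.
  case/matrix0Pn: u0 => k [j]; rewrite (ord1 j) => /ub; by rewrite ltn0.
case: (pselect (forall i, act M (Ge i) u = 0)) => [eu|]; first by exists u.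
move=> /existsNP[i /eqP eu]; apply: (IH (act M (Ge i) u)) => //;
  first exact: Pa.
move=> k; rewrite mxE => kn; have [j] : exists j, rho (Ge i) k j * u j 0 != 0.
  apply/existsP; apply: contraNT kn => /existsPn h.
  by rewrite big1 // => j _; apply/eqP; rewrite -[_ == 0]negbK.
rewrite mulf_eq0 negb_or => /andP[/e_lev kj /ub jb]; exact: leq_trans kj jb.
Qed.

(** A nonzero element would produce a nonzero singular vector in P. It is a combination of the
    orthogonal, non-isotropic sv_j, and pairing it with each sv_j shows that all coefficients
    vanish. *)
Lemma submodule_zero (P : M -> Prop) : submodule P ->
  (forall j u, P u -> bil (sv j) u = 0) -> forall u, P u -> u = 0.
Proof.
move=> sP orth u Pu; apply/eqP; apply: contraT => u0.
have [t [Pt t0 /sv_span[c tE]]] := submodule_singular sP Pu u0.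
case/negP: t0; rewrite tE big1 // => j _.
have := orth j t Pt; rewrite tE diag_form_sumr (bigD1 j) //= big1 => [|k kj].
  by rewrite addr0 diag_formZr => /eqP; rewrite mulf_eq0 (negPf (sv_norm j))
    orbF
    => /eqP ->; rewrite scale0r.
by rewrite diag_formZr sv_orth ?mulr0 // eq_sym.
Qed.

Lemma f_span_sv_submodule j : submodule (M := M) (F j).
Proof. exact: (f_span_submodule hpos pr ps hM (sv_weight j) (sv_e j)). Qed.

(** The outermost f_i passes to the other side of the form as e_i, which kills sv_k. *)
Lemma f_span_sv_orth j k u : j != k -> F j u -> bil (sv k) u = 0.
Proof.
move=> jk; elim=> [|c u1 u2 _ h1 _ h2|i u1 _ h1].
- by rewrite sv_orth // eq_sym.
- by rewrite diag_form_linr h1 h2 mulr0 addr0.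
- by rewrite -ef_adj sv_e diag_form0l.
Qed.

Lemma perp_submodule (P : M -> Prop) : submodule P ->
  submodule (M := M) (fun v => forall u, P u -> bil u v = 0).
Proof.
case=> P0 Pl Pa; split.
- by move=> u _; rewrite diag_form0r.
- by move=> c u v hu hv w Pw; rewrite diag_form_linr hu ?hv // mulr0 addr0.
move=> x u hu w Pw.
have tor y : toral y -> bil w (act M y u) = 0.
  by move=> ty; rewrite -toral_adj // hu //; apply: Pa.
case: x => i; try by apply: tor.
  by rewrite diag_formC ef_adj diag_formC hu //; apply: Pa.
by rewrite -ef_adj hu //; apply: Pa.
Qed.

Lemma f_span_min (P : M -> Prop) v : submodule P -> P v ->
  forall u, f_span v u -> P u.
Proof.
by case=> _ Pl Pa Pv u; elim=> // [c u1 u2 _ h1 _ h2|i u1 _ h1]; auto.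
Qed.

(** The orthogonal complement of M_j is a submodule containing sv_k, hence M_k. *)
Lemma f_span_orth j k u v : j != k -> F j u -> F k v -> bil u v = 0.
Proof.
move=> jk Fu Fv; apply: (f_span_min (perp_submodule (f_span_sv_submodule j)) _
  Fv) Fu.
by move=> w Fw; rewrite diag_formC; apply: f_span_sv_orth Fw.
Qed.

(** The radical of the form on M_j is a submodule, orthogonal to sv_j by definition and to the other
    sv_k by [f_span_sv_orth], so [submodule_zero] applies. This makes the sum of the M_j direct. *)
Lemma f_span_nondeg j u : F j u -> (forall v, F j v -> bil v u = 0) -> u = 0.
Proof.
move=> Fu hu; have [P0 Pl Pa] := f_span_sv_submodule j.
have [Q0 Ql Qa] := perp_submodule (f_span_sv_submodule j).
apply: (@submodule_zero (fun w => F j w /\ forall v,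
  F j v -> bil v w = 0)) => //.
- split; first by split.
    by move=> c w w' [h1 h2] [h3 h4]; split; [apply: Pl|apply: Ql].
  by move=> x w [h1 h2]; split; [apply: Pa|apply: Qa].
- move=> k w [Fw hw]; case: (eqVneq j k) => [<-|jk].
    by apply: hw; apply: f_span_gen.
  exact: f_span_sv_orth Fw.
Qed.

Lemma f_span_sum_full (U : {vspace 'cV[K]_m}) :
  (forall j u, F j u -> u \in U) -> U = fullv.
Proof.
move=> FU; apply/eqP; apply: contraT => Uf.
have [v v0 vU] := diag_form_perp Uf.
have sQ : submodule (M := M) (fun v => forall j u, F j u -> bil u v = 0).
  split.
  - by move=> j; have [] := perp_submodule (f_span_sv_submodule j).
  - move=> c u w hu hw j; have [_ h _] := perp_submodule (f_span_sv_submodule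
    j).
    by apply: h; [exact: hu|exact: hw].
  - move=> x u hu j; have [_ _ h] := perp_submodule (f_span_sv_submodule j).
    by apply: h; exact: hu.
case/negP: v0; apply/eqP; apply: (submodule_zero sQ) => [j w hw|j w Fw].
  by apply: hw (f_span_gen _).
by apply: vU; apply: FU Fw.
Qed.

Lemma exists_f_span_vspace : exists U : I -> {vspace 'cV[K]_m},
  forall j u, u \in U j <-> F j u.
Proof.
suff h j : {U : {vspace 'cV[K]_m} | forall u, u \in U <-> F j u}.
  by exists (fun j => sval (h j)) => j; apply: (svalP (h j)).
apply: cid; have [P0 Pl _] := f_span_sv_submodule j.
exact: vspace_of_closed.
Qed.

(** An induction principle: linear statements such as the vanishing of the Serre elements, or
    surjectivity of the sum map below, need only be checked on the M_j. *)
Lemma closed_full (P : 'cV[K]_m -> Prop) : P 0 ->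
  (forall c u v, P u -> P v -> P (c *: u + v)) ->
  (forall j u, F j u -> P u) -> forall u, P u.
Proof.
move=> P0 Pl FP u; have [U hU] := vspace_of_closed P0 Pl.
by apply/hU; rewrite (f_span_sum_full (U := U)) ?memvf // => j w Fw; apply/hU;
  apply: FP Fw.
Qed.

Lemma serre_e_zero i j (u : M) : i != j -> serre_op r s g i j u = 0.
Proof.
move=> ij; move: u; apply: closed_full => [|c u v hu hv|k u Fu].
- exact: serre_sum0.
- by rewrite /serre_op serre_sum_linear; move: hu hv;
  rewrite /serre_op => -> ->;
    rewrite scaler0 addr0.
- exact: (serre_op_f_span hpos pr ps rs hn hM ij (sv_e k) Fu).
Qed.

Lemma iter_adj i k u v : bil (iter k (act M (Ge i)) u) v =
  bil u (iter k (act M (Gf i)) v).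
Proof. by elim: k v => // k IH v; rewrite iterS ef_adj IH -iterSr. Qed.

(* The Serre element in the f's is the adjoint of the one in the e's. *)
Lemma full_is_Urs_module : is_Urs_module r s g M.
Proof.
case: hM => *; split=> // i j u ij.
  by rewrite big_mkord; apply: serre_e_zero.
apply: diag_form_nondeg => v; rewrite big_mkord diag_form_sumr.
rewrite -[RHS](diag_form0l u) -(serre_e_zero v ij) diag_formC diag_form_sumr.
apply: eq_bigr => k _; rewrite !diag_formZr [in RHS]diag_formC.
by rewrite iter_adj ef_adj iter_adj.
Qed.

Section Pieces.

Variables (U : I -> {vspace 'cV[K]_m}).
Hypothesis hU : forall j u, u \in U j <-> F j u.

Lemma piece_stable j x u : u \in U j -> act M x u \in U j.
Proof.
by move=> /hU Fu; apply/hU; have [_ _] := f_span_sv_submodule j; apply.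
Qed.

Lemma piece_is_L j : is_L r s g (la j) (sub_gmodule rho (U j)).
Proof.
have svU : sv j \in U j by apply/hU/f_span_gen.
have vU := vsprojK svU.
have vi := @subvs_inj _ _ (U j).
have sv0 : sv j <> 0.
  by move=> e; have := sv_norm j; rewrite e diag_form0l eqxx.
have gen (P : sub_gmodule rho (U j) -> Prop) : submodule P ->
    P (vsproj (U j) (sv j)) -> forall u, P u.
  move=> sP Pv u; have sP' := sub_submodule (@piece_stable j) sP.
  have Fu : F j (vsval u) by apply/hU/subvsP.
  have [|w /vi <- //] := f_span_min sP' _ Fu.
  by exists (vsproj (U j) (sv j)).
split.
- exact: sub_is_Urs_module (@piece_stable j) full_is_Urs_module.
- split.
    by exists (vsproj (U j) (sv j)) => e; apply: sv0; rewrite -vU e linear0.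
  move=> P sP; case: (pselect (forall v, P v -> v = 0)) => [|/existsNP[v]];
    first by left.
  move=> /not_implyP[Pv /eqP v0]; right; apply: gen => //.
  have sP' := sub_submodule (@piece_stable j) sP.
  have [||t [[w wt Pw] t0 te]] := submodule_singular (u := vsval v) sP'.
  - by exists v.
  - by apply: contraNneq v0 => e; apply/eqP/vi; rewrite e linear0.
  have [c tE] := sv_span te.
  (* As t lies in M_j, it is orthogonal to every other sv_k, which forces c_k = 0. So sv_j is a
     multiple of t, lies in P and generates the piece. *)
  have tj : t = c j *: sv j.
    rewrite [LHS]tE (bigD1 j) //= big1 ?addr0 // => k kj.
    have Ft : F j t by apply/hU; rewrite -wt subvsP.
    have jk : j != k by rewrite eq_sym.
    have := f_span_sv_orth jk Ft; rewrite tE diag_form_sumr (bigD1 k) //= big1.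
      by rewrite addr0 diag_formZr => /eqP; rewrite mulf_eq0 (negPf (sv_norm k))
        orbF => /eqP ->; rewrite scale0r.
    by move=> l lk; rewrite diag_formZr sv_orth ?mulr0 // eq_sym.
  have cj0 : c j != 0 by apply: contraNneq t0 => e; rewrite tj e scale0r.
  have -> : vsproj (U j) (sv j) = (c j)^-1 *: w.
    by apply: vi; rewrite vU linearZ /= wt tj scalerA mulVf ?scale1r.
  by have [P0 Pl _] := sP; rewrite -[_ *: w]addr0; apply: Pl.
- exists (vsproj (U j) (sv j)); split.
  + by move=> e; apply: sv0; rewrite -vU e linear0.
  + move=> i; have [h1 h2] := sv_weight j i.
    by split; apply: vi; rewrite (val_sub_act (@piece_stable j)) val_subZ vU.
  + by move=> i; apply: vi; rewrite (val_sub_act (@piece_stable j)) vU sv_e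
    linear0.
  + by move=> P sP Pv u; apply: gen.
Qed.

Lemma pieces_isomorphic (j1 j2 j3 : I) : uniq [:: j1; j2; j3] ->
  (forall j, j \in [:: j1; j2; j3]) ->
  isomorphic M (dsum (sub_gmodule rho (U j1))
    (dsum (sub_gmodule rho (U j2)) (sub_gmodule rho (U j3)))).
Proof.
move=> /= /andP[]; rewrite !inE negb_or => /andP[j12 j13].
rewrite andbT => j23 jall.
set D := dsum _ _.
pose psi (a : D) : 'cV[K]_m := vsval a.1 + vsval a.2.1 + vsval a.2.2.
have psi_lin c a b : psi (c *: a + b) = c *: psi a + psi b.
  have -> : psi (c *: a + b) = vsval (c *: a.1 + b.1) +
      vsval (c *: a.2.1 + b.2.1) + vsval (c *: a.2.2 + b.2.2) by [].
  have vP (V : {vspace 'cV[K]_m}) (x y : subvs_of V) :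
      vsval (c *: x + y) = c *: vsval x + vsval y by exact: linearP.
  by rewrite !vP /psi !scalerDr [LHS](AC (2*2*2) ((1*3*5)*(2*4*6))).
have FU j (a : subvs_of (U j)) : F j (vsval a) by apply/hU/subvsP.
have psi0 a : psi a = 0 -> a = 0.
  case: a => [a1 [a2 a3]] e; rewrite /psi /= in e.
  (* Pairing a vanishing sum with M_j isolates the component in M_j and puts it into the radical
     there. *)
  have z (j k l : I) (b1 : subvs_of (U j)) (b2 : subvs_of (U k)) (b3 : subvs_of
    (U l)) :
      j != k -> j != l -> vsval b1 + vsval b2 + vsval b3 = 0 -> b1 = 0.
    move=> jk jl eb; apply: (@subvs_inj _ _ (U j)); rewrite linear0.
    apply: (f_span_nondeg (FU _ b1)) => v Fv.
    have := congr1 (bil v) eb; rewrite !diag_formDr diag_form0r.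
    by rewrite (f_span_orth jk Fv (FU _ b2)) (f_span_orth jl Fv (FU _ b3))
      !addr0.
  have -> : a1 = 0 by apply: z e.
  have -> : a2 = 0.
    apply: (z _ _ _ a2 a1 a3) => //; first by rewrite eq_sym.
    by rewrite [vsval a2 + _]addrC.
  have -> // : a3 = 0.
  by apply: (z _ _ _ a3 a1 a2); rewrite ?(eq_sym j3) // -addrA addrC.
have v0 (V : {vspace 'cV[K]_m}) : vsval (0 : subvs_of V) = 0 by exact: linear0.
have psi_surj u : exists a, psi a = u.
  move: u; apply: closed_full => [|c u v [a <-] [b <-]|j u Fu].
  - by exists 0; rewrite /psi (v0 (U j1)) (v0 (U j2)) (v0 (U j3)) !addr0.
  - by exists (c *: a + b).
  have := jall j; rewrite !inE => /or3P[] /eqP ej; rewrite ej in Fu;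
    move/hU: Fu => uU.
  - by exists (vsproj _ u, (0, 0)); rewrite /psi (v0 (U j2)) (v0 (U j3)) !addr0
    vsprojK.
  - by exists (0, (vsproj _ u, 0)); rewrite /psi (v0 (U j1)) (v0 (U j3)) addr0
    add0r vsprojK.
  - by exists (0, (0, vsproj _ u)); rewrite /psi (v0 (U j1)) (v0 (U j2)) !add0r
    vsprojK.
have psi_inj : injective psi.
  move=> a b e; apply/eqP; rewrite -subr_eq0; apply/eqP/psi0.
  by rewrite addrC -scaleN1r psi_lin e scaleN1r addNr.
(* Only the sum map [psi] has a formula. The isomorphism is its inverse, chosen pointwise, and is
   linear because [psi] is linear and injective. *)
have [phi phiK] := choice psi_surj.
have phi_lin : linear (phi : M -> D).
  by move=> c u v; apply: psi_inj; rewrite psi_lin !phiK.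
pose phiL : {linear M -> D} :=
  HB.pack (phi : M -> D) (GRing.isLinear.Build K M D *:%R phi phi_lin).
exists phiL.
  by exists psi => [u|a]; [exact: phiK | apply: psi_inj; exact: phiK].
move=> x u; apply: psi_inj; rewrite phiK /psi.
have st j y w : w \in U j -> act M y w \in U j by exact: piece_stable.
rewrite /= !vsprojK; try by apply: st; exact: subvsP.
by rewrite -!mulmxDr -/(psi (phi u)) phiK.
Qed.

End Pieces.

End Decomposition.

(** * The module V and its tensor square *)

Section TensorLinearity.

Variables (K : fieldType) (m m' p p' : nat).
Implicit Types (A B : 'M[K]_(m, m')) (C D : 'M[K]_(p, p')).

Lemma tensmxDl A B C : (A + B) *t C = A *t C + B *t C.
Proof. by apply/matrixP => i j; rewrite !mxE mulrDl. Qed.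

Lemma tensmxDr A C D : A *t (C + D) = A *t C + A *t D.
Proof. by apply/matrixP => i j; rewrite !mxE mulrDr. Qed.

Lemma tensmxZl (c : K) A C : (c *: A) *t C = c *: (A *t C).
Proof. by apply/matrixP => i j; rewrite !mxE mulrA. Qed.

Lemma tensmxZr (c : K) A C : A *t (c *: C) = c *: (A *t C).
Proof. by apply/matrixP => i j; rewrite !mxE mulrCA. Qed.

Lemma tensmxBl A B C : (A - B) *t C = A *t C - B *t C.
Proof. by rewrite -scaleN1r tensmxDl tensmxZl scaleN1r. Qed.

Lemma tensmxBr A C D : A *t (C - D) = A *t C - A *t D.
Proof. by rewrite -scaleN1r tensmxDr tensmxZr scaleN1r. Qed.

End TensorLinearity.

Lemma tens_scalar11 (K : fieldType) (m p : nat) :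
  (1%:M : 'M[K]_m) *t (1%:M : 'M[K]_p) = 1%:M.
Proof.
apply/matrixP => i j; case: (mxtens_indexP i) => a b.
case: (mxtens_indexP j) => c e; rewrite tensmxE !mxE.
rewrite (can_eq (@mxtens_indexK m p)) xpair_eqE.
by case: eqP; case: eqP; rewrite /= ?mulr1 ?mulr0.
Qed.

Lemma regroup_commutator (V : zmodType) (a b c x y z : V) :
  a + x + (y + b) - (a + c + (z + b)) = (x - z) + (y - c).
Proof.
apply/eqP; rewrite subr_eq [X in _ == X](AC ((2*2)*(2*2))
  (((5*1)*(3*8))*((7*2)*(6*4)))).
by rewrite /= !subrr !addr0.
Qed.

Section PrelimRep.

Variables (K : fieldType) (r s : K) (g : classical_type) (n : nat).

Local Notation al := (alpha g).

Record is_prelim_rep (m : nat) (rho : generator n -> 'M[K]_m) : Prop := {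
  rep_toral_comm : forall (x y : generator n), toral x -> toral y ->
    rho x *m rho y = rho y *m rho x;
  rep_wV : forall i, rho (Gw i) *m rho (Gwinv i) = 1%:M;
  rep_w'V : forall i, rho (Gw' i) *m rho (Gw'inv i) = 1%:M;
  rep_we : forall i j, rho (Gw i) *m rho (Ge j) =
    rs_pow r s (form g (al j) (al i)) (- form g (al i) (al j))
      *: (rho (Ge j) *m rho (Gw i));
  rep_wf : forall i j, rho (Gw i) *m rho (Gf j) =
    rs_pow r s (- form g (al j) (al i)) (form g (al i) (al j))
      *: (rho (Gf j) *m rho (Gw i));
  rep_w'e : forall i j, rho (Gw' i) *m rho (Ge j) =
    rs_pow r s (- form g (al i) (al j)) (form g (al j) (al i))
      *: (rho (Ge j) *m rho (Gw' i));
  rep_w'f : forall i j, rho (Gw' i) *m rho (Gf j) =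
    rs_pow r s (form g (al i) (al j)) (- form g (al j) (al i))
      *: (rho (Gf j) *m rho (Gw' i));
  rep_ef : forall i j, rho (Ge i) *m rho (Gf j) - rho (Gf j) *m rho (Ge i) =
    (if i == j then (r_ r g i - s_ s g i)^-1 *: (rho (Gw i) - rho (Gw' i)) else
      0)
}.

Lemma prelim_rep_module (m : nat) (rho : generator n -> 'M[K]_m) :
  is_prelim_rep rho -> is_prelim_module r s g (matrix_gmodule rho).
Proof.
case=> h1 h2 h3 h4 h5 h6 h7 h8; split => /=.
- by move=> x y u tx ty; rewrite !mulmxA h1.
- by move=> i u; rewrite mulmxA h2 mul1mx.
- by move=> i u; rewrite mulmxA h3 mul1mx.
- by move=> i j u; rewrite !mulmxA h4 -scalemxAl.
- by move=> i j u; rewrite !mulmxA h5 -scalemxAl.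
- by move=> i j u; rewrite !mulmxA h6 -scalemxAl.
- by move=> i j u; rewrite !mulmxA h7 -scalemxAl.
- move=> i j u; rewrite !mulmxA -mulmxBl h8.
  by case: ifP => _; rewrite ?mul0mx // -scalemxAl mulmxBl.
Qed.

Lemma tensor_prelim_rep (m : nat) (rho : generator n -> 'M[K]_m) :
  is_prelim_rep rho -> is_prelim_rep (tensor_rep rho rho).
Proof.
case=> h1 h2 h3 h4 h5 h6 h7 h8.
split => [x y tx ty|i|i|i j|i j|i j|i j|i j] /=.
- have tE z : toral z -> tensor_rep rho rho z = rho z *t rho z by case: z.
  by rewrite !tE // !tensmx_mul h1.
- by rewrite tensmx_mul h2 tens_scalar11.
- by rewrite tensmx_mul h3 tens_scalar11.
- rewrite mulmxDr mulmxDl !tensmx_mul mulmx1 mul1mx h4 (h1 (Gw i) (Gw j)) //.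
  by rewrite tensmxZl tensmxZr -scalerDr.
- rewrite mulmxDr mulmxDl !tensmx_mul mulmx1 mul1mx h5 (h1 (Gw i) (Gw' j)) //.
  by rewrite tensmxZl tensmxZr -scalerDr.
- rewrite mulmxDr mulmxDl !tensmx_mul mulmx1 mul1mx h6 (h1 (Gw' i) (Gw j)) //.
  by rewrite tensmxZl tensmxZr -scalerDr.
- rewrite mulmxDr mulmxDl !tensmx_mul mulmx1 mul1mx h7 (h1 (Gw' i) (Gw' j)) //.
  by rewrite tensmxZl tensmxZr -scalerDr.
(* The mixed terms of the two products agree: omega_i past f_j and omega'_j past e_i give the same
   scalar. What remains is omega_i (x) [e_i, f_j] + [e_i, f_j] (x) omega'_j, which telescopes for i
   = j. *)
rewrite !(mulmxDr, mulmxDl) !tensmx_mul !(mulmx1, mul1mx) h5 h6.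
rewrite tensmxZl tensmxZr regroup_commutator -tensmxBl -tensmxBr h8.
case: eqP => [->|_]; last by rewrite tens0mx tensmx0 addr0.
by rewrite tensmxZl tensmxZr tensmxBl tensmxBr -scalerDr addrA subrK.
Qed.

End PrelimRep.

(** * Coincidences among the entries of the e_i *)

Section EndIndices.

Variables (g : classical_type) (n : nat).
Hypothesis hn : (match g with TypeB => 1 | TypeC => 2 | TypeD => 3 end <= n)%N.

Local Notation N := (dimV g n).
Local Notation p := (end1 hn).
Local Notation q := (end2 hn).

Definition kappa2 (t : classical_type) : nat := if t is TypeB then 2 else 1.

Lemma kappa2E : 2 * kappa g = (kappa2 g)%:R.
Proof. by rewrite /kappa /kappa2; case: g. Qed.

Lemma end1_inner (i : 'I_n) : (i.+1 < n)%N -> p i = i :> nat.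
Proof. by rewrite /= /end1_nat => h; case: (g) => //; case: eqP => // e;
  lia. Qed.

Lemma end1_last (i : 'I_n) : (n <= i.+1)%N ->
  p i = (if g is TypeD then i.-1 else i) :> nat.
Proof.
by rewrite /= /end1_nat => h; case: (g) => //; case: eqP => // e;
  have := ltn_ord i; lia.
Qed.

Lemma type_match (A : Type) (x y z w : A) :
  (g = TypeB -> x = w) -> (g = TypeC -> y = w) -> (g = TypeD -> z = w) ->
  match g with TypeB => x | TypeC => y | TypeD => z end = w.
Proof. by case: g => hB hC hD; [apply: hB|apply: hC|apply: hD]. Qed.

Lemma rev_ordE (a : 'I_N) : rev_ord a = (N - a.+1)%N :> nat.
Proof. by []. Qed.

Variant end1_spec (i : 'I_n) : Prop :=
  | End1Inner of (i.+1 < n)%N & p i = i :> nat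
  | End1B of i.+1 = n & g = TypeB & p i = i :> nat & N = n.*2.+1
  | End1C of i.+1 = n & g = TypeC & p i = i :> nat & N = n.*2 & (1 < n)%N
  | End1D of i.+1 = n & g = TypeD & p i = i.-1 :> nat & N = n.*2 & (2 < n)%N.

Lemma end1P i : end1_spec i.
Proof.
have li := ltn_ord i; case: (ltnP i.+1 n) => ni.
  by apply: End1Inner => //; apply: end1_inner.
have ei : i.+1 = n by lia.
have pl := end1_last ni; have h := hn; case eg : (g) => //.
- by apply: End1B => //; [rewrite pl eg | rewrite /dimV eg].
- by apply: End1C => //; [rewrite pl eg | rewrite /dimV eg | move: h;
  rewrite eg].
- by apply: End1D => //; [rewrite pl eg | rewrite /dimV eg | move: h;
  rewrite eg].
Qed.

Lemma end2_inj i j : (q i == q j) = (i == j).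
Proof. by rewrite -!val_eqE /= eqSS. Qed.

(** The exception is e_n = E_{nn'} of sp_{2n}, whose position (p, q) is its own mirror image (q',
    p'); [e_coef2] and [f_coef2] are 0 there so that it is counted once. *)
Lemma end2_rev1 i j : q i == rev_ord (p j) -> [/\ g = TypeC, i = j & i.+1 = n].
Proof.
rewrite -(inj_eq (@ord_inj _)) rev_ordE [nat_of_ord (q i)]/= => /eqP;
  have := dimV_bounds g n.
have := ltn_ord i; have := ltn_ord j => lj li hN.
case: (end1P j) => [? ->|? ? -> ->|? ? -> ->|? ? -> ->] e; try lia.
by split=> //; try (apply: val_inj => /=); lia.
Qed.

Lemma end1_rev2 i j : p i == rev_ord (q j) -> [/\ g = TypeC, i = j & i.+1 = n].
Proof.
rewrite -(inj_eq rev_ord_inj) rev_ordK eq_sym => /end2_rev1[-> <- ?].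
by split.
Qed.

Lemma end1_rev2E i : (p i == rev_ord (q i)) =
  if (i.+1 < n)%N then false else if g is TypeC then true else false.
Proof.
rewrite -(inj_eq (@ord_inj _)) rev_ordE; have := dimV_bounds g n => hN.
by case: (end1P i) => [hi ep|hi eg ep eN|hi eg ep eN ?|hi eg ep eN ?];
  rewrite ep [nat_of_ord (q i)]/= ?eN ?hi ?ltnn ?eg; lia.
Qed.

Lemma end2_rev2E i : (q i == rev_ord (q i)) =
  if (i.+1 < n)%N then false else if g is TypeB then true else false.
Proof.
rewrite -(inj_eq (@ord_inj _)) rev_ordE; have := dimV_bounds g n => hN.
by case: (end1P i) => [hi ep|hi eg ep eN|hi eg ep eN ?|hi eg ep eN ?];
  rewrite [nat_of_ord (q i)]/= ?eN ?hi ?ltnn ?eg; lia.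
Qed.

(** This is the fork of the so_{2n} diagram: alpha_{n-1} and alpha_n both start at v_{n-1}, and
    their other ends v_n and v_{n'} are mirror images. *)
Lemma end1_eq i j : p i = p j -> i != j ->
  [/\ g = TypeD, rev_ord (q i) = q j, rev_ord (q j) = q i
    & (i.+1 < n)%N = (n <= j.+1)%N].
Proof.
move=> /(congr1 (@nat_of_ord _)) e; rewrite -(inj_eq (@ord_inj _)) => ij.
have := ltn_ord i; have := ltn_ord j => lj li; move: e.
case: (end1P i) => [hi ep|hi ? ep ?|hi ? ep ? ?|hi ? ep eN ?];
case: (end1P j) => [hj ep'|hj ? ep' ?|hj ? ep' ? ?|hj ? ep' eN' ?];
  rewrite ep ep' => e; try lia.
- by split=> //; try (apply: ord_inj; rewrite rev_ordE /= ); lia.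
- by split=> //; try (apply: ord_inj; rewrite rev_ordE /= ); lia.
Qed.

Lemma end1_neq i : [/\ p i != q i, p i != rev_ord (p i) & q i != rev_ord (q i)
  \/ g = TypeB /\ i.+1 = n].
Proof.
rewrite -!(inj_eq (@ord_inj _)) !rev_ordE; have := dimV_bounds g n;
  have := ltn_ord i => li hN.
case: (end1P i) => [hi ep|hi ? ep eN|hi ? ep eN ?|hi ? ep eN ?];
  rewrite ep ?eN [nat_of_ord (q i)]/=; split; try lia; try by right.
all: left; rewrite /= ; lia.
Qed.

End EndIndices.

Section VectorRepMatrices.

Variables (K : fieldType) (r s : K) (g : classical_type) (n : nat).
Hypothesis hn : (match g with TypeB => 1 | TypeC => 2 | TypeD => 3 end <= n)%N.

Local Notation N := (dimV g n).
Local Notation p := (end1 hn).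
Local Notation q := (end2 hn).

Definition e_coef1 (i : 'I_n) : K :=
  if (i.+1 < n)%N then 1 else if g is TypeD then (r * s)^-1 else 1.

Definition e_coef2 (i : 'I_n) : K :=
  if (i.+1 < n)%N then -1 else if g is TypeC then 0 else -1.

Definition f_coef1 (i : 'I_n) : K :=
  if (i.+1 < n)%N then 1 else
  match g with
  | TypeB => r^-1 + s^-1
  | TypeC => (r * s)^-1
  | TypeD => 1
  end.

Definition f_coef2 (i : 'I_n) : K :=
  if (i.+1 < n)%N then - (r * s) ^- kappa2 g else
  match g with
  | TypeB => - (r^-1 + s^-1)
  | TypeC => 0
  | TypeD => -1
  end.

Local Notation c1 := e_coef1.
Local Notation c2 := e_coef2.
Local Notation d1 := f_coef1.
Local Notation d2 := f_coef2.

Lemma E_delta (a b : 'I_N) x y : x = a.+1 -> y = b.+1 ->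
  E K g n x y = delta_mx a b.
Proof. by move=> -> ->; apply/matrixP => i j; rewrite !mxE !eqSS. Qed.

Lemma V_eE i : V_e r s g i =
  c1 i *: delta_mx (p i) (q i) + c2 i *: delta_mx (rev_ord (q i)) (rev_ord (p
    i)).
Proof.
have li := ltn_ord i; have pin := end1_inner hn (i := i);
  have pl := end1_last hn (i := i).
have lp := ltn_ord (p i); have lq := ltn_ord (q i).
rewrite /V_e; case: ifP => ni.
  rewrite /e_coef1 /e_coef2 ni scale1r scaleN1r; congr (_ - _);
    apply: E_delta => //.
  - by rewrite pin.
  - by rewrite /prime_idx /= in lq *; lia.
  - by move: (pin ni) lp; rewrite /prime_idx /= => -> lp; lia.
have {pin pl ni lp lq} [ni pl lp lq] : [/\ (n <= i.+1)%N,
    p i = (if g is TypeD then i.-1 else i) :> nat, (p i < N)%N & (i.+1 < N)%N].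
  by split=> //; [rewrite leqNgt ni|apply: pl; rewrite leqNgt ni].
apply: type_match => eg.
- have eN : N = n.*2.+1 by rewrite /dimV eg.
  have h : (1 <= n)%N by move: hn; rewrite eg.
  have {}pl : p i = i :> nat by rewrite pl eg.
  have -> : c1 i = 1 by rewrite /e_coef1 ltnNge ni eg.
  have -> : c2 i = -1 by rewrite /e_coef2 ltnNge ni eg.
  rewrite scale1r scaleN1r; congr (_ - _); apply: E_delta; rewrite /prime_idx.
  + by rewrite pl; lia.
  + by rewrite /=; lia.
  + by rewrite /= eN; lia.
  + by rewrite rev_ordE pl eN; lia.
- have eN : N = n.*2 by rewrite /dimV eg.
  have h : (2 <= n)%N by move: hn; rewrite eg.
  have {}pl : p i = i :> nat by rewrite pl eg.
  have -> : c1 i = 1 by rewrite /e_coef1 ltnNge ni eg.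
  have -> : c2 i = 0 by rewrite /e_coef2 ltnNge ni eg.
  rewrite scale1r scale0r addr0; apply: E_delta; rewrite /prime_idx.
  + by rewrite pl; lia.
  + by rewrite /= eN; lia.
- have eN : N = n.*2 by rewrite /dimV eg.
  have h : (3 <= n)%N by move: hn; rewrite eg.
  have {}pl : p i = i.-1 :> nat by rewrite pl eg.
  have -> : c1 i = (r * s)^-1 by rewrite /e_coef1 ltnNge ni eg.
  have -> : c2 i = -1 by rewrite /e_coef2 ltnNge ni eg.
  rewrite scaleN1r; congr (_ - _); first congr (_ *: _); apply: E_delta;
    rewrite /prime_idx.
  + by rewrite pl; lia.
  + by rewrite /= eN; lia.
  + by rewrite /= eN; lia.
  + by rewrite rev_ordE pl eN; lia.
Qed.

Lemma V_fE i : V_f r s g i =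
  d1 i *: delta_mx (q i) (p i) + d2 i *: delta_mx (rev_ord (p i)) (rev_ord (q
    i)).
Proof.
have li := ltn_ord i; have pin := end1_inner hn (i := i);
  have pl := end1_last hn (i := i).
have lp := ltn_ord (p i); have lq := ltn_ord (q i).
rewrite /V_f; case: ifP => ni.
  rewrite /f_coef1 /f_coef2 ni scale1r scaleNr (kappa2E g); congr (_ - _).
    by apply: E_delta => //; rewrite pin.
  congr (_ *: _); first by rewrite pmulrn -rmorphN /= qpow_int -invr_expz
    -exprnP.
  apply: E_delta.
  - by move: (pin ni) lp; rewrite /prime_idx /= => -> lp; lia.
  - by rewrite /prime_idx /= in lq *; lia.
have {pin pl ni lp lq} [ni pl lp lq] : [/\ (n <= i.+1)%N,
    p i = (if g is TypeD then i.-1 else i) :> nat, (p i < N)%N & (i.+1 < N)%N].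
  by split=> //; [rewrite leqNgt ni|apply: pl; rewrite leqNgt ni].
apply: type_match => eg.
- have eN : N = n.*2.+1 by rewrite /dimV eg.
  have h : (1 <= n)%N by move: hn; rewrite eg.
  have {}pl : p i = i :> nat by rewrite pl eg.
  have -> : d1 i = r^-1 + s^-1 by rewrite /f_coef1 ltnNge ni eg.
  have -> : d2 i = - (r^-1 + s^-1) by rewrite /f_coef2 ltnNge ni eg.
  rewrite scaleNr scalerBr; congr (_ *: _ - _ *: _); apply: E_delta;
    rewrite /prime_idx.
  + by rewrite /=; lia.
  + by rewrite pl; lia.
  + by rewrite rev_ordE pl eN; lia.
  + by rewrite /= eN; lia.
- have eN : N = n.*2 by rewrite /dimV eg.
  have h : (2 <= n)%N by move: hn; rewrite eg.
  have {}pl : p i = i :> nat by rewrite pl eg.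
  have -> : d1 i = (r * s)^-1 by rewrite /f_coef1 ltnNge ni eg.
  have -> : d2 i = 0 by rewrite /f_coef2 ltnNge ni eg.
  rewrite scale0r addr0; congr (_ *: _); apply: E_delta; rewrite /prime_idx.
  + by rewrite /= eN; lia.
  + by rewrite pl; lia.
- have eN : N = n.*2 by rewrite /dimV eg.
  have h : (3 <= n)%N by move: hn; rewrite eg.
  have {}pl : p i = i.-1 :> nat by rewrite pl eg.
  have -> : d1 i = 1 by rewrite /f_coef1 ltnNge ni eg.
  have -> : d2 i = -1 by rewrite /f_coef2 ltnNge ni eg.
  rewrite scale1r scaleN1r; congr (_ - _); apply: E_delta;
    rewrite /prime_idx.
  + by rewrite /= eN; lia.
  + by rewrite pl; lia.
  + by rewrite rev_ordE pl eN; lia.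
  + by rewrite /= eN; lia.
Qed.

End VectorRepMatrices.

Lemma mul_diag_delta (K : fieldType) (m : nat) (d : 'I_m -> K) (a b : 'I_m) :
  diag_mx (\row_k d k) *m delta_mx a b = d a *: delta_mx a b.
Proof.
apply/matrixP => i j; rewrite mul_diag_mx !mxE.
by case: eqP => [->|_] //=; rewrite !mulr0.
Qed.

Lemma mul_delta_diag (K : fieldType) (m : nat) (d : 'I_m -> K) (a b : 'I_m) :
  delta_mx a b *m diag_mx (\row_k d k) = d b *: delta_mx a b.
Proof.
apply/matrixP => i j; rewrite mul_mx_diag !mxE mulrC.
by case: (j =P b) => [->|_] //=; rewrite andbF !mulr0.
Qed.

(** * The relations on V other than the Serre relations *)

Section VectorRep.

Variables (K : fieldType) (pos : K -> Prop) (hpos : pos_cone pos).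
Variables (r s : K) (pr : pos r) (ps : pos s) (rs : r != s).
Variables (g : classical_type) (n : nat).
Hypothesis hn : (match g with TypeB => 1 | TypeC => 2 | TypeD => 3 end <= n)%N.

Let r0 : r != 0 := pos_neq0 hpos pr.
Let s0 : s != 0 := pos_neq0 hpos ps.

Local Notation N := (dimV g n).
Local Notation al := (alpha g).
Local Notation p := (end1 hn).
Local Notation q := (end2 hn).
Local Notation wt := (@wt g n).
Local Notation rho := (@V_rep K r s g n).
Local Notation c1 := (e_coef1 r s g).
Local Notation c2 := (e_coef2 K g).
Local Notation d1 := (f_coef1 r s g).
Local Notation d2 := (f_coef2 r s g).

Local Notation w a i := (w_eigen r s g (wt a) i).
Local Notation w' a i := (w'_eigen r s g (wt a) i).

Lemma wt_end1 i : wt (p i) = wt (q i) + al i.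
Proof. by rewrite (alpha_wt hn) addrC subrK. Qed.

Lemma wt_rev_end2 i : wt (rev_ord (q i)) = wt (rev_ord (p i)) + al i.
Proof. by rewrite !wt_rev wt_end1 opprD addrNK. Qed.

Lemma V_we i j : rho (Gw i) *m rho (Ge j) =
  w_eigen r s g (al j) i *: (rho (Ge j) *m rho (Gw i)).
Proof.
rewrite /= (V_eE r s hn) !(mulmxDl, mulmxDr) -!scalemxAl -!scalemxAr
  !mul_diag_delta.
rewrite !mul_delta_diag -![V_weight _ _ _]/(wt _) wt_end1 wt_rev_end2.
rewrite !(w_eigenD hn r0 s0) scalerDr !scalerA.
by congr (_ *: _ + _ *: _); ring.
Qed.

Lemma V_w'e i j : rho (Gw' i) *m rho (Ge j) =
  w'_eigen r s g (al j) i *: (rho (Ge j) *m rho (Gw' i)).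
Proof.
rewrite /= (V_eE r s hn) !(mulmxDl, mulmxDr) -!scalemxAl -!scalemxAr
  !mul_diag_delta.
rewrite !mul_delta_diag -![V_weight _ _ _]/(wt _) wt_end1 wt_rev_end2.
rewrite !(w'_eigenD hn r0 s0) scalerDr !scalerA.
by congr (_ *: _ + _ *: _); ring.
Qed.

Lemma V_wf i j : rho (Gw i) *m rho (Gf j) =
  (w_eigen r s g (al j) i)^-1 *: (rho (Gf j) *m rho (Gw i)).
Proof.
have h := w_eigen_neq0 g r0 s0 (al j) i.
rewrite /= (V_fE r s hn) !(mulmxDl, mulmxDr) -!scalemxAl -!scalemxAr
  !mul_diag_delta.
rewrite !mul_delta_diag -![V_weight _ _ _]/(wt _) wt_end1 wt_rev_end2.
rewrite !(w_eigenD hn r0 s0) scalerDr !scalerA.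
by congr (_ *: _ + _ *: _); field.
Qed.

Lemma V_w'f i j : rho (Gw' i) *m rho (Gf j) =
  (w'_eigen r s g (al j) i)^-1 *: (rho (Gf j) *m rho (Gw' i)).
Proof.
have h := w'_eigen_neq0 g r0 s0 (al j) i.
rewrite /= (V_fE r s hn) !(mulmxDl, mulmxDr) -!scalemxAl -!scalemxAr
  !mul_diag_delta.
rewrite !mul_delta_diag -![V_weight _ _ _]/(wt _) wt_end1 wt_rev_end2.
rewrite !(w'_eigenD hn r0 s0) scalerDr !scalerA.
by congr (_ *: _ + _ *: _); field.
Qed.

Lemma w_eigenN (la : weight n) i : w_eigen r s g (- la) i = (w_eigen r s g la
  i)^-1.
Proof.
have h := w_eigen_neq0 g r0 s0 la i; apply: (mulfI h).
by rewrite -(w_eigenD hn r0 s0) subrr w_eigen0 divff.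
Qed.

Lemma w'_eigenN (la : weight n) i : w'_eigen r s g (- la) i = (w'_eigen r s g
  la i)^-1.
Proof.
have h := w'_eigen_neq0 g r0 s0 la i; apply: (mulfI h).
by rewrite -(w'_eigenD hn r0 s0) subrr w'_eigen0 divff.
Qed.

Lemma V_ef_neq i j : i != j -> rho (Ge i) *m rho (Gf j) = rho (Gf j) *m rho (Ge
  i).
Proof.
move=> ij; rewrite /= (V_eE r s hn) (V_fE r s hn) !(mulmxDl, mulmxDr).
rewrite -!scalemxAl -!scalemxAr !mul_delta_mx_cond end2_inj (negPf ij).
rewrite !(inj_eq rev_ord_inj) end2_inj [j == i]eq_sym (negPf ij).
have z1 a b : a != b -> (q a == rev_ord (p b)) = false.
  by move=> ab; apply: contraNF ab => /end2_rev1[_ ->].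
have z2 a b : a != b -> (p a == rev_ord (q b)) = false.
  by move=> ab; apply: contraNF ab => /end1_rev2[_ ->].
have z3 a b : a != b -> (rev_ord (q a) == p b) = false.
  by move=> ab; rewrite eq_sym z2 // eq_sym.
have z4 a b : a != b -> (rev_ord (p a) == q b) = false.
  by move=> ab; rewrite eq_sym z1 // eq_sym.
rewrite z1 // z2 ?z3 ?z4 // 1?eq_sym // !mulr0n !scaler0 !add0r !addr0.
rewrite [p j == p i]eq_sym; case: (eqVneq (p i) (p j)) => [e|_];
  last by rewrite !mulr0n !scaler0.
(* At the fork both products are multiples of the same matrix unit. Their coefficients c2 d2 and c1
   d1 agree thanks to the factor 1/(rs) in e_n, which matches the one in f_{n-1}. *)
have [eg -> -> lij] := end1_eq e ij.
rewrite !mulr1n !scalerA; congr (_ *: _).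
rewrite /e_coef1 /e_coef2 /f_coef1 /f_coef2 lij eg.
case: ltnP => hj; rewrite ?mulr1 ?mulrNN ?mul1r //.
Qed.

Definition end_exponents (i : 'I_n) : int * int * int * int :=
  if (i.+1 < n)%N then (Posz (kappa2 g), 0, 0, - Posz (kappa2 g)) else
  match g with
  | TypeB => (1, 1, 0, 0)
  | TypeC => (1, 1, -1, -1)
  | TypeD => (0, 1, -1, 0)
  end.

Lemma end_exponentsE i : [/\
  form g (wt (p i)) (al i) = (end_exponents i).1.1.1%:~R,
  form g (al i) (wt (p i)) = (end_exponents i).1.1.2%:~R,
  form g (wt (q i)) (al i) = (end_exponents i).1.2%:~R
  & form g (al i) (wt (q i)) = (end_exponents i).2%:~R].
Proof.
have e := form_endE hn i; rewrite /form_end kappa2E in e.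
rewrite (congr1 (fun t => t.1.1.1) e : form _ _ _ = _).
rewrite (congr1 (fun t => t.1.1.2) e : form _ _ _ = _).
rewrite (congr1 (fun t => t.1.2) e : form _ _ _ = _).
rewrite (congr1 (fun t => t.2) e : form _ _ _ = _).
by rewrite /end_exponents; case: ifP; case: (g).
Qed.

Lemma w_w'_form a i (e f : int) :
  form g (wt a) (al i) = e%:~R -> form g (al i) (wt a) = f%:~R ->
  w a i = r ^ e * s ^ (- f) /\ w' a i = r ^ (- f) * s ^ e.
Proof.
by move=> he hf; rewrite /w_eigen /w'_eigen he hf -rmorphN /= !rs_pow_int.
Qed.

Definition ef_diag a i : K := (r_ r g i - s_ s g i)^-1 * (w a i - w' a i).

Lemma ef_diagE i a : ef_diag a i =
  c1 i * d1 i * ((a == p i)%:R - (a == q i)%:R) +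
  c2 i * d2 i * ((a == rev_ord (q i))%:R - (a == rev_ord (p i))%:R).
Proof.
have [pq pp' qq'] := end1_neq hn i.
have p'p : rev_ord (p i) == p i = false by rewrite eq_sym (negPf pp').
have qp : q i == p i = false by rewrite eq_sym (negPf pq).
have p'q : (rev_ord (p i) == q i) = (p i == rev_ord (q i)).
  by rewrite -(inj_eq rev_ord_inj) rev_ordK.
have q'p : (rev_ord (q i) == p i) = (p i == rev_ord (q i)) by rewrite eq_sym.
have qp' : (q i == rev_ord (p i)) = (p i == rev_ord (q i)) by rewrite eq_sym
  p'q.
have q'q : (rev_ord (q i) == q i) = (q i == rev_ord (q i)) by rewrite eq_sym.
have [h1 h2 h3 h4] := end_exponentsE i.
have [wp w'p] := w_w'_form h1 h2; have [wq w'q] := w_w'_form h3 h4.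
have wr b : w (rev_ord b) i = (w b i)^-1 by rewrite wt_rev w_eigenN.
have w'r b : w' (rev_ord b) i = (w' b i)^-1 by rewrite wt_rev w'_eigenN.
have [x0 y0 xy xpy q3] := pos_rs_distinct hpos pr ps rs hn i.
move: x0 y0 xy xpy q3; rewrite /ef_diag (r_E r hn) (s_E s hn) => x0 y0 xy xpy
  q3.
(* Off the four indices of e_i the weight of v_a is orthogonal to alpha_i, so that omega_i and
   omega'_i act on v_a by the same scalar. *)
have other : a != p i -> a != q i -> a != rev_ord (q i) -> a != rev_ord (p i) ->
    w a i = w' a i.
  move=> ap aq aq' ap'; suff e0 : form g (al i) (wt a) = - form g (wt a) (al i).
    by rewrite /w_eigen /w'_eigen e0 opprK.
  apply/eqP; rewrite -addr_eq0 addrC form_sym (alpha_wt hn) innerDr !inner_wt.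
  by rewrite !inner_wt0 ?mulr0 ?subrr.
have q0 : r ^+ kappa2 g != 0 by rewrite expf_neq0.
have q1 : s ^+ kappa2 g != 0 by rewrite expf_neq0.
have rl : root_length g i = if (i.+1 < n)%N then kappa2 g
  else if g is TypeC then 2 else 1 by [].
have [ap|ap] := eqVneq a (p i).
  rewrite ap (negPf pq) (negPf pp') wp w'p end1_rev2E {h1 h2 h3 h4 wp w'p wq
    w'q wr w'r}.
  move: xy q0 q1; rewrite /end_exponents /e_coef1 /e_coef2 /f_coef1 /f_coef2 rl.
  case: ifP => _; last case: (g); rewrite //= ?exprMn ?opprK ?oppr0 ?expr0z
    ?expr1z
    -?invr_expz -?exprnP => xy q0 q1 *; field;
    do ?(apply/andP; split); rewrite ?oner_eq0 ?expf_neq0 ?mulf_neq0 //.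
have [aq|aq] := eqVneq a (q i).
  rewrite aq qp' wq w'q end2_rev2E end1_rev2E {h1 h2 h3 h4 wp w'p wq w'q wr
    w'r}.
  move: xy q0 q1; rewrite /end_exponents /e_coef1 /e_coef2 /f_coef1 /f_coef2 rl.
  case: ifP => _; last case: (g); rewrite //= ?exprMn ?opprK ?oppr0 ?expr0z
    ?expr1z
    -?invr_expz -?exprnP => xy q0 q1 *; field;
    do ?(apply/andP; split); rewrite ?oner_eq0 ?expf_neq0 ?mulf_neq0 //.
have [aq'|aq'] := eqVneq a (rev_ord (q i)).
  move: ap aq; rewrite aq' (inj_eq rev_ord_inj) qp wr w'r wq w'q q'p q'q
    end1_rev2E
    end2_rev2E {h1 h2 h3 h4 wp w'p wq w'q wr w'r}.
  move: xy q0 q1; rewrite /end_exponents /e_coef1 /e_coef2 /f_coef1 /f_coef2 rl.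
  case: ifP => _; last case: (g); rewrite //= ?exprMn ?opprK ?oppr0 ?expr0z
    ?expr1z
    -?invr_expz -?exprnP => xy q0 q1 *; field;
    do ?(apply/andP; split); rewrite ?oner_eq0 ?expf_neq0 ?mulf_neq0 //.
have [ap'|ap'] := eqVneq a (rev_ord (p i)).
  move: aq; rewrite ap' wr w'r wp w'p p'q end1_rev2E {h1 h2 h3 h4 wp w'p wq w'q
    wr w'r}.
  move: xy q0 q1; rewrite /end_exponents /e_coef1 /e_coef2 /f_coef1 /f_coef2 rl.
  case: ifP => _; last case: (g); rewrite //= ?exprMn ?opprK ?oppr0 ?expr0z
    ?expr1z
    -?invr_expz -?exprnP => xy q0 q1 *; field;
    do ?(apply/andP; split); rewrite ?oner_eq0 ?expf_neq0 ?mulf_neq0 //.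
by rewrite other // !subrr !mulr0 addr0.
Qed.

Lemma V_ef_eq i : rho (Ge i) *m rho (Gf i) - rho (Gf i) *m rho (Ge i) =
  (r_ r g i - s_ s g i)^-1 *: (rho (Gw i) - rho (Gw' i)).
Proof.
rewrite /= (V_eE r s hn) (V_fE r s hn) !(mulmxDl, mulmxDr).
rewrite -!scalemxAl -!scalemxAr !mul_delta_mx_cond !(inj_eq rev_ord_inj) !eqxx
  !mulr1n.
(* Cross products of the two matrix units occur only for the long root of sp_{2n}, where the second
   coefficients vanish. *)
have cd : (p i == rev_ord (q i)) -> c2 i = 0 /\ d2 i = 0.
  by move=> /end1_rev2[eg _ ei]; rewrite /e_coef2 /f_coef2 ei ltnn eg.
have -> : (q i == rev_ord (p i)) = (p i == rev_ord (q i)).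
  by rewrite eq_sym -(inj_eq rev_ord_inj) rev_ordK.
have -> : (rev_ord (p i) == q i) = (p i == rev_ord (q i)).
  by rewrite -(inj_eq rev_ord_inj) rev_ordK.
rewrite [rev_ord (q i) == p i]eq_sym.
have z1 (X : 'M[K]_N) c : c2 i *: (c *: (X *+ (p i == rev_ord (q i)))) = 0.
  by case: eqP => [/eqP/cd[-> _]|_]; rewrite ?scale0r ?mulr0n ?scaler0.
have z2 (X : 'M[K]_N) c : d2 i *: (c *: (X *+ (p i == rev_ord (q i)))) = 0.
  by case: eqP => [/eqP/cd[_ ->]|_]; rewrite ?scale0r ?mulr0n ?scaler0.
have z3 (X : 'M[K]_N) c : c *: (c2 i *: (X *+ (p i == rev_ord (q i)))) = 0.
  by case: eqP => [/eqP/cd[-> _]|_]; rewrite ?scale0r ?mulr0n ?scaler0.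
have z4 (X : 'M[K]_N) c : c *: (d2 i *: (X *+ (p i == rev_ord (q i)))) = 0.
  by case: eqP => [/eqP/cd[_ ->]|_]; rewrite ?scale0r ?mulr0n ?scaler0.
rewrite z1 z2 z3 z4 !addr0 !add0r; apply/matrixP => a b; rewrite !mxE.
have bool_eq x : (a == x) && (b == x) = (a == b) && (a == x).
  by case: (a =P x) => [->|_] /=; rewrite ?andbT ?andbF // eq_sym.
rewrite !bool_eq; case: eqP => [_|_] /=; last by rewrite !mulr0n subrr !mulr0
  addr0 subrr.
by rewrite !mulr1n -[RHS]/(ef_diag a i) ef_diagE; ring.
Qed.

Lemma V_prelim_rep : is_prelim_rep r s g rho.
Proof.
have diagC (d d' : 'I_N -> K) : diag_mx (\row_k d k) *m diag_mx (\row_k d' k) =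
    diag_mx (\row_k d' k) *m diag_mx (\row_k d k).
  by rewrite !mulmx_diag; congr diag_mx; apply/rowP => k; rewrite !mxE mulrC.
have diagV (d : 'I_N -> K) : (forall k, d k != 0) ->
    diag_mx (\row_k d k) *m diag_mx (\row_k (d k)^-1) = 1%:M.
  move=> d0; rewrite mulmx_diag; apply/matrixP => a b; rewrite !mxE.
  by case: eqP => // _; rewrite divff.
split.
- by case=> i [] j //= _ _; apply: diagC.
- by move=> i; apply: diagV => k; apply: w_eigen_neq0.
- by move=> i; apply: diagV => k; apply: w'_eigen_neq0.
- exact: V_we.
- move=> i j; rewrite V_wf -w_eigenN; congr (_ *: _).
  by rewrite /w_eigen !formE opprK.
- exact: V_w'e.
- move=> i j; rewrite V_w'f -w'_eigenN; congr (_ *: _).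
  by rewrite /w'_eigen !formE opprK.
- move=> i j; case: eqP => [<-|/eqP ij]; first exact: V_ef_eq.
  by rewrite V_ef_neq // subrr.
Qed.

End VectorRep.

(** * Adjoint pairs and levels on the tensor square *)

Section TensorSquare.

Variables (K : fieldType) (pos : K -> Prop) (hpos : pos_cone pos).
Variables (r s : K) (pr : pos r) (ps : pos s) (rs : r != s).
Variables (g : classical_type) (n : nat).
Hypothesis hn : (match g with TypeB => 1 | TypeC => 2 | TypeD => 3 end <= n)%N.

Let r0 : r != 0 := pos_neq0 hpos pr.
Let s0 : s != 0 := pos_neq0 hpos ps.

Local Notation N := (dimV g n).
Local Notation al := (alpha g).
Local Notation p := (end1 hn).
Local Notation q := (end2 hn).
Local Notation wt := (@wt g n).
Local Notation rho := (@V_rep K r s g n).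
Local Notation c1 := (e_coef1 r s g).
Local Notation c2 := (e_coef2 K g).
Local Notation d1 := (f_coef1 r s g).
Local Notation d2 := (f_coef2 r s g).

Local Notation w a i := (w_eigen r s g (wt a) i).
Local Notation w' a i := (w'_eigen r s g (wt a) i).
Local Notation rho2 := (tensor_rep rho rho).
Local Notation ix a b := (mxtens_index (a, b)).
Local Notation M := (matrix_gmodule rho2).

Lemma VV_prelim : is_prelim_module r s g M.
Proof.
by apply/prelim_rep_module/tensor_prelim_rep/(V_prelim_rep hpos pr ps rs hn).
Qed.

(* norm a is the square length of v_a for a diagonal form on V in which f_i is
   the adjoint of e_i; it is 1 on v_1, ..., v_n. On V (x) V the product of two
   such forms must be multiplied by twist, since the coproduct involves omega_i
   in e_i but omega'_i in f_i. The shifts by kappa in twist make all exponents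
   integers. *)
Definition norm_last : K :=
  match g with
  | TypeB => (r * s / (r + s)) ^+ 2
  | TypeC => r * s
  | TypeD => (r * s)^-1
  end.

Definition norm (a : 'I_N) : K :=
  if (a < n)%N then 1
  else if (N - a <= n)%N then norm_last * (r * s) ^+ (kappa2 g * (a - (N - n)))
  else r * s / (r + s).

Lemma norm_pos a : pos (norm a).
Proof.
have prs : pos (r * s) by apply: (posM hpos).
have prs' : pos (r * s / (r + s)).
  by apply: (posM hpos) => //; apply/(posV hpos)/(posD hpos).
rewrite /norm; case: ifP => _; first exact: (pos1 hpos).
case: ifP => // _; apply: (posM hpos); last exact: posX.
by rewrite /norm_last; case: (g) => //; [apply: posX|apply: (posV hpos)].
Qed.

(** Adjointness of e_i and f_i on V fixes the ratios of [norm] along the entries of e_i; with the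
    value 1 at v_1 this is where its formula comes from. *)
Lemma norm_adj i : c1 i * norm (p i) = d1 i * norm (q i) /\
  c2 i * norm (rev_ord (q i)) = d2 i * norm (rev_ord (p i)).
Proof.
have hN := dimV_bounds g n; have li := ltn_ord i.
have rs0 : r + s != 0 by apply/(pos_neq0 hpos)/(posD hpos).
rewrite /norm !rev_ordE /e_coef1 /e_coef2 /f_coef1 /f_coef2 /norm_last.
rewrite [nat_of_ord (q i)]/=.
case: (end1P hn i) => [hi ep|hi eg ep eN|hi eg ep eN ?|hi eg ep eN ?];
  rewrite ep.
- have -> : (i < n)%N by [].
  rewrite hi.
  have -> : (N - i.+2 < n)%N = false by lia.
  have -> : (N - i.+1 < n)%N = false by lia.
  have -> : (N - (N - i.+2) <= n)%N by lia.
  have -> : (N - (N - i.+1) <= n)%N by lia.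
  split=> //.
  have -> : (N - i.+1 - (N - n) = (N - i.+2 - (N - n)).+1)%N by lia.
  rewrite mulnS exprD mulN1r mulNr; congr (- _).
  by rewrite [RHS]mulrCA mulKf // expf_neq0 // mulf_neq0.
- rewrite eN hi eg ltnn leqnn /=.
  have -> : (n.*2.+1 - n.+1 < n)%N = false by lia.
  have -> : (n.*2.+1 - n < n)%N = false by lia.
  have -> : (n.*2.+1 - n <= n)%N = false by lia.
  have -> : (n.*2.+1 - (n.*2.+1 - n.+1) <= n)%N = false by lia.
  have -> : (n.*2.+1 - (n.*2.+1 - n) <= n)%N by lia.
  have -> : (n.*2.+1 - n - (n.*2.+1 - n) = 0)%N by lia.
  by rewrite muln0 expr0; split; field; rewrite rs0 r0 s0.
- rewrite eN hi eg ltnn leqnn /=.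
  have -> : (n.*2 - n <= n)%N by lia.
  rewrite !mul0r; split=> //.
  have -> : (n - (n.*2 - n) = 0)%N by lia.
  by rewrite muln0 expr0; field; rewrite r0 s0.
- rewrite eN hi eg ?ltnn /=.
  have -> : (i.-1 < n)%N by lia.
  have -> : (n.*2 - n <= n)%N by lia.
  have -> : (n - (n.*2 - n) = 0)%N by lia.
  have -> : (n.*2 - n.+1 < n)%N by lia.
  have -> : (n.*2 - i.-1.+1 < n)%N = false by lia.
  have -> : (n.*2 - (n.*2 - i.-1.+1) <= n)%N by lia.
  have -> : (n.*2 - i.-1.+1 - (n.*2 - n) = 1)%N by lia.
  by rewrite muln0 expr0 expr1; split; field; rewrite r0 s0.
Qed.

Lemma V_e_adj i a c : V_e r s g i a c * norm a = norm c * V_f r s g i c a.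
Proof.
have [h1 h2] := norm_adj i.
rewrite (V_eE r s hn) (V_fE r s hn) !mxE mulrDl mulrDr; congr (_ + _).
  case: eqP => [->|_]; case: eqP => [->|_];
    rewrite /= ?mulr0 ?mul0r ?mulr1 ?h1 1?mulrC //.
case: eqP => [->|_]; case: eqP => [->|_];
  rewrite /= ?mulr0 ?mul0r ?mulr1 ?h2 1?mulrC //.
Qed.

Lemma V_e_weight i a c : V_e r s g i a c != 0 -> wt a = wt c + al i.
Proof.
rewrite (V_eE r s hn) !mxE.
have [/andP[/eqP-> /eqP->] _|_] := boolP ((a == p i) && (c == q i)).
  exact: wt_end1.
have [/andP[/eqP-> /eqP->] _|_] := boolP ((a == rev_ord (q i)) && (c == rev_ord
  (p i))).
  exact: wt_rev_end2.
by rewrite !mulr0 addr0 eqxx.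
Qed.

Definition twist (a b : 'I_N) : K :=
  rs_pow r s (kappa g - form g (wt a) (wt b)) (kappa g + form g (wt b) (wt a)).

Lemma twist_pos a b : pos (twist a b).
Proof. by apply: (posM hpos); apply: pos_qpow. Qed.

(** Raising the left factor by alpha_i brings out the eigenvalue of omega'_i on the right factor, as
    f_i (x) omega'_i in the coproduct demands. [twist_shiftr] does the same for omega_i (x) e_i. *)
Lemma twist_shiftl i a b c : wt a = wt c + al i -> twist a b = twist c b * w' b
  i.
Proof.
have [h1 _] := kappa_form_int hn c b; have [_ h2] := kappa_form_int hn b c.
move=> e; rewrite /twist /w'_eigen e !formE -(rs_powD r0 s0) ?rpredN //.
- by congr rs_pow; ring.
- exact: form_alphal_int.
- exact: form_alphar_int.
Qed.

Lemma twist_shiftr i a b c : wt b = wt c + al i -> w a i * twist a b = twist a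
  c.
Proof.
have [h1 _] := kappa_form_int hn a c; have [_ h2] := kappa_form_int hn c a.
have w0 := w_eigen_neq0 g r0 s0 (wt a) i.
move=> e; apply: (mulfI (invr_neq0 w0)); rewrite mulKf // mulrC.
rewrite -(w_eigenN hpos pr ps hn) /twist /w_eigen e !formE -(rs_powD r0 s0)
  ?rpredN //.
- by congr rs_pow; ring.
- exact: form_alphar_int.
- by rewrite ?opprK; exact: form_alphal_int.
Qed.

Definition tens_norm (k : 'I_(N * N)) : K :=
  let: (a, b) := mxtens_unindex k in norm a * norm b * twist a b.

Lemma tens_normE a b : tens_norm (ix a b) = norm a * norm b * twist a b.
Proof. by rewrite /tens_norm mxtens_indexK. Qed.

Lemma tens_norm_pos k : pos (tens_norm k).
Proof.
case: (mxtens_indexP k) => a b; rewrite tens_normE.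
apply: (posM hpos); last exact: twist_pos.
by apply: (posM hpos); apply: norm_pos.
Qed.

Lemma tens_ge i a b c e : rho2 (Ge i) (ix a b) (ix c e) =
  V_e r s g i a c * (b == e)%:R + w a i * (a == c)%:R * V_e r s g i b e.
Proof.
rewrite /= mxE !tensmxE !mxE; congr (_ + _ * _).
by rewrite mulr_natr.
Qed.

Lemma tens_gf i a b c e : rho2 (Gf i) (ix a b) (ix c e) =
  (a == c)%:R * V_f r s g i b e + V_f r s g i a c * (w' b i * (b == e)%:R).
Proof.
by rewrite /= mxE !tensmxE !mxE mulr_natr.
Qed.

Lemma adjoint_entries (m : nat) (d : 'I_m -> K) (A B : 'M[K]_m) :
  (forall k l, A k l * d k = d l * B l k) -> forall u v,
  diag_form d (A *m u) v = diag_form d u (B *m v).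
Proof.
move=> AB u v; rewrite /diag_form.
under eq_bigr => k _ do rewrite mxE mulr_sumr mulr_suml.
rewrite exchange_big; apply: eq_bigr => l _.
rewrite mxE mulr_sumr; apply: eq_bigr => k _.
transitivity (A k l * d k * (u l 0 * v k 0)); first by ring.
by rewrite AB; ring.
Qed.

Lemma VV_ef_adj i u v : diag_form tens_norm (act M (Ge i) u) v =
  diag_form tens_norm u (act M (Gf i) v).
Proof.
apply: adjoint_entries => k l.
case: (mxtens_indexP k) => a b; case: (mxtens_indexP l) => c e.
rewrite tens_ge tens_gf !tens_normE mulrDl mulrDr addrC; congr (_ + _).
  rewrite [c == a]eq_sym; case: eqP => [<-|_]; last by rewrite !(mulr0, mul0r).
  rewrite mulr1 mul1r; have [e0|e0] := eqVneq (V_e r s g i b e) 0.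
    have := V_e_adj i b e; rewrite e0 mul0r => /esym h.
    transitivity (norm e * V_f r s g i e b * (norm a * twist a e));
      last by ring.
    by rewrite h mulr0 !mul0r.
  rewrite -(twist_shiftr a (V_e_weight e0)).
  transitivity (norm a * (V_e r s g i b e * norm b) * (w a i * twist a b));
    first by ring.
  by rewrite V_e_adj; ring.
rewrite [e == b]eq_sym; case: eqP => [<-|_]; last by rewrite !(mulr0, mul0r).
rewrite !mulr1; have [e0|e0] := eqVneq (V_e r s g i a c) 0.
  have := V_e_adj i a c; rewrite e0 mul0r => /esym h.
  transitivity (norm c * V_f r s g i c a * (norm b * twist c b * w' b i));
    last by ring.
  by rewrite h !mul0r.
rewrite (twist_shiftl b (V_e_weight e0)).
transitivity (norm b * (V_e r s g i a c * norm a) * (twist c b * w' b i));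
  first by ring.
by rewrite V_e_adj; ring.
Qed.

Lemma toral_rep x : toral x -> exists t : 'I_N -> K,
  rho x = diag_mx (\row_k t k).
Proof. by case: x => // i _; eexists. Qed.

Lemma VV_toral_entry x k l : toral x -> k != l -> rho2 x k l = 0.
Proof.
case: (mxtens_indexP k) => a b; case: (mxtens_indexP l) => c e tx.
rewrite (can_eq (@mxtens_indexK N N)) xpair_eqE.
have [t rt] := toral_rep tx.
have -> : rho2 x = rho x *t rho x by case: (x) tx.
rewrite tensmxE rt !mxE; case: eqP => //= _; last by rewrite [_ *+ 0]mulr0n
  mul0r.
by move=> /negPf ->; rewrite mulr0n mulr0.
Qed.

Lemma VV_toral_adj x u v : toral x -> diag_form tens_norm (act M x u) v =
  diag_form tens_norm u (act M x v).
Proof.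
move=> tx; apply: adjoint_entries => k l.
have [->|kl] := eqVneq k l; first by rewrite mulrC.
by rewrite (VV_toral_entry tx kl) mul0r VV_toral_entry ?mulr0 // eq_sym.
Qed.

Definition tens_level (k : 'I_(N * N)) : nat :=
  let: (a, b) := mxtens_unindex k in (a + b)%N.

Lemma V_e_level (i : 'I_n) (a c : 'I_N) : V_e r s g i a c != 0 -> (a < c)%N.
Proof.
have := dimV_bounds g n; have := ltn_ord i.
have lpq : (p i < q i)%N.
  by rewrite [nat_of_ord (q i)]/=; case: (end1P hn i) => [_|_ _|_ _|_ _] ->;
    lia.
have := ltn_ord (q i).
rewrite (V_eE r s hn) !mxE.
have [/andP[/eqP-> /eqP->] //|_] := boolP ((a == p i) && (c == q i)).
have [/andP[/eqP-> /eqP->] lq _ _ _|_] := boolP ((a == rev_ord (q i)) && (c ==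
  rev_ord (p i))).
  by rewrite !rev_ordE; lia.
by rewrite !mulr0 addr0 eqxx.
Qed.

Lemma VV_e_level (i : 'I_n) (k l : 'I_(N * N)) : rho2 (Ge i) k l != 0 ->
  (tens_level k < tens_level l)%N.
Proof.
case: (mxtens_indexP k) => a b; case: (mxtens_indexP l) => c e.
rewrite tens_ge /tens_level !mxtens_indexK.
have [ac|ac] := eqVneq (V_e r s g i a c) 0; last first.
  have lac := V_e_level ac; case: (b =P e) => [->|_];
    first by rewrite ltn_add2r.
  rewrite mulr0 add0r; have [be|/V_e_level lbe _] := eqVneq (V_e r s g i b e) 0.
    by rewrite be mulr0 eqxx.
  by lia.
rewrite ac mul0r add0r; have [be|/V_e_level lbe] := eqVneq (V_e r s g i b e) 0.
  by rewrite be mulr0 eqxx.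
case: (a =P c) => [->|_]; first by rewrite ltn_add2l.
by rewrite mulr0 mul0r eqxx.
Qed.

End TensorSquare.

(** * Singular vectors of the tensor square *)

Section TopIndices.

Variables (g : classical_type) (n : nat).
Hypothesis hn : (match g with TypeB => 1 | TypeC => 2 | TypeD => 3 end <= n)%N.

Local Notation N := (dimV g n).
Local Notation p := (end1 hn).
Local Notation q := (end2 hn).
Local Notation wt := (@wt g n).

Fact dimV_gt1 : (1 < N)%N.
Proof. by move: hn; rewrite /dimV; case: (g); lia. Qed.

Fact rank_gt0 : (0 < n)%N.
Proof. by move: hn; case: (g); lia. Qed.

Definition top1 : 'I_N := Ordinal (ltnW dimV_gt1).
Definition top2 : 'I_N := Ordinal dimV_gt1.
Definition root1 : 'I_n := Ordinal rank_gt0.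

Definition singular_weight (j : 'I_3) : weight n :=
  match val j with
  | 0 => eps n 1 *+ 2
  | 1 => eps n 1 + eps n 2
  | _ => 0
  end.

Lemma wt_top1 : wt top1 = eps n 1.
Proof. by rewrite /wt /V_weight /= rank_gt0. Qed.

(** For so_3 the second basis vector is the middle one, of weight 0, in agreement with the
    convention eps_2 = 0. *)
Lemma wt_top2 : wt top2 = eps n 2.
Proof.
rewrite /wt /V_weight /=; case: ltnP => // n1; have n_1 : n = 1%N.
  by have := rank_gt0; lia.
have -> : eps n 2 = 0.
  apply/rowP => k; rewrite !mxE; have := ltn_ord k; rewrite {2}n_1.
  by case: (nat_of_ord k) => //=; lia.
case: ifP => //; rewrite /prime_idx /dimV; move: hn n1; case: (g); rewrite n_1;
  lia.
Qed.

Lemma end1_top i : p i = top1 -> q i = top2.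
Proof.
move=> /(congr1 (@nat_of_ord _)) e; apply: ord_inj; move: e; have := ltn_ord i.
by case: (end1P hn i) => [hi ->|hi _ -> _|hi _ -> _ ?|hi _ -> _ ?] /=; lia.
Qed.

Lemma rev_end2_top i : rev_ord (q i) != top1.
Proof.
rewrite -(inj_eq (@ord_inj _)) rev_ordE /=; have := ltn_ord i.
by have := dimV_bounds g n; case: (end1P hn i) => [hi _|hi _ _ eN|hi _ _ eN
  ?|hi _ _ eN ?];
  rewrite ?eN; lia.
Qed.

Lemma end1_lt_end2 i : (p i < q i)%N.
Proof.
have := ltn_ord i; rewrite [nat_of_ord (q i)]/=.
by case: (end1P hn i) => [_|_ _|_ _|_ _] ->; lia.
Qed.

Lemma rev_end2_lt i : (rev_ord (q i) < rev_ord (p i))%N.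
Proof. by rewrite !rev_ordE; have := end1_lt_end2 i; have := ltn_ord (q i);
  lia. Qed.

(** So every basis vector but v_1 is raised by some e_i with nonzero coefficient: c1 in the first
    case, c2 in the second, whose side condition excludes c2 = 0. *)
Lemma lower_index (a : 'I_N) : a != top1 -> exists i,
  a = q i \/ a = rev_ord (p i) /\ ((i.+1 < n)%N \/ g = TypeB).
Proof.
rewrite -(inj_eq (@ord_inj _)) /= => a0; have la := ltn_ord a;
  have hN := dimV_bounds g n.
case: (leqP a n) => an.
  have h : (a.-1 < n)%N by lia.
  by exists (Ordinal h); left; apply: ord_inj => /=; lia.
have h : (N.-1 - a < n)%N by lia.
pose i : 'I_n := Ordinal h; exists i; right; have iE : i = (N.-1 - a)%N :> nat
  by [].
case: (end1P hn i) => [hi ep|hi eg ep eN|hi eg ep eN h2|hi eg ep eN h2].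
- by split; [apply: ord_inj; rewrite rev_ordE ep; lia | left].
- by split; [apply: ord_inj; rewrite rev_ordE ep; lia | right].
- by exfalso; lia.
- by exfalso; lia.
Qed.

End TopIndices.

Section SingularVectors.

Variables (K : fieldType) (pos : K -> Prop) (hpos : pos_cone pos).
Variables (r s : K) (pr : pos r) (ps : pos s) (rs : r != s).
Variables (g : classical_type) (n : nat).
Hypothesis hn : (match g with TypeB => 1 | TypeC => 2 | TypeD => 3 end <= n)%N.

Let r0 : r != 0 := pos_neq0 hpos pr.
Let s0 : s != 0 := pos_neq0 hpos ps.

Local Notation N := (dimV g n).
Local Notation p := (end1 hn).
Local Notation q := (end2 hn).
Local Notation wt := (@wt g n).
Local Notation rho := (@V_rep K r s g n).
Local Notation c1 := (e_coef1 r s g).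
Local Notation c2 := (e_coef2 K g).

Local Notation w a i := (w_eigen r s g (wt a) i).
Local Notation w' a i := (w'_eigen r s g (wt a) i).
Local Notation rho2 := (tensor_rep rho rho).
Local Notation ix a b := (mxtens_index (a, b)).
Local Notation M := (matrix_gmodule rho2).

Lemma tens_act_e i (u : 'cV[K]_(N * N)) a b : (act M (Ge i) u) (ix a b) 0 =
  c1 i * (a == p i)%:R * u (ix (q i) b) 0 +
  c2 i * (a == rev_ord (q i))%:R * u (ix (rev_ord (p i)) b) 0 +
  w a i * (c1 i * (b == p i)%:R * u (ix a (q i)) 0 +
           c2 i * (b == rev_ord (q i))%:R * u (ix a (rev_ord (p i))) 0).
Proof.
have V_sum x (F : 'I_N -> K) : \sum_y V_e r s g i x y * F y =
    c1 i * (x == p i)%:R * F (q i) + c2 i * (x == rev_ord (q i))%:R * F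
      (rev_ord (p i)).
  have d (y0 : 'I_N) : \sum_y (y == y0)%:R * F y = F y0.
    by rewrite (bigD1 y0) //= eqxx mul1r big1 ?addr0 // => y /negPf ->;
      rewrite mul0r.
  rewrite -(d (q i)) -(d (rev_ord (p i))) !mulr_sumr -big_split;
    apply: eq_bigr => y _.
  rewrite (V_eE r s hn) !mxE -!mulnb !natrM /=; ring.
rewrite mxE (reindex (@mxtens_index N N)) /=; last first.
  by exists (@mxtens_unindex N N) => x _; rewrite (mxtens_indexK,
    mxtens_unindexK).
transitivity (\sum_c \sum_e rho2 (Ge i) (ix a b) (ix c e) * u (ix c e) 0).
  by rewrite pair_big; apply: eq_bigr => -[c e].
under eq_bigr => c _ do under eq_bigr => e _ do rewrite tens_ge mulrDl.
under eq_bigr => c _ do rewrite big_split /=.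
rewrite big_split /=; congr (_ + _).
  rewrite -(V_sum a (fun c => u (ix c b) 0)); apply: eq_bigr => c _.
  rewrite (bigD1 b) //= eqxx mulr1 big1 ?addr0 // => e eb.
  by rewrite [b == e]eq_sym (negPf eb) mulr0 mul0r.
rewrite -(V_sum b (fun e => u (ix a e) 0)) (bigD1 a) //= [X in _ + X]big1
  ?addr0 => [|c ca].
  by rewrite mulr_sumr; apply: eq_bigr => e _; rewrite eqxx mulr1 mulrA.
by apply: big1 => e _; rewrite [a == c]eq_sym (negPf ca) mulr0 !mul0r.
Qed.

Local Notation top1 := (top1 hn).
Local Notation top2 := (top2 hn).
Local Notation root1 := (root1 hn).
Local Notation singular_weight := (@singular_weight n).

(* The coefficients of the invariant vector sum_a u_a v_a (x) v_a' *)
Definition trivial_coef (a : 'I_N) : K :=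
  if (a < n)%N then r ^+ (kappa2 g * a)
  else
    match g with TypeB => r / s | TypeC => - (r / s) | TypeD => 1 end
    * r ^+ (kappa2 g * n.-1)
    * (if (N - a <= n)%N then s ^- (kappa2 g * (a - (N - n))) else 1).

(** The constant in the second vector: e_1 sends v_2 (x) v_1 to v_1 (x) v_1, and v_1 (x) v_2 to the
    same vector times the eigenvalue of omega_1 on v_1. *)
Definition singular_entry (j : 'I_3) (a b : 'I_N) : K :=
  match val j with
  | 0 => ((a == top1) && (b == top1))%:R
  | 1 => ((a == top1) && (b == top2))%:R
         - w top1 root1 * ((a == top2) && (b == top1))%:R
  | _ => (b == rev_ord a)%:R * trivial_coef a
  end.

Definition singular_vec (j : 'I_3) : 'cV[K]_(N * N) :=
  \col_k let: (a, b) := mxtens_unindex k in singular_entry j a b.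

Lemma singular_vecE j a b : singular_vec j (ix a b) 0 = singular_entry j a b.
Proof. by rewrite mxE mxtens_indexK. Qed.

Lemma singular_entry_weight j a b : singular_entry j a b != 0 ->
  wt a + wt b = singular_weight j.
Proof.
rewrite /singular_entry /singular_weight; case: (val j) => [|[|k]].
- case: (a =P top1) => [->|_]; last by rewrite eqxx.
  by case: (b =P top1) => [->|_]; [rewrite wt_top1 mulr2n | rewrite eqxx].
- have [/andP[/eqP -> /eqP ->]|_] := boolP ((a == top1) && (b == top2)).
    by rewrite wt_top1 wt_top2.
  have [/andP[/eqP -> /eqP ->]|_] := boolP ((a == top2) && (b == top1)).
    by move=> _; rewrite wt_top1 wt_top2 addrC.
  by rewrite /= mulr0 subrr eqxx.
- by case: (b =P rev_ord a) => [->|_]; [rewrite wt_rev subrr | rewrite mul0r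
  eqxx].
Qed.

Lemma singular_vec_weight j : has_weight (M := M) r s g (singular_vec j)
  (singular_weight j).
Proof.
have diag_act (t : 'I_N -> K) x y : rho x = diag_mx (\row_k t k) ->
    rho2 x = rho x *t rho x ->
    (forall a b, singular_entry j a b != 0 -> t a * t b = y) ->
    act M x (singular_vec j) = y *: singular_vec j.
  move=> rt rr ht; apply/colP => k; case: (mxtens_indexP k) => a b.
  rewrite mxE [RHS]mxE (bigD1 (ix a b)) //= big1 => [|l kl].
    rewrite rr tensmxE rt !mxE !eqxx !mulr1n mxtens_indexK addr0.
    by have [->|/ht ->] := eqVneq (singular_entry j a b) 0; rewrite ?mulr0.
  suff -> : rho2 x (ix a b) l = 0 by rewrite mul0r.
  case: (mxtens_indexP l) kl => c e kl; rewrite rr tensmxE rt !mxE.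
  move: kl; rewrite (can_eq (@mxtens_indexK N N)) xpair_eqE.
  rewrite [c == a]eq_sym [e == b]eq_sym; case: eqP => //= _ h.
    by rewrite (negPf h) mulr0n mulr0.
  by rewrite [_ *+ 0]mulr0n mul0r.
move=> i; split.
  apply: (diag_act (fun a => w a i)) => // a b /singular_entry_weight <-.
  by rewrite (w_eigenD hn r0 s0).
apply: (diag_act (fun a => w' a i)) => // a b /singular_entry_weight <-.
by rewrite (w'_eigenD hn r0 s0).
Qed.

End SingularVectors.

(** * Uniqueness of singular vectors *)

Section SingularSpace.

Variables (K : fieldType) (pos : K -> Prop) (hpos : pos_cone pos).
Variables (r s : K) (pr : pos r) (ps : pos s) (rs : r != s).
Variables (g : classical_type) (n : nat).
Hypothesis hn : (match g with TypeB => 1 | TypeC => 2 | TypeD => 3 end <= n)%N.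

Let r0 : r != 0 := pos_neq0 hpos pr.
Let s0 : s != 0 := pos_neq0 hpos ps.

Local Notation N := (dimV g n).
Local Notation p := (end1 hn).
Local Notation q := (end2 hn).
Local Notation wt := (@wt g n).
Local Notation rho := (@V_rep K r s g n).
Local Notation c1 := (e_coef1 r s g).
Local Notation c2 := (e_coef2 K g).

Local Notation w a i := (w_eigen r s g (wt a) i).
Local Notation rho2 := (tensor_rep rho rho).
Local Notation ix a b := (mxtens_index (a, b)).
Local Notation M := (matrix_gmodule rho2).
Local Notation top1 := (top1 hn).
Local Notation top2 := (top2 hn).
Local Notation root1 := (root1 hn).

Lemma mulf_eq0_right (x y : K) : x != 0 -> x * y = 0 -> y = 0.
Proof. by move=> x0 /eqP; rewrite mulf_eq0 (negPf x0) => /eqP. Qed.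

Lemma e_coef1_neq0 (i : 'I_n) : c1 i != 0.
Proof.
rewrite /e_coef1; case: ifP => _; first exact: oner_neq0.
by case: (g); rewrite ?oner_neq0 // invr_neq0 // mulf_neq0.
Qed.

Lemma e_coef2_neq0 (i : 'I_n) : (i.+1 < n)%N \/ g = TypeB -> c2 i != 0.
Proof.
have N1 : -1 != 0 :> K by rewrite oppr_eq0 oner_neq0.
rewrite /e_coef2; case=> [->|->] //; by case: ifP.
Qed.

Lemma e_coef2_eq0 i : (p i == rev_ord (q i)) -> c2 i = 0.
Proof. by move=> /end1_rev2[eg _ ei]; rewrite /e_coef2 ei ltnn eg. Qed.

Section SingularEquations.

Variable t : 'cV[K]_(N * N).
Hypothesis te : forall i, act M (Ge i) t = 0.

Local Notation T a b := (t (ix a b) 0).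

Lemma singular_eq i a b :
  c1 i * (a == p i)%:R * T (q i) b + c2 i * (a == rev_ord (q i))%:R * T
    (rev_ord (p i)) b +
  w a i * (c1 i * (b == p i)%:R * T a (q i) +
           c2 i * (b == rev_ord (q i))%:R * T a (rev_ord (p i))) = 0.
Proof. by rewrite -(tens_act_e r s hn) te mxE. Qed.

(** If v_b is not in the support of the image of e_i, the coefficient of v_p (x) v_b in e_i t comes
    from v_q (x) v_b only. The next three lemmas treat the other factor and the other entry of e_i
    alike. *)
Lemma singular_left_q i b : b != p i -> b != rev_ord (q i) -> T (q i) b = 0.
Proof.
move=> bp bq; have := singular_eq i (p i) b; rewrite eqxx (negPf bp) (negPf bq).
rewrite !(mulr0, mul0r, addr0, mulr1); have [/e_coef2_eq0 ->|_] := boolP (p i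
  == rev_ord (q i)).
  by rewrite !(mul0r, addr0) => /eqP; rewrite mulf_eq0 (negPf (e_coef1_neq0 i))
    => /eqP.
by rewrite !(mulr0, mul0r, addr0) => /eqP; rewrite mulf_eq0 (negPf
  (e_coef1_neq0 i)) => /eqP.
Qed.

Lemma singular_right_q i a : a != p i -> a != rev_ord (q i) -> T a (q i) = 0.
Proof.
have c1n := e_coef1_neq0 i; have wn := w_eigen_neq0 g r0 s0 (wt a) i.
move=> ap aq; have := singular_eq i a (p i); rewrite eqxx (negPf ap) (negPf aq).
rewrite !(mulr0, mul0r, add0r, mulr1); have [/e_coef2_eq0 ->|_] := boolP (p i
  == rev_ord (q i)).
  by rewrite !(mul0r, addr0) => /(mulf_eq0_right wn)/(mulf_eq0_right c1n).
by rewrite !(mulr0, mul0r, addr0) => /(mulf_eq0_right wn)/(mulf_eq0_right c1n).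
Qed.

Lemma singular_left_p i b : c2 i != 0 -> b != p i -> b != rev_ord (q i) ->
  T (rev_ord (p i)) b = 0.
Proof.
move=> c2n bp bq; have := singular_eq i (rev_ord (q i)) b.
have pq' : rev_ord (q i) == p i = false.
  by apply: contraNF c2n => h; rewrite e_coef2_eq0 // eq_sym.
rewrite eqxx (negPf bp) (negPf bq) pq' !(mulr0, mul0r, add0r, addr0, mulr1).
by move=> /eqP; rewrite mulf_eq0 (negPf c2n) => /eqP.
Qed.

Lemma singular_right_p i a : c2 i != 0 -> a != p i -> a != rev_ord (q i) ->
  T a (rev_ord (p i)) = 0.
Proof.
have wn := w_eigen_neq0 g r0 s0 (wt a) i.
move=> c2n ap aq; have := singular_eq i a (rev_ord (q i)).
have pq' : rev_ord (q i) == p i = false.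
  by apply: contraNF c2n => h; rewrite e_coef2_eq0 // eq_sym.
rewrite eqxx (negPf ap) (negPf aq) pq' !(mulr0, mul0r, add0r, addr0, mulr1).
by move=> /(mulf_eq0_right wn)/(mulf_eq0_right c2n).
Qed.

Lemma singular_link_q i : T (p i) (rev_ord (p i)) = 0 ->
  T (q i) (rev_ord (q i)) = 0.
Proof.
have c1n := e_coef1_neq0 i.
move=> h; have := singular_eq i (p i) (rev_ord (q i)); rewrite !eqxx h.
rewrite [rev_ord (q i) == p i]eq_sym.
have [e|_] := boolP (p i == rev_ord (q i)).
  rewrite e_coef2_eq0 // !(mulr0, mul0r, addr0, mulr1).
  have -> : q i = rev_ord (p i) by rewrite (eqP e) rev_ordK.
  by rewrite h !(mulr0, addr0) => /eqP; rewrite mulf_eq0 (negPf c1n) => /eqP.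
rewrite !(mulr0, mul0r, addr0, mulr1) => /eqP.
by rewrite mulf_eq0 (negPf c1n) => /eqP.
Qed.

Lemma singular_link_p i : c2 i != 0 -> T (rev_ord (q i)) (q i) = 0 ->
  T (rev_ord (p i)) (p i) = 0.
Proof.
move=> c2n h; have := singular_eq i (rev_ord (q i)) (p i).
have pq' : rev_ord (q i) == p i = false.
  by apply: contraNF c2n => e; rewrite e_coef2_eq0 // eq_sym.
rewrite !eqxx [p i == rev_ord (q i)]eq_sym pq' h.
rewrite !(mulr0, mul0r, addr0, add0r, mulr1) => /eqP.
by rewrite mulf_eq0 (negPf c2n) => /eqP.
Qed.

End SingularEquations.

(** Here v_x is the vector to which some e_i raises v_a. Iterating towards smaller indices reduces
    all entries of a singular t to the row of v_1. *)
Lemma singular_descent (a : 'I_N) : a != top1 -> exists x : 'I_N,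
  [/\ (x < a)%N, x = top1 -> a = top2
    & forall t, (forall i, act M (Ge i) t = 0) ->
      [/\ forall b, b != rev_ord a -> b != x -> t (ix a b) 0 = 0,
          forall b, b != rev_ord a -> b != x -> t (ix b a) 0 = 0
        & t (ix x (rev_ord x)) 0 = 0 -> t (ix a (rev_ord a)) 0 = 0]].
Proof.
move=> /lower_index[i [->|[-> /e_coef2_neq0 c2n]]].
  exists (p i); split; [exact: end1_lt_end2 | exact: end1_top |] => t te; split.
  - by move=> b b1 b2; apply: singular_left_q.
  - by move=> b b1 b2; apply: singular_right_q.
  - exact: singular_link_q.
exists (rev_ord (q i)); split; first exact: rev_end2_lt.
  by move/eqP; rewrite (negPf (rev_end2_top hn i)).
move=> t te; rewrite !rev_ordK; split.
- by move=> b b1 b2; apply: singular_left_p.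
- by move=> b b1 b2; apply: singular_right_p.
- exact: singular_link_p.
Qed.

Lemma end1_root1 : p root1 = top1.
Proof.
by apply: ord_inj => /=; case: (end1P hn root1) => [_|_ _|_ _|_ _] /= ->.
Qed.

Lemma end2_root1 : q root1 = top2.
Proof. exact: ord_inj. Qed.

Lemma singular_unique t : (forall i, act M (Ge i) t = 0) ->
  t (ix top1 top1) 0 = 0 -> t (ix top1 top2) 0 = 0 ->
  t (ix top1 (rev_ord top1)) 0 = 0 -> t = 0.
Proof.
move=> te t11 t12 t1r.
have t21 : t (ix top2 top1) 0 = 0.
  have := singular_eq te root1 top1 top1.
  rewrite end1_root1 end2_root1 eqxx t12.
  have -> : (top1 == rev_ord top2) = false.
    by apply/negbTE; rewrite eq_sym -end2_root1 rev_end2_top.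
  rewrite !(mulr0, mul0r, addr0, mulr1) => /eqP.
  by rewrite mulf_eq0 (negPf (e_coef1_neq0 root1)) => /eqP.
have diag k : forall a : 'I_N, (a < k)%N -> t (ix a (rev_ord a)) 0 = 0.
  elim: k => // k IH a ak; have [->//|a1] := eqVneq a top1.
  have [x [xa _ /(_ t te)[_ _]]] := singular_descent a1; apply; apply: IH.
  exact: leq_trans xa _.
apply/colP => k; rewrite mxE; case: (mxtens_indexP k) => a b.
have [->|ba] := eqVneq b (rev_ord a); first exact: diag (ltnSn a).
have ba' : a != rev_ord b by apply: contraNneq ba => ->; rewrite rev_ordK.
have [ea|a1] := eqVneq a top1.
  rewrite ea; have [->//|b1] := eqVneq b top1.
  have [x [_ xt /(_ t te)[_ h _]]] := singular_descent b1.
  have [/esym/xt ->//|xa] := eqVneq top1 x.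
  by apply: h => //; rewrite -ea.
have [x [xa xt /(_ t te)[h _ _]]] := singular_descent a1.
(* The entry (a, x) is left. Its column is governed by the neighbour y < x < a of x, so that a is
   not y; if x is the top index, then a is [top2] and the entry is [t21]. *)
have [ebx|bx] := eqVneq b x; last exact: h.
have [eb|b1] := eqVneq b top1; first by rewrite xt -?ebx // eb.
have [y [yb _ /(_ t te)[_ h' _]]] := singular_descent b1.
apply: h' => //; apply: contraTneq yb => <-; rewrite ebx -leqNgt; exact: ltnW.
Qed.

End SingularSpace.

(** * The three singular vectors and the decomposition *)

Section Assembly.

Variables (K : fieldType) (pos : K -> Prop) (hpos : pos_cone pos).
Variables (r s : K) (pr : pos r) (ps : pos s) (rs : r != s).
Variables (g : classical_type) (n : nat).
Hypothesis hn : (match g with TypeB => 1 | TypeC => 2 | TypeD => 3 end <= n)%N.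

Let r0 : r != 0 := pos_neq0 hpos pr.
Let s0 : s != 0 := pos_neq0 hpos ps.

Local Notation N := (dimV g n).
Local Notation p := (end1 hn).
Local Notation q := (end2 hn).
Local Notation wt := (@wt g n).
Local Notation rho := (@V_rep K r s g n).
Local Notation c1 := (e_coef1 r s g).
Local Notation c2 := (e_coef2 K g).

Local Notation w a i := (w_eigen r s g (wt a) i).
Local Notation rho2 := (tensor_rep rho rho).
Local Notation ix a b := (mxtens_index (a, b)).
Local Notation M := (matrix_gmodule rho2).
Local Notation top1 := (top1 hn).
Local Notation top2 := (top2 hn).
Local Notation root1 := (root1 hn).
Local Notation sv := (singular_vec r s hn).
Local Notation un := (trivial_coef r s (g := g) (n := n)).

(** These are the equations of e_i at the positions (p, q') and (q', p), the recursion behind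
    [trivial_coef]. For the long root of sp_{2n} the two positions coincide, whence the indicator
    terms. *)
Lemma trivial_coef_eq i :
  c1 i * un (q i) + w (p i) i * (c2 i * un (p i)) +
    (p i == rev_ord (q i))%:R * (w (p i) i * (c1 i * un (p i))) = 0 /\
  c2 i * un (rev_ord (p i)) + w (rev_ord (q i)) i * (c1 i * un (rev_ord (q i)))
    =
    (p i == rev_ord (q i))%:R * (w (p i) i * (c1 i * un (p i))).
Proof.
have [h1 h2 h3 h4] := end_exponentsE hn i.
have [wp _] := w_w'_form r s h1 h2; have [wq _] := w_w'_form r s h3 h4.
rewrite wt_rev (w_eigenN hpos pr ps hn) wp wq end1_rev2E {h1 h2 h3 h4 wp wq}.
rewrite /end_exponents /e_coef1 /e_coef2 /trivial_coef !rev_ordE.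
rewrite [nat_of_ord (q i)]/=.
have hN := dimV_bounds g n; have li := ltn_ord i.
case: (end1P hn i) => [hi ep|hi eg ep eN|hi eg ep eN h|hi eg ep eN h];
  rewrite ep.
- have -> : (i < n)%N by [].
  rewrite hi.
  have -> : (N - i.+2 < n)%N = false by lia.
  have -> : (N - i.+1 < n)%N = false by lia.
  have -> : (N - (N - i.+2) <= n)%N by lia.
  have -> : (N - (N - i.+1) <= n)%N by lia.
  have -> : (N - i.+1 - (N - n) = (N - i.+2 - (N - n)).+1)%N by lia.
  rewrite !mulnS !exprD oppr0 opprK expr0z mulr1 mul1r /= -!exprnP.
  have q1 : s ^+ kappa2 g != 0 by rewrite expf_neq0.
  have q2 : s ^+ (kappa2 g * (N - i.+2 - (N - n))) != 0 by rewrite expf_neq0.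
  by split; field; rewrite ?q1 ?q2.
- rewrite eN hi eg ltnn leqnn /=.
  have -> : (n.*2.+1 - n.+1 < n)%N = false by lia.
  have -> : (n.*2.+1 - n < n)%N = false by lia.
  have -> : (n.*2.+1 - n <= n)%N = false by lia.
  have -> : (n.*2.+1 - (n.*2.+1 - n.+1) <= n)%N = false by lia.
  have -> : (n.*2.+1 - (n.*2.+1 - n) <= n)%N by lia.
  have -> : (n.*2.+1 - n - (n.*2.+1 - n) = 0)%N by lia.
  have -> : n.-1 = i by lia.
  rewrite muln0 expr0 oppr0 !expr0z -invr_expz !expr1z.
  by split; field; rewrite ?oner_eq0 ?s0.
- rewrite eN hi eg ltnn leqnn /=.
  have -> : (n.*2 - n.+1 < n)%N by lia.
  have -> : (n.*2 - n < n)%N = false by lia.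
  have -> : (n.*2 - n <= n)%N by lia.
  have -> : (n - (n.*2 - n) = 0)%N by lia.
  have -> : (n.*2 - n.+1 = i)%N by lia.
  have -> : n.-1 = i by lia.
  rewrite muln0 expr0 opprK -!invr_expz !expr1z.
  by split; field; rewrite ?oner_eq0 ?s0 ?r0.
- rewrite eN hi eg ltnn /=.
  have -> : (i.-1 < n)%N by lia.
  have -> : (n.*2 - n.+1 < n)%N by lia.
  have -> : (n.*2 - i.-1.+1 < n)%N = false by lia.
  have -> : (n.*2 - n <= n)%N by lia.
  have -> : (n.*2 - (n.*2 - i.-1.+1) <= n)%N by lia.
  have -> : (n - (n.*2 - n) = 0)%N by lia.
  have -> : (n.*2 - i.-1.+1 - (n.*2 - n) = 1)%N by lia.
  have -> : (n.*2 - n.+1 = i.-1.+1)%N by lia.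
  have -> : n.-1 = i.-1.+1 by lia.
  rewrite muln0 !mul1n expr0 oppr0 !expr0z -!invr_expz !expr1z !exprS.
  by split; field; rewrite ?oner_eq0 ?s0 ?r0.
Qed.

Lemma singular_vec_e j i : act M (Ge i) (sv j) = 0.
Proof.
apply/colP => k; rewrite [RHS]mxE; case: (mxtens_indexP k) => a b.
have q1 : q i == top1 = false by apply/negbTE; rewrite -(inj_eq (@ord_inj _)).
have qp0 := rev_end2_lt hn i.
have q'1 : (0 < rev_ord (q i))%N by have := rev_end2_top hn i;
  rewrite -(inj_eq (@ord_inj _)) lt0n.
have p1 : rev_ord (p i) == top1 = false by rewrite -(inj_eq (@ord_inj _))
  [nat_of_ord top1]/=; lia.
have p2 : rev_ord (p i) == top2 = false by rewrite -(inj_eq (@ord_inj _))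
  [nat_of_ord top2]/=; lia.
rewrite (tens_act_e r s hn) !singular_vecE /singular_entry;
  case: (val j) => [|[|l]].
- by rewrite q1 p1 !(andbF, andFb, mulr0n, mulr0, addr0).
- rewrite q1 p1 p2 !(andbF, andFb, mulr0n, subr0, sub0r, mulr0, addr0, add0r,
  oppr0).
  have [qt|_] := eqVneq (q i) top2; last by rewrite !(andbF, andFb, mulr0,
    oppr0, addr0).
  have ir : i = root1 by move/(congr1 (@nat_of_ord _)): qt => [] h;
    apply: ord_inj.
  have pt : p i = top1 by rewrite ir end1_root1.
  rewrite pt andbT andTb ir.
  case: (a =P top1) => [->|_]; case: (b =P top1) => [_|_]; rewrite /=; ring.
- have [U1 U2] := trivial_coef_eq i.
  have e1 : (q i == rev_ord a) = (a == rev_ord (q i)).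
    by rewrite -(inj_eq rev_ord_inj) rev_ordK eq_sym.
  rewrite !rev_ordK (inj_eq rev_ord_inj) e1 [p i == a]eq_sym.
  have [ap|ap] := eqVneq a (p i).
    rewrite ap; have [e|e] := eqVneq (p i) (rev_ord (q i)).
      rewrite -e eqxx in U1 U2 *; case: (b =P p i) => _ /=; last by ring.
      move: U1 U2; rewrite !mul1r => U1 U2.
      have {}U2 : c2 i * un (rev_ord (p i)) = 0.
        by apply: (@addIr _ (w (p i) i * (c1 i * un (p i)))); rewrite add0r.
      transitivity (c1 i * un (q i) + w (p i) i * (c2 i * un (p i)) +
        w (p i) i * (c1 i * un (p i)) + c2 i * un (rev_ord (p i)));
          last by rewrite U1 U2 addr0.
      by ring.
    rewrite (negPf e) mul0r addr0 in U1.
    case: (b == rev_ord (q i)); rewrite /=; last by ring.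
    by rewrite -[RHS]U1; ring.
  have [aq|aq] := eqVneq a (rev_ord (q i)); last by rewrite /=; ring.
  have e : (p i == rev_ord (q i)) = false by rewrite -aq eq_sym (negPf ap).
  rewrite aq; rewrite e mul0r in U2.
  by case: (b == p i); rewrite /=; [rewrite -[RHS]U2; ring | ring].
Qed.

(** The supports are pairwise disjoint: N is at least 3, so neither (1, 1) nor (1, 2) nor (2, 1)
    lies on the antidiagonal. *)
Lemma singular_vec_orth j k : j != k -> diag_form (tens_norm r s (g := g) (n :=
  n)) (sv j) (sv k) = 0.
Proof.
move=> jk; rewrite /diag_form big1 // => l _; case: (mxtens_indexP l) => a b.
rewrite !singular_vecE -mulrA; suff -> : singular_entry r s hn j a b *
  singular_entry r s hn k a b = 0.
  by rewrite mulr0.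
have r1 : (top1 == rev_ord top1) = false.
  by apply/negbTE; rewrite -(inj_eq (@ord_inj _)) rev_ordE /=;
    have := dimV_gt1 hn; lia.
have t12 : (top2 == top1) = false by [].
have r2 : (top2 == rev_ord top1) = false.
  apply/negbTE; rewrite -(inj_eq (@ord_inj _)) rev_ordE /=;
    have := rev_end2_top hn root1.
  by rewrite -(inj_eq (@ord_inj _)) rev_ordE /=; lia.
have r3 : (top1 == rev_ord top2) = false.
  by rewrite -(inj_eq rev_ord_inj) rev_ordK eq_sym.
have z0 : (rev_ord top1 == top1) = false by rewrite eq_sym.
have z1 : (rev_ord top1 == top2) = false by rewrite eq_sym.
have z2 : (rev_ord top2 == top1) = false by rewrite eq_sym.
have e02 : (a == top1) && (b == top1) && (b == rev_ord a) = false.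
  by case: (a =P top1) => [->|//]; case: (b =P top1) => [->|//]; rewrite r1.
have e12 : (a == top1) && (b == top2) && (b == rev_ord a) = false.
  by case: (a =P top1) => [->|//]; case: (b =P top2) => [->|//]; rewrite r2.
have e12' : (a == top2) && (b == top1) && (b == rev_ord a) = false.
  by case: (a =P top2) => [->|//]; case: (b =P top1) => [->|//]; rewrite r3.
have e01 : (a == top1) && (b == top1) && ((a == top1) && (b == top2)) = false.
  by case: (b =P top1) => [->|]; rewrite ?andbF // [top1 == top2]eq_sym t12
    !andbF.
have e01' : (a == top1) && (b == top1) && ((a == top2) && (b == top1)) = false.
  by case: (a =P top1) => [->|]; rewrite ?andbF // [top1 == top2]eq_sym t12
    !andbF.
move: e02 e12 e12' e01 e01'; rewrite /singular_entry.
move: jk; case: j k => [[|[|[|j]]] hj] [[|[|[|k]]] hk] //= _;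
  do 5![case: eqP => _ /= | move=> _] ; rewrite ?(mulr0, mul0r, subr0, sub0r,
    oppr0) //.
Qed.

Lemma w_eigen_pos (la : weight n) i : pos (w_eigen r s g la i).
Proof. by apply: (posM hpos); apply: pos_qpow. Qed.

(** For sp_{2n} half of the coefficients are negatives of cone elements; square lengths only involve
    their squares. *)
Lemma trivial_coef_sqr_pos a : pos (un a ^+ 2).
Proof.
rewrite /trivial_coef; case: ifP => _; first by do 2!apply: posX => //.
rewrite !exprMn; apply: (posM hpos); first apply: (posM hpos).
- have prs : pos (r / s) by apply/(posM hpos)/(posV hpos).
  case: (g); first exact: posX; last by rewrite expr1n; exact: (pos1 hpos).
  by rewrite sqrrN; apply: posX.
- by do 2!apply: posX => //.
- apply: posX => //; case: ifP => _; last exact: (pos1 hpos).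
  by apply: (posV hpos); apply: (posX hpos).
Qed.

Lemma singular_entry_sqr j a b : singular_entry r s hn j a b = 0 \/
  pos (singular_entry r s hn j a b ^+ 2).
Proof.
have p1 := pos1 hpos; rewrite /singular_entry; case: (val j) => [|[|l]].
- by case: andP => _; [right; rewrite expr1n | left].
- have [/andP[/eqP -> /eqP ->]|_] := boolP ((a == top1) && (b == top2)).
    by right; rewrite /= mulr0 subr0 expr1n.
  case: andP => _; [right | left].
    by rewrite /= sub0r mulr1 sqrrN; apply: posX => //; apply: w_eigen_pos.
  by rewrite /= mulr0 subr0.
- case: eqP => _; [right | left]; last by rewrite mul0r.
  by rewrite mul1r; apply: trivial_coef_sqr_pos.
Qed.

Lemma singular_vec_norm j : diag_form (tens_norm r s (g := g) (n := n)) (sv j)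
  (sv j) != 0.
Proof.
have term a b : tens_norm r s (ix a b) * sv j (ix a b) 0 * sv j (ix a b) 0 =
    tens_norm r s (ix a b) * singular_entry r s hn j a b ^+ 2.
  by rewrite singular_vecE -mulrA -expr2.
(* Each singular vector is normalised to have an entry 1 in the row of v_1, which supplies one
   nonzero term of the sum. *)
pose b0 := match val j with 0 => top1 | 1 => top2 | _ => rev_ord top1 end.
have e0 : singular_entry r s hn j top1 b0 = 1.
  rewrite /singular_entry /b0; case: (val j) => [|[|l]]; rewrite ?eqxx //=.
    by rewrite /= mulr0 subr0.
  by rewrite mul1r /trivial_coef /= (rank_gt0 hn) muln0 expr0.
apply: (pos_neq0 hpos); apply: (pos_sum hpos (i0 := ix top1 b0)).
- exact: mem_index_enum.
- rewrite term e0 expr1n mulr1; exact: (tens_norm_pos hpos pr ps).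
move=> k _; case: (mxtens_indexP k) => a b; rewrite term.
case: (singular_entry_sqr j a b) => [->|h]; first by left; rewrite expr0n mulr0.
by right; apply: (posM hpos) => //; apply: (tens_norm_pos hpos pr ps).
Qed.

(** The coefficients are the three entries of t that decide [singular_unique]. Each singular vector
    has 1 at its own position among them and 0 at the other two, so the difference vanishes. *)
Lemma singular_vec_span t : (forall i, act M (Ge i) t = 0) ->
  exists c : 'I_3 -> K, t = \sum_j c j *: sv j.
Proof.
move=> te; pose c (j : 'I_3) := match val j with
  | 0 => t (ix top1 top1) 0 | 1 => t (ix top1 top2) 0
  | _ => t (ix top1 (rev_ord top1)) 0 end.
exists c; apply/eqP; rewrite -subr_eq0; apply/eqP.
set u := \sum_j _; have uE b : u (ix top1 b) 0 = t (ix top1 top1) 0 * (b ==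
  top1)%:R +
    t (ix top1 top2) 0 * (b == top2)%:R +
    t (ix top1 (rev_ord top1)) 0 * (b == rev_ord top1)%:R.
  rewrite /u summxE !big_ord_recr big_ord0 /= !mxE !mxtens_indexK /c
    /singular_entry /=.
  rewrite /trivial_coef /= (rank_gt0 hn) muln0 expr0; ring.
have r1 : (top1 == rev_ord top1) = false.
  by apply/negbTE; rewrite -(inj_eq (@ord_inj _)) rev_ordE /=;
    have := dimV_gt1 hn; lia.
have r2 : (top2 == rev_ord top1) = false.
  apply/negbTE; rewrite -(inj_eq (@ord_inj _)) rev_ordE /=;
    have := rev_end2_top hn root1.
  by rewrite -(inj_eq (@ord_inj _)) rev_ordE /=; lia.
apply: (singular_unique hpos pr ps).
- move=> i; have uS : act M (Ge i) u = \sum_j c j *: act M (Ge i) (sv j).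
    by rewrite [LHS]linear_sum; apply: eq_bigr => j _; exact: linearZ.
  rewrite linearB te uS big1 ?subrr // => j _.
  by rewrite singular_vec_e scaler0.
- by rewrite !mxE uE eqxx r1 /= !(mulr0, addr0, mulr1) subrr.
- by rewrite !mxE uE eqxx r2 /= !(mulr0, addr0, add0r, mulr1) subrr.
- by rewrite !mxE uE eqxx ![rev_ord top1 == _]eq_sym r1 r2 /= !(mulr0, addr0,
  add0r, mulr1) subrr.
Qed.

Lemma tensor_square_decomposition : exists L1 L2 L3 : gmodule K n,
  [/\ is_L r s g (eps n 1 *+ 2) L1, is_L r s g (eps n 1 + eps n 2) L2,
      is_L r s g 0 L3 & isomorphic (VV r s g n) (dsum L1 (dsum L2 L3))].
Proof.
have nz (k : 'I_(N * N)) : tens_norm r s k != 0 := pos_neq0 hpos (tens_norm_pos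
  hpos pr ps k).
have VVp := VV_prelim hpos pr ps rs hn.
have ad := VV_ef_adj hpos pr ps rs hn.
have ad' x u v : toral x -> diag_form (tens_norm r s (g := g) (n := n)) (act M
  x u) v =
    diag_form (tens_norm r s (g := g) (n := n)) u (act M x v).
  exact: VV_toral_adj.
have sw j : has_weight (M := M) r s g (sv j) (singular_weight n j).
  exact: (singular_vec_weight hpos pr ps).
have lev (i : 'I_n) (k l : 'I_(N * N)) : rho2 (Ge i) k l != 0 ->
    (tens_level k < tens_level l)%N.
  by apply: (VV_e_level hpos pr ps rs hn).
have [U hU] := exists_f_span_vspace hpos pr ps VVp sw singular_vec_e.
have isL := piece_is_L hpos pr ps rs hn VVp nz ad ad' lev sw singular_vec_e
  singular_vec_orth
  singular_vec_norm singular_vec_span hU.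
pose j0 : 'I_3 := ord0; pose j1 : 'I_3 := Ordinal (isT : (1 < 3)%N).
pose j2 : 'I_3 := Ordinal (isT : (2 < 3)%N).
exists (sub_gmodule rho2 (U j0)), (sub_gmodule rho2 (U j1)),
  (sub_gmodule rho2 (U j2)).
split; [exact: (isL j0) | exact: (isL j1) | exact: (isL j2) |].
apply: (pieces_isomorphic hpos pr ps VVp ad ad' lev sw singular_vec_e
  singular_vec_orth
  singular_vec_norm singular_vec_span hU) => //.
by case=> [[|[|[|k]]] hk].
Qed.

End Assembly.

(** * Positivity at r = s = 1 *)

Section Positivity.

Variables (R : realType) (K : fieldType).
Variable iota : {rmorphism {fraction {poly {poly R[i]}}} -> K}.

Local Notation emb a := (iota (tofrac a)).

(** The outer variable is r and the inner one s, so [.[1].[1]] evaluates at r = s = 1; in [R[i]],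
    being greater than 0 means being real and positive. *)
Definition pos11 (x : K) : Prop := exists a b : {poly {poly R[i]}},
  [/\ 0 < a.[1].[1], 0 < b.[1].[1] & x = emb a / emb b].

Lemma emb_neq0 (a : {poly {poly R[i]}}) : 0 < a.[1].[1] -> emb a != 0.
Proof.
rewrite fmorph_eq0 tofrac_eq0; apply: contraTneq => ->.
by rewrite !horner0 ltxx.
Qed.

Lemma pos11_cone : pos_cone pos11.
Proof.
split.
- by move=> _ [a [b [a1 b1 ->]]]; rewrite mulf_neq0 ?invr_neq0 // emb_neq0.
- by exists 1, 1; rewrite !hornerC tofrac1 rmorph1 divr1 ltr01.
- move=> _ _ [a [b [a1 b1 ->]]] [c [d [e1 d1 ->]]].
  exists (a * d + c * b), (b * d); split.
  + by rewrite !(hornerD, hornerM) addr_gt0 // mulr_gt0.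
  + by rewrite !hornerM mulr_gt0.
  + by rewrite addf_div ?emb_neq0 // tofracD !tofracM rmorphD !rmorphM.
- move=> _ _ [a [b [a1 b1 ->]]] [c [d [e1 d1 ->]]].
  exists (a * c), (b * d); split; try by rewrite !hornerM mulr_gt0.
  by rewrite mulf_div !tofracM !rmorphM.
- by move=> _ [a [b [a1 b1 ->]]]; exists b, a; rewrite invf_div.
Qed.

Lemma pos11_poly (a : {poly {poly R[i]}}) : 0 < a.[1].[1] -> pos11 (emb a).
Proof.
by move=> a1; exists a, 1; rewrite !hornerC tofrac1 rmorph1 divr1 ltr01.
Qed.

End Positivity.

(* iota embeds C(r, s) = Frac(C[s][r]) into K *)
Theorem proposition3p9 (R : realType) (K : closedFieldType)
    (iota : {rmorphism {fraction {poly {poly R[i]}}} -> K})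
    (g : classical_type) (n : nat)
    (hn : (match g with TypeB => 1 | TypeC => 2 | TypeD => 3 end <= n)%N) :
  let r : K := iota (tofrac 'X) in
  let s : K := iota (tofrac 'X%:P) in
  exists L1 L2 L3 : gmodule K n,
    [/\ is_L r s g (eps n 1 *+ 2) L1,
        is_L r s g (eps n 1 + eps n 2) L2,
        is_L r s g 0 L3
      & isomorphic (VV r s g n) (dsum L1 (dsum L2 L3))].
Proof.
apply: (tensor_square_decomposition (pos11_cone iota)) => //.
- by apply: pos11_poly; rewrite hornerX hornerC ltr01.
- by apply: pos11_poly; rewrite hornerC hornerX ltr01.
(* As polynomials in the outer variable, r and s differ in the coefficient of degree 1. *)
rewrite (inj_eq (fmorph_inj _)) tofrac_eq; apply/eqP => /polyP/(_ 1%N).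
by rewrite coefX coefC /= => /eqP; rewrite oner_eq0.
Qed.
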